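(* Let $1\le p<\infty$, $1/p+1/p'=1$, $\mu_0\in\mathcal{M}$, and for each $\mu\in\mathcal{M}$ let $B(\mu)\colon(W^{n+r}_p)^m\to\mathbb{C}^{rm}$ be a continuous linear operator with canonical representation $$B(\mu)y=\sum_{s=0}^{n+r-1}\alpha_s(\mu)\,y^{(s)}(t_0)+\int_a^b\Phi(t,\mu)\,y^{(n+r)}(t)\,dt,\qquad y\in(W^{n+r}_p)^m,$$ where $t_0\in[a,b]$ is fixed, $\alpha_s(\mu)\in\mathbb{C}^{rm\times m}$ and $\Phi(\cdot,\mu)\in L_{p'}([a,b];\mathbb{C}^{rm\times m})$. Consider the following asymptotic conditions as $\mu\to\mu_0$: (a) $\alpha_s(\mu)\to\alpha_s(\mu_0)$ in $\mathbb{C}^{rm\times m}$ for every $s\in\{0,\ldots,n+r-1\}$; (b) $\|\Phi(\cdot,\mu)\|_{p'}=O(1)$; (c) $\int_a^t\Phi(\tau,\mu)\,d\tau\to\int_a^t\Phi(\tau,\mu_0)\,d\tau$ in $\mathbb{C}^{rm\times m}$ for all $t\in(a,b]$; (d) $\|\Phi(\cdot,\mu)-\Phi(\cdot,\mu_0)\|_{p'}\to0$. Then $B(\mu)$ converges strongly to $B(\mu_0)$ as $\mu\to\mu_0$ (that is, $B(\mu)y\to B(\mu_0)y$ for every $y\in(W^{n+r}_p)^m$) if and only if conditions (a), (b) and (c) hold. The convergence is uniform (that is, $\|B(\mu)-B(\mu_0)\|\to0$ in operator norm) if and only if (a) and (d) are satisfied.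
   Context: Let $(a,b)\subset\mathbb{R}$ be a finite interval, $n\in\mathbb{N}\cup\{0\}$, $m,r\in\mathbb{N}=\{1,2,\ldots\}$, and let $\mathcal{M}$ be an arbitrary metric space. $W^{k}_p=W^k_p([a,b];\mathbb{C})$ is the complex Sobolev space with norm $\|y\|_{k,p}=\sum_{s=0}^{k}\|y^{(s)}\|_{L_p}$. $(W^k_p)^m$ denotes the space of $\mathbb{C}^m$-valued (column) functions with all components in $W^k_p$. Norms of vector- and matrix-valued functions are the sums of the norms of their entries; $\|\cdot\|_{p'}$ is the norm in $L_{p'}$. For $1\le p<\infty$ and fixed $t_0\in[a,b]$, every bounded linear operator $(W^{n+r}_p)^m\to\mathbb{C}^{rm}$ has a unique representation of the displayed form, which is called its canonical representation. *)

(* Defs.v *)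
From HB Require Import structures.
From mathcomp Require Export all_boot all_order all_algebra.
From mathcomp Require Export complex.
From mathcomp Require Export all_classical all_reals all_analysis.

Set Implicit Arguments.
Unset Strict Implicit.
Unset Printing Implicit Defensive.

Import Order.TTheory GRing.Theory Num.Theory numFieldNormedType.Exports.

Local Open Scope classical_set_scope.
Local Open Scope ring_scope.
Local Open Scope complex_scope.

(* Functions on [a, b] are represented by total functions on R of which only
   the values on [a, b] matter. *)

Section Derivative.
Context {R : realType}.
Variables a b : R.

Definition diff_quot (f : R -> R) (x z : R) : R := (f z - f x) / (z - x).

(* One-sided at the endpoints a and b. *)
Definition real_derivable_at (f : R -> R) (x : R) : Prop :=
  cvg (diff_quot f x z @[z --> within `[a, b] x^']).

(* Total: the default value of lim where the limit does not exist. *)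
Definition real_deriv (f : R -> R) (x : R) : R :=
  lim (diff_quot f x z @[z --> within `[a, b] x^']).

Definition derivable_at (f : R -> R[i]) (x : R) : Prop :=
  real_derivable_at (fun t => complex.Re (f t)) x /\
  real_derivable_at (fun t => complex.Im (f t)) x.

Definition deriv (f : R -> R[i]) (x : R) : R[i] :=
  real_deriv (fun t => complex.Re (f t)) x +i*
  real_deriv (fun t => complex.Im (f t)) x.

Definition nderiv (s : nat) (f : R -> R[i]) : R -> R[i] := iter s deriv f.

Definition abs_cont (f : R -> R[i]) : Prop :=
  forall e : R, 0 < e -> exists2 d : R, 0 < d &
    forall (N : nat) (u v : 'I_N -> R),
      (forall i, [/\ a <= u i, u i <= v i & v i <= b]) ->
      trivIset setT (fun i => `]u i, v i[%classic) ->
      \sum_(i < N) (v i - u i) < d ->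
      \sum_(i < N) Normc.normc (f (v i) - f (u i)) < e.

End Derivative.

Section Lebesgue.
Context {R : realType}.
Variables a b : R.

Definition Lp_norm (q : \bar R) (f : R -> R[i]) : \bar R :=
  Lnorm lebesgue_measure q
    (fun t => (Normc.normc (f t) * \1_(`[a, b]%classic) t)%:E).

Definition in_Lp (q : \bar R) (f : R -> R[i]) : Prop :=
  [/\ measurable_fun `[a, b] (fun t => complex.Re (f t)),
      measurable_fun `[a, b] (fun t => complex.Im (f t)) &
      (Lp_norm q f < +oo)%E].

Definition mx_Lp_norm (q : \bar R) (k l : nat) (F : R -> 'M[R[i]]_(k, l)) :
    \bar R :=
  (\sum_(i < k) \sum_(j < l) Lp_norm q (fun t => F t i j))%E.

Definition mx_in_Lp (q : \bar R) (k l : nat) (F : R -> 'M[R[i]]_(k, l)) :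
    Prop :=
  forall i j, in_Lp q (fun t => F t i j).

End Lebesgue.

Definition cintegral {R : realType} (c d : R) (f : R -> R[i]) : R[i] :=
  (\int[lebesgue_measure]_(t in `[c, d]) complex.Re (f t)) +i*
  (\int[lebesgue_measure]_(t in `[c, d]) complex.Im (f t)).

Definition mx_integral {R : realType} (c d : R) (k l : nat)
    (F : R -> 'M[R[i]]_(k, l)) : 'M[R[i]]_(k, l) :=
  \matrix_(i, j) cintegral c d (fun t => F t i j).

Definition mx_norm1 {R : realType} (k l : nat) (A : 'M[R[i]]_(k, l)) : R :=
  \sum_(i < k) \sum_(j < l) Normc.normc (A i j).

Definition mx_cvg {R : realType} (M : metricType R) (k l : nat)
    (A : M -> 'M[R[i]]_(k, l)) (mu0 : M) : Prop :=
  mx_norm1 (A mu - A mu0) @[mu --> mu0] --> (0 : R).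

Section Sobolev.
Context {R : realType}.
Variables (a b : R) (p : R).

(* W^0_p = L_p; for k >= 1 a class in W^k_p is represented by its unique
   C^(k-1) member, for which y^(k-1) is absolutely continuous and y^(k), which
   exists almost everywhere, is in L_p. *)
Definition sobolev (k : nat) (f : R -> R[i]) : Prop :=
  match k with
  | 0 => in_Lp a b p%:E f
  | k'.+1 =>
    [/\ forall s, (s < k')%N ->
          forall x, x \in `[a, b] -> derivable_at a b (nderiv a b s f) x,
        abs_cont a b (nderiv a b k' f),
        {ae lebesgue_measure, forall x,
          x \in `[a, b] -> derivable_at a b (nderiv a b k' f) x} &
        in_Lp a b p%:E (nderiv a b k f)]
  end.

Variable m : nat.

Definition vderiv (s : nat) (y : R -> 'cV[R[i]]_m) (t : R) : 'cV[R[i]]_m :=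
  \col_i nderiv a b s (fun u => y u i 0) t.

Definition vsobolev (k : nat) : set (R -> 'cV[R[i]]_m) :=
  [set y | forall i, sobolev k (fun t => y t i 0)].

Definition sobolev_norm (k : nat) (y : R -> 'cV[R[i]]_m) : \bar R :=
  (\sum_(s < k.+1) mx_Lp_norm a b p%:E (vderiv s y))%E.

(* Linearity and boundedness force B y to depend only on the restriction of y
   to [a, b]; the values of B outside W^k_p are irrelevant. *)
Definition bounded_linear (k l : nat)
    (B : (R -> 'cV[R[i]]_m) -> 'cV[R[i]]_l) : Prop :=
  (forall (c : R[i]) y z, vsobolev k y -> vsobolev k z ->
     B (fun t => c *: y t + z t) = c *: B y + B z) /\
  (exists C : R, forall y, vsobolev k y ->
     ((mx_norm1 (B y))%:E <= C%:E * sobolev_norm k y)%E).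

Definition op_norm (k l : nat) (B : (R -> 'cV[R[i]]_m) -> 'cV[R[i]]_l) :
    \bar R :=
  ereal_sup [set (mx_norm1 (B y))%:E | y in
    [set y | vsobolev k y /\ (sobolev_norm k y <= 1)%E]].

Definition canonical_repr (k l : nat) (t0 : R)
    (B : (R -> 'cV[R[i]]_m) -> 'cV[R[i]]_l)
    (alpha : 'I_k -> 'M[R[i]]_(l, m)) (Phi : R -> 'M[R[i]]_(l, m)) : Prop :=
  forall y, vsobolev k y ->
    B y = \sum_(s < k) alpha s *m vderiv s y t0 +
          mx_integral a b (fun t => Phi t *m vderiv k y t).

End Sobolev.

(* Main.v *)
Require Import Defs.
From mathcomp Require Import measurable_realfun ess_sup_inf ring lra.

(* Subtracting [B mu0] reduces everything to convergence to zero of operators in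
   canonical form, with coefficients [A mu = alpha mu - alpha mu0] and kernel
   [Psi mu = Phi mu - Phi mu0].

   Testing such an operator on (t - t0)^s e_j reads off, up to the factor s!, the
   columns of the coefficients, whence (a). Testing it on the iterated
   primitive y of f in L_p that vanishes at t0 to full order reads off the
   integral of [Psi mu] f, because the highest derivative of y is f almost
   everywhere. So strong convergence amounts to (a) together with weak
   convergence to zero of the entries of [Psi mu] as functionals on L_p. The
   latter implies (b) by uniform boundedness, applied to a sequence tending to
   mu0, and (c) by taking indicators of intervals for f. Conversely, (c) settles
   indicators of intervals, hence of Borel sets by Dynkin's pi-lambda theorem,
   and (b) extends the convergence to all of L_p by density.

   For uniform convergence, (d) follows by taking for f an almost norming
   element of L_p for each entry of [Psi mu]. In the converse direction the
   Sobolev embedding is not needed: each B mu being bounded, the point-evaluation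
   part of the difference is bounded too, and the bounded combinations of
   finitely many functionals are bounded uniformly in terms of their
   coefficients. *)

Set Implicit Arguments.
Unset Strict Implicit.
Unset Printing Implicit Defensive.

Import Order.TTheory GRing.Theory Num.Theory numFieldNormedType.Exports.

Local Open Scope classical_set_scope.
Local Open Scope ring_scope.

(** The obstacle that shapes the construction of test functions is that [deriv] is a limit with a
    default value. The highest derivative of a test function is known only almost everywhere, yet
    [in_Lp] demands Borel measurability of that very function. The lower derivatives hold at every
    point of the interval, so a test function is described by a chain of real functions, each the
    derivative of its predecessor. All analysis is done on real functions on the line, extended by
    zero outside [a, b]. Complex kernels enter through their real and imaginary parts, which a real
    test function reads off separately. Uniform boundedness comes from a walk with geometrically
    decreasing steps: it needs one convergent series in L_p and, for every kernel, a nearly norming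
    function, also at the exponent +oo. The scaling [c] of the test functions does not depend on the
    function f they integrate, since one constant has to bound every kernel by the operator norm. *)

(** * Real L_p functions, Hölder's inequality and the pairing *)

Section Lp_functions.
Context d (T : measurableType d) (R : realType).
Variable mu : {measure set T -> \bar R}.
Implicit Types (f g : T -> R) (p q : \bar R).

Definition Lp_fun p f : Prop :=
  measurable_fun setT f /\ (Lnorm mu p (EFin \o f) < +oo)%E.

(** [fine] sends an infinite norm to 0, so this value carries information only together with
    [Lp_fun]; being real, it can be used in linear arithmetic. *)
Definition Lp_val p f : R := fine (Lnorm mu p (EFin \o f)).

Definition pairing f g : R := \int[mu]_x (f x * g x).

Lemma Lp_valE p f : Lp_fun p f -> Lnorm mu p (EFin \o f) = (Lp_val p f)%:E.
Proof.
by case=> _ ffin; rewrite /Lp_val fineK// ge0_fin_numE// Lnorm_ge0.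
Qed.

Lemma Lp_val_ge0 p f : 0 <= Lp_val p f.
Proof. by rewrite /Lp_val fine_ge0// Lnorm_ge0. Qed.

Lemma Lnorm_le_ae p f g : (1 <= p)%E ->
  measurable_fun setT f -> measurable_fun setT g ->
  {ae mu, forall x, `|f x| <= `|g x|} ->
  (Lnorm mu p (EFin \o f) <= Lnorm mu p (EFin \o g))%E.
Proof.
case: p => [r| |]//; rewrite ?lee_fin => r1 mf mg fg; rewrite unlock /Lnorm.
- have r0 : 0 < r by rewrite (lt_le_trans ltr01).
  apply: gt0_ler_poweR; rewrite ?invr_ge0 ?(ltW r0)//.
  + by rewrite in_itv/= leey andbT; apply: integral_ge0 => x _ /=; rewrite lee_fin powR_ge0.
  + by rewrite in_itv/= leey andbT; apply: integral_ge0 => x _ /=; rewrite lee_fin powR_ge0.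
  + have mp (h : T -> R) : measurable_fun setT h ->
        measurable_fun setT (fun x => `|h x| `^ r).
      move=> mh.
      apply: (@measurableT_comp _ _ _ _ _ _ (@powR R ^~ r)) => //.
      exact: measurableT_comp.
    apply: ae_ge0_le_integral => //=; try exact/measurable_EFinP/mp.
    apply: filterS fg => x fgx _; rewrite lee_fin.
    by apply: ge0_ler_powR; rewrite ?nnegrE// ltW.
- case: ifPn => // _; apply: le_ess_sup.
  by apply: filterS fg => x /= fgx; rewrite lee_fin.
Qed.

Lemma Lp_fun_le p f g : (1 <= p)%E -> measurable_fun setT f -> Lp_fun p g ->
  {ae mu, forall x, `|f x| <= `|g x|} -> Lp_fun p f /\ Lp_val p f <= Lp_val p g.
Proof.
move=> p1 mf pg fg; have [mg gfin] := pg.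
have le_fg := Lnorm_le_ae p1 mf mg fg.
have pf : Lp_fun p f by split=> //; exact: le_lt_trans le_fg gfin.
by split=> //; rewrite -lee_fin -!Lp_valE.
Qed.

Lemma Lp_funZ p (c : R) f : (1 <= p)%E -> Lp_fun p f ->
  Lp_fun p (fun x => c * f x) /\ Lp_val p (fun x => c * f x) = `|c| * Lp_val p f.
Proof.
move=> p1 pf; have [mf ffin] := pf.
have fL : f \in Lfun mu p by rewrite inE; apply/andP; split; rewrite inE.
have := LnormZ (Lfun_Sub p1 fL) c; rewrite /= => cfE.
have cE : EFin \o (c \*: f) = EFin \o (fun x => c * f x) by [].
rewrite cE in cfE.
split; last by rewrite /Lp_val cfE Lp_valE//= -EFinM.
split; first exact: measurable_funM.
by rewrite cfE Lp_valE// -EFinM ltry.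
Qed.

Lemma Lp_funD p f g : (1 <= p)%E -> Lp_fun p f -> Lp_fun p g ->
  Lp_fun p (fun x => f x + g x) /\
  Lp_val p (fun x => f x + g x) <= Lp_val p f + Lp_val p g.
Proof.
move=> p1 pf pg; have [[mf ffin] [mg gfin]] := (pf, pg).
have le_fg := eminkowski mu mf mg p1.
rewrite (Lp_valE pf) (Lp_valE pg) -EFinD in le_fg.
have pfg : Lp_fun p (f \+ g).
  by split; [exact: measurable_funD|exact: le_lt_trans le_fg (ltry _)].
by split=> //; rewrite -lee_fin -Lp_valE.
Qed.

Lemma Lp_fun0 p : (1 <= p)%E -> Lp_fun p (fun=> 0) /\ Lp_val p (fun=> 0) = 0.
Proof.
move=> p1; have E := @Lnorm0 _ T R mu p; have p0 : p != 0.
  by rewrite gt_eqF// (lt_le_trans lte01).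
have {}E : (Lnorm mu p (EFin \o (fun=> 0%R : R)) = 0)%E by exact: E.
by split; [split; [exact: measurable_cst|rewrite E]|rewrite /Lp_val E].
Qed.

Lemma Linf_ae f : Lp_fun +oo f -> {ae mu, forall x, `|f x| <= Lp_val +oo f}.
Proof.
move=> pf; have [mf _] := pf; have := Lp_valE pf.
rewrite unlock /Lnorm; case: ifPn => [mu0 fE|mu0 _].
  have := ess_sup_ge mu (abse \o (EFin \o f)).
  by apply: filterS => x /=; rewrite fE lee_fin.
(* On a null space the norm at +oo is 0 by convention and bounds nothing pointwise, but the whole
   space is then a negligible exceptional set. *)
exists setT; split => //.
by apply/eqP; rewrite eq_le measure_ge0 andbT leNgt.
Qed.

(** The extended inverse sends +oo to 0, and the equation excludes 0 and -oo as values of [q]. A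
    finite [q] then forces 1/p < 1, whence both exponents exceed 1. *)
Lemma conj_exponents (p : R) q : 1 <= p -> (p%:E^-1 + q^-1 = 1)%E ->
  (p = 1 /\ q = +oo%E) \/
  exists r, [/\ q = r%:E, 1 < p, 1 < r & p^-1 + r^-1 = 1].
Proof.
move=> p1; have p0 : 0 < p by rewrite (lt_le_trans ltr01).
rewrite /inve gt_eqF//; case: q => [r| |] //=; last first.
- move=> /eqP; rewrite adde0 eqe => /eqP pV; left; split=> //.
  by rewrite -[p]invrK pV invr1.
- case: eqP => [//|/eqP r0] /eqP; rewrite -EFinD eqe => /eqP pr; right.
  exists r; have p1' : 1 < p.
    rewrite lt_neqAle p1 andbT; apply: contra_neqN r0 => /eqP p1E.
    move: pr; rewrite -p1E invr1 => pr.
    have /eqP : r^-1 = 0 by lra.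
    by rewrite invr_eq0 => /eqP.
  have rV : r^-1 = 1 - p^-1 by rewrite -pr addrC addKr.
  have pV : p^-1 < 1 by rewrite invf_lt1.
  have r0' : 0 < r by rewrite -invr_gt0 rV subr_gt0.
  by split=> //; rewrite -[ltLHS]invr1 -ltf_pV2 ?posrE ?invr1// rV gtrBl invr_gt0.
Qed.

Lemma conj_ge1 (p : R) q : 1 <= p -> (p%:E^-1 + q^-1 = 1)%E -> (1 <= q)%E.
Proof.
move=> p1 /(conj_exponents p1)[[_ ->]|[r [-> _ r1 _]]]; first exact: leey.
by rewrite lee_fin ltW.
Qed.

(** Hölder's inequality; for p = 1 it reduces to the almost everywhere bound of [g] by its essential
    supremum. *)
Lemma Lnorm1_mul_le (p : R) q f g : 1 <= p -> (p%:E^-1 + q^-1 = 1)%E ->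
  Lp_fun p%:E f -> Lp_fun q g ->
  (Lnorm mu 1 (EFin \o (g \* f)%R) <= (Lp_val q g * Lp_val p%:E f)%R%:E)%E.
Proof.
move=> p1 pq pf pg; have [[mf _] [mg _]] := (pf, pg).
have [[pE qE]|[r [qE p1' r1 pr]]] := conj_exponents p1 pq; last first.
  rewrite EFinM -!Lp_valE// qE.
  apply: hoelder => //; rewrite ?(lt_trans ltr01)//.
  by rewrite addrC.
rewrite {}qE {}pE in pf pg *.
rewrite EFinM -(Lp_valE pf) !Lnorm1 -ge0_integralZl//=; last 2 first.
- by apply/measurable_EFinP; exact: measurableT_comp.
- by rewrite lee_fin Lp_val_ge0.
apply: ae_ge0_le_integral => //=.
- by do 2 apply: measurableT_comp => //; exact: measurable_funM.
- by move=> x _; rewrite mule_ge0// lee_fin Lp_val_ge0.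
- by apply: emeasurable_funM => //; apply/measurable_EFinP; exact: measurableT_comp.
- apply: filterS (Linf_ae pg) => x gx _.
  by rewrite -EFinM lee_fin normrM ler_wpM2r.
Qed.

Lemma pairing_integrable (p : R) q f g : 1 <= p -> (p%:E^-1 + q^-1 = 1)%E ->
  Lp_fun p%:E f -> Lp_fun q g -> mu.-integrable setT (EFin \o (g \* f)).
Proof.
move=> p1 pq pf pg; have [[mf _] [mg _]] := (pf, pg).
apply/Lfun1_integrable; rewrite inE; apply/andP; split; rewrite inE/=.
  exact: measurable_funM.
exact: le_lt_trans (Lnorm1_mul_le p1 pq pf pg) (ltry _).
Qed.

Lemma pairing_le (p : R) q f g : 1 <= p -> (p%:E^-1 + q^-1 = 1)%E ->
  Lp_fun p%:E f -> Lp_fun q g ->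
  `|pairing g f| <= Lp_val q g * Lp_val p%:E f.
Proof.
move=> p1 pq pf pg; have ifg := pairing_integrable p1 pq pf pg.
rewrite -lee_fin EFin_normr_Rintegral//.
apply: le_trans (Lnorm1_mul_le p1 pq pf pg); rewrite Lnorm1.
by apply: le_abse_integral => //; case/integrableP : ifg.
Qed.

Lemma pairingD (p : R) q f1 f2 g : 1 <= p -> (p%:E^-1 + q^-1 = 1)%E ->
  Lp_fun p%:E f1 -> Lp_fun p%:E f2 -> Lp_fun q g ->
  pairing g (fun x => f1 x + f2 x) = pairing g f1 + pairing g f2.
Proof.
move=> p1 pq pf1 pf2 pg; rewrite /pairing -RintegralD//.
- by apply: eq_Rintegral => x _; rewrite mulrDr.
- exact: (pairing_integrable p1 pq).
- exact: (pairing_integrable p1 pq).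
Qed.

Lemma pairingZ (p : R) q (c : R) f g : 1 <= p -> (p%:E^-1 + q^-1 = 1)%E ->
  Lp_fun p%:E f -> Lp_fun q g ->
  pairing g (fun x => c * f x) = c * pairing g f.
Proof.
move=> p1 pq pf pg; rewrite /pairing -RintegralZl//.
- by apply: eq_Rintegral => x _; rewrite mulrCA.
- exact: (pairing_integrable p1 pq).
Qed.

End Lp_functions.

(** * Indicators of sets of finite measure *)

Section indicator.
Context d (T : measurableType d) (R : realType).
Variable mu : {measure set T -> \bar R}.

Lemma integrable_indic_lty (A : set T) : measurable A -> (mu A < +oo)%E ->
  mu.-integrable setT (EFin \o (\1_A : T -> R)).
Proof.
move=> mA Aoo; apply/integrableP; split.
  by apply/measurable_EFinP; exact: measurable_indic.
under eq_integral do rewrite /= ger0_norm//.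
by rewrite integral_indic// setIT.
Qed.

Lemma Lnorm_indic (p : R) (A : set T) : 1 <= p -> measurable A ->
  (Lnorm mu p%:E (EFin \o (\1_A : T -> R)) = mu A `^ p^-1)%E.
Proof.
move=> p1 mA; rewrite unlock /Lnorm; congr (_ `^ _)%E.
rewrite -[in RHS](setIT A) -integral_indic//.
apply: eq_integral => x _; rewrite /= indicE; case: (x \in A).
  by rewrite normr1 powR1.
by rewrite normr0 powR0// gt_eqF// (lt_le_trans ltr01).
Qed.

Lemma Lp_fun_indic (p : R) (A : set T) : 1 <= p -> measurable A ->
  (mu A < +oo)%E -> Lp_fun mu p%:E (\1_A : T -> R).
Proof.
move=> p1 mA Aoo; split; first exact: measurable_indic.
by rewrite Lnorm_indic// poweR_lty.
Qed.

End indicator.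

(** * Nearly norming functions for L_q *)

Section dual_witness.
Context d (T : measurableType d) (R : realType).
Variable mu : {measure set T -> \bar R}.
Variables (I : set T).
Hypotheses (mI : measurable I) (Ioo : (mu I < +oo)%E).
Implicit Types (f g phi : T -> R).

Lemma measurable_gtr phi (c : R) : measurable_fun setT phi ->
  measurable [set x | c < phi x].
Proof.
move=> mphi; have := mphi measurableT _ (measurable_itv `]c, +oo[).
by rewrite setTI; congr measurable; apply/seteqP; split=> x /=;
  rewrite in_itv/= andbT.
Qed.

(** The witness is the indicator of {phi > c} divided by the measure of that set. The measure is
    finite because c >= 0 and [phiI] place the set inside [I]. *)
Let Linf_witness_pos phi (c : R) : Lp_fun mu +oo phi ->
  (forall x, ~ I x -> phi x = 0) -> 0 <= c -> (0 < mu [set x | (c < phi x)%R])%E ->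
  exists u, [/\ Lp_fun mu 1 u, Lp_val mu 1 u <= 1 & c <= pairing mu phi u].
Proof.
move=> pphi phiI c0; set E := [set x | c < phi x] => E0.
have mphi : measurable_fun setT phi by case: pphi.
have mE : measurable E by exact: measurable_gtr.
have EI : E `<=` I.
  move=> x; rewrite /E/= => cphi; apply: contrapT => /phiI phi0.
  by move: cphi; rewrite phi0 ltNge c0.
have Eoo : (mu E < +oo)%E by apply: le_lt_trans Ioo; exact: le_measure (mem_set mE) (mem_set mI) EI.
have muEE : mu E = (fine (mu E))%:E by rewrite fineK// ge0_fin_numE.
set m := fine (mu E) in muEE; have m0 : 0 < m by rewrite -lte_fin -muEE.
pose u x := m^-1 * \1_E x.
have iE : mu.-integrable setT (EFin \o (\1_E : T -> R)) by exact: integrable_indic_lty.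
have intE : \int[mu]_x (\1_E x : R) = m.
  by rewrite /Rintegral integral_indic// setIT muEE.
have mu1 : measurable_fun setT u.
  by apply: measurable_funM => //; exact: measurable_indic.
have iu : mu.-integrable setT (EFin \o u).
  by apply: (integrableZl measurableT m^-1 iE).
have intu : \int[mu]_x u x = 1 by rewrite RintegralZl// intE mulVf// gt_eqF.
have u0 x : 0 <= u x by rewrite mulr_ge0// invr_ge0 ltW.
have N1u : Lnorm mu 1 (EFin \o u) = 1%E.
  rewrite Lnorm1; under eq_integral do rewrite /= ger0_norm//.
  by rewrite -[LHS]fineK ?[fine _]intu//; exact: integrable_fin_num.
have pu : Lp_fun mu 1 u by split=> //; rewrite N1u ltry.
exists u; split=> //; first by rewrite /Lp_val N1u.
have -> : c = \int[mu]_x (c * u x) by rewrite RintegralZl// intu mulr1.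
apply: le_Rintegral => //.
- exact: (integrableZl measurableT c iu).
- by apply: (@pairing_integrable _ _ _ mu 1 +oo%E) => //; rewrite /inve /= oner_eq0 invr1 adde0.
- move=> x _; rewrite /u indicE; have [|] := boolP (x \in E).
    by rewrite inE /E/= => /ltW cx; rewrite ler_wpM2r// mulr1 invr_ge0 ltW.
  by rewrite !mulr0.
Qed.

(** If {phi > c} and {-phi > c} were both null, c would bound |phi| almost everywhere and hence the
    norm. So one of them has positive measure, up to the sign of [phi]. *)
Let Linf_witness phi (c : R) : Lp_fun mu +oo phi ->
  (forall x, ~ I x -> phi x = 0) -> 0 <= c -> c < Lp_val mu +oo phi ->
  exists u, [/\ Lp_fun mu 1 u, Lp_val mu 1 u <= 1 & c <= pairing mu phi u].
Proof.
move=> pphi phiI c0 cphi; have mphi : measurable_fun setT phi by case: pphi.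
have [E0|E0] := ltP 0%E (mu [set x | (c < phi x)%R]); first exact: Linf_witness_pos.
have [F0|F0] := ltP 0%E (mu [set x | (c < - phi x)%R]).
  have /Lp_funZ-/(_ (-1) (leey _))[] := pphi => pNphi _.
  have NE : (fun x => -1 * phi x) = (fun x => - phi x).
    by apply/funext => x; rewrite mulN1r.
  rewrite NE in pNphi.
  have [|u [pu u1 cu]] := @Linf_witness_pos _ c pNphi _ c0 F0.
    by move=> x /phiI ->; rewrite oppr0.
  have [pNu NuE] := Lp_funZ (-1) (lexx _) pu.
  exists (fun x => -1 * u x); split=> //; first by rewrite NuE normrN1 mul1r.
  rewrite (_ : pairing mu phi _ = pairing mu (fun x => - phi x) u)//.
  by apply: eq_Rintegral => x _; rewrite mulN1r mulrN mulNr.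
exfalso; move: cphi; apply/negP; rewrite -leNgt -lee_fin -Lp_valE//.
rewrite unlock /Lnorm; case: ifPn => // _.
apply/ess_supP.
have mE : measurable [set x | c < phi x] by exact: measurable_gtr.
have mF : measurable [set x | c < - phi x].
  by apply: measurable_gtr; exact: measurableT_comp.
exists ([set x | c < phi x] `|` [set x | c < - phi x]); split.
- exact: measurableU.
- apply/eqP; rewrite eq_le measure_ge0 andbT.
  apply: le_trans (measureU2 _ mE mF) _.
  by rewrite -[leRHS]adde0; apply: leeD.
- move=> x /= /negP; rewrite lee_fin -ltNge ltr_normr => /orP[|]; [left|right] => //.
Qed.

(** The equality case of Hölder's inequality: as (r - 1) p = r, the power |u|^p is proportional to
    |phi|^r, and [K] is the factor that gives [u] norm one. *)
Let Lr_witness (p r : R) phi : 1 < p -> 1 < r -> p^-1 + r^-1 = 1 ->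
  Lp_fun mu r%:E phi -> 0 < Lp_val mu r%:E phi ->
  exists u, [/\ Lp_fun mu p%:E u, Lp_val mu p%:E u <= 1 &
    Lp_val mu r%:E phi <= pairing mu phi u].
Proof.
move=> p1 r1 pr pphi; set N := Lp_val _ _ _ => N0.
have [mphi _] := pphi.
have [p0 r0] : 0 < p /\ 0 < r by split; exact: lt_trans ltr01 _.
have r10 : 0 < r - 1 by rewrite subr_gt0.
have rp : (r - 1) * p = r.
  have : (p^-1 + r^-1) * (p * r) = p * r by rewrite pr mul1r.
  rewrite mulrDl mulrA mulVf ?gt_eqF// mul1r mulrCA mulVf ?gt_eqF// mulr1 => E.
  by rewrite mulrBl mul1r mulrC -E addrK.
pose K := N `^ (r - 1); have K0 : 0 < K by exact: powR_gt0.
have mpow a (f : T -> R) : measurable_fun setT f -> measurable_fun setT (fun x => `|f x| `^ a).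
  move=> mf; apply: (@measurableT_comp _ _ _ _ _ _ (@powR R ^~ a)) => //.
  exact: measurableT_comp.
have intphi : (\int[mu]_x (`|phi x| `^ r)%:E)%E = (N `^ r)%:E.
  have := @poweR_Lnorm _ _ _ mu (EFin \o phi) r; rewrite gt_eqF// => /(_ isT).
  by rewrite Lp_valE// poweR_EFin => ->.
(* This is sgn(phi) |phi|^(r-1) / K without a sign function. The exponent r - 2 may be negative, but
   the factor [phi x] makes the value 0 at the zeros of [phi]. *)
pose u x := K^-1 * (phi x * `|phi x| `^ (r - 1 - 1)).
have mu1 : measurable_fun setT u.
  by apply: measurable_funM => //; apply: measurable_funM => //; exact: mpow.
have uN x : `|u x| = K^-1 * `|phi x| `^ (r - 1).
  rewrite /u normrM gtr0_norm ?invr_gt0// normrM [X in _ * (_ * X)]ger0_norm ?powR_ge0//.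
  by rewrite mulr_powRB1.
have uphi x : phi x * u x = K^-1 * `|phi x| `^ r.
  have sq : phi x * phi x = `|phi x| * `|phi x|.
    by rewrite -normrM ger0_norm// -expr2 sqr_ge0.
  rewrite /u mulrCA; congr (_ * _).
  by rewrite mulrA sq -mulrA mulr_powRB1// mulr_powRB1.
have KK : K `^ p = N `^ r by rewrite /K -powRrM rp.
have up x : `|u x| `^ p = (N `^ r)^-1 * `|phi x| `^ r.
  rewrite uN powRM ?invr_ge0 ?(ltW K0)// ?powR_ge0//.
  by rewrite -powRrM rp -(powR_inv1 (ltW K0)) powRAC KK powR_inv1 ?powR_ge0.
have Nr0 : 0 < N `^ r by exact: powR_gt0.
have Nu : Lnorm mu p%:E (EFin \o u) = 1%E.
  rewrite unlock /Lnorm.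
  under eq_integral do rewrite /= up EFinM.
  rewrite ge0_integralZl_EFin//; last 2 first.
  - by apply/measurable_EFinP; exact: mpow.
  - by rewrite invr_ge0 ltW.
  by rewrite intphi -EFinM mulVf ?gt_eqF// poweR_EFin powR1.
exists u; split; [by split=> //; rewrite Nu ltry|by rewrite /Lp_val Nu|].
rewrite /pairing; under eq_Rintegral do rewrite uphi.
have iphi : mu.-integrable setT (EFin \o (fun x => `|phi x| `^ r)).
  apply/integrableP; split; first by apply/measurable_EFinP; exact: mpow.
  under eq_integral do rewrite /= ger0_norm ?powR_ge0//.
  by rewrite intphi ltry.
rewrite RintegralZl// /Rintegral intphi /= -(mulr_powRB1 (ltW N0) r0).
by rewrite mulrCA mulVf ?mulr1// gt_eqF.
Qed.

(** The norm is attained for finite [q] but only approached for q = +oo, which is why [c] lies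
    strictly below it. A negative [c] is served by the zero function. *)
Lemma dual_witness (p : R) (q : \bar R) phi (c : R) :
  1 <= p -> (p%:E^-1 + q^-1 = 1)%E -> Lp_fun mu q phi ->
  (forall x, ~ I x -> phi x = 0) -> c < Lp_val mu q phi ->
  exists u, [/\ Lp_fun mu p%:E u, Lp_val mu p%:E u <= 1 & c <= pairing mu phi u].
Proof.
move=> p1 pq pphi phiI cphi; have [c0|c0] := ltP c 0.
  have [p0 p0E] := @Lp_fun0 _ _ _ mu p%:E p1.
  exists (fun=> 0); split=> //; first by rewrite p0E.
  rewrite /pairing; under eq_Rintegral do rewrite mulr0.
  by rewrite Rintegral_cst// mul0r ltW.
have [[pE qE]|[r [qE p1' r1 pr]]] := conj_exponents p1 pq.
  by rewrite {}pE {}qE in pphi cphi *; exact: Linf_witness.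
rewrite {}qE in pphi cphi *.
have [u [pu u1 cu]] := Lr_witness p1' r1 pr pphi (le_lt_trans c0 cphi).
by exists u; split=> //; exact: le_trans (ltW cphi) cu.
Qed.

End dual_witness.

(** * Geometrically dominated series in L_p *)

Section Lp_series.
Context d (T : measurableType d) (R : realType).
Variable mu : {measure set T -> \bar R}.
Variable p : R.
Hypothesis p1 : 1 <= p.
Implicit Types f g : T -> R.

Let p0 : 0 < p. Proof. exact: lt_le_trans ltr01 p1. Qed.

Let p1e : (1 <= p%:E)%E. Proof. by rewrite lee_fin. Qed.

Let Lp := Lp_fun mu p%:E.
Let nLp := Lp_val mu p%:E.

Let measurable_normX (f : T -> R) : measurable_fun setT f ->
  measurable_fun setT (fun x => `|f x| `^ p).
Proof.
move=> mf; apply: (@measurableT_comp _ _ _ _ _ _ (@powR R ^~ p)) => //.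
exact: measurableT_comp.
Qed.

Lemma int_normX f : Lp f ->
  (\int[mu]_x (`|f x| `^ p)%:E)%E = (nLp f `^ p)%:E.
Proof.
move=> pf; have := @poweR_Lnorm _ _ _ mu (EFin \o f) p.
by rewrite gt_eqF// => /(_ isT); rewrite Lp_valE// poweR_EFin => ->.
Qed.

Lemma Lp_fun_intX f (C : R) : 0 <= C -> measurable_fun setT f ->
  (\int[mu]_x (`|f x| `^ p)%:E <= (C `^ p)%R%:E)%E -> Lp f /\ nLp f <= C.
Proof.
move=> C0 mf fC; have NC : (Lnorm mu p%:E (EFin \o f) <= C%:E)%E.
  rewrite unlock /Lnorm.
  have -> : C%:E = ((C `^ p)%:E `^ p^-1)%E.
    by rewrite poweR_EFin -powRrM mulfV ?gt_eqF// powRr1.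
  apply: gt0_ler_poweR => //; rewrite ?in_itv/= ?leey ?andbT.
  - by rewrite invr_ge0 ltW.
  - by apply: integral_ge0 => x _; rewrite /= lee_fin powR_ge0.
  - by rewrite lee_fin powR_ge0.
have pf : Lp f by split=> //; exact: le_lt_trans NC (ltry _).
by split=> //; rewrite -lee_fin -Lp_valE.
Qed.

(** Monotone convergence of the p-th powers makes the limit integrable, hence finite on a set [D]
    with null complement. The last clause transfers the bound to any [f] whose modulus is at most
    the supremum of the [S k] on [D], without naming that supremum. *)
Lemma monotone_Lp (S : nat -> T -> R) (C : R) : 0 <= C ->
  (forall k x, 0 <= S k x) -> (forall k x, S k x <= S k.+1 x) ->
  (forall k, Lp (S k)) -> (forall k, nLp (S k) <= C) ->
  exists D, [/\ measurable D, mu (~` D) = 0,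
    forall x, D x -> exists B, forall k, S k x <= B &
    forall f, measurable_fun setT f ->
      (forall x B, D x -> (forall k, S k x <= B) -> `|f x| <= B) ->
      Lp f /\ nLp f <= C].
Proof.
move=> C0 S0 Sinc pS SC.
have mS k : measurable_fun setT (S k) by case: (pS k).
pose g k x : \bar R := (`|S k x| `^ p)%:E.
have g0 k x : (0 <= g k x)%E by rewrite lee_fin powR_ge0.
have mg k : measurable_fun setT (g k).
  by apply/measurable_EFinP; exact: measurable_normX.
have Shomo x : {homo S^~ x : n m / (n <= m)%N >-> n <= m}.
  by apply: homo_leq => //= k; exact: le_trans.
have ghomo x : {homo g^~ x : n m / (n <= m)%N >-> (n <= m)%E}.
  move=> n m nm; rewrite lee_fin; apply: ge0_ler_powR; rewrite ?nnegrE ?(ltW p0)//.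
  by rewrite !ger0_norm//; exact: Shomo.
pose H x := limn (g^~ x).
have gH k x : (g k x <= H x)%E.
  rewrite /H (cvg_lim _ (@ereal_nondecreasing_cvgn _ (g^~ x) _))//.
  by apply: ereal_sup_ubound; exists k.
have H0 x : (0 <= H x)%E := le_trans (g0 0%N x) (gH 0%N x).
have mH : measurable_fun setT H.
  apply: (emeasurable_fun_cvg g) => // x _.
  exact: ereal_nondecreasing_is_cvgn.
have intH : (\int[mu]_x H x <= (C `^ p)%R%:E)%E.
  have cv := @cvg_monotone_convergence _ _ _ mu setT measurableT g mg
    (fun n x _ => g0 n x) (fun x _ => ghomo x).
  rewrite -(cvg_lim _ cv)//; apply: lime_le; first by apply/cvg_ex; eexists; exact: cv.
  near=> k; rewrite int_normX// lee_fin; apply: ge0_ler_powR; rewrite ?nnegrE ?(ltW p0)//.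
  exact: Lp_val_ge0.
pose D := [set x | (H x < +oo)%E].
have mD : measurable D.
  by rewrite /D -[X in measurable X]setTI; exact: emeasurable_fun_infty_o.
have D0 : mu (~` D) = 0.
  have iH : mu.-integrable setT H.
    apply/integrableP; split=> //.
    by under eq_integral do rewrite gee0_abs//; exact: le_lt_trans intH (ltry _).
  have [N [mN N0 HN]] := integrable_ae measurableT iH.
  apply/eqP; rewrite eq_le measure_ge0 andbT -N0.
  apply: le_measure; rewrite ?inE//; first exact: measurableC.
  move=> x Dx; apply: HN => /= /(_ I) Hfin; apply: Dx.
  by rewrite /D /= -ge0_fin_numE.
have fH0 x : 0 <= fine (H x) by exact: fine_ge0.
have SB k x : D x -> S k x <= fine (H x) `^ p^-1.
  move=> Dx; have := gH k x; rewrite -[H x]fineK ?ge0_fin_numE// lee_fin => le_gH.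
  rewrite -[leLHS]ger0_norm// -[leLHS]powRr1// -(mulfV (negbT (gt_eqF p0))) powRrM.
  by apply: ge0_ler_powR; rewrite ?nnegrE ?invr_ge0 ?(ltW p0)//; exact: fH0.
exists D; split => //.
- by move=> x Dx; exists (fine (H x) `^ p^-1) => k; exact: SB.
- move=> f mf fB; apply: Lp_fun_intX => //; apply: le_trans intH.
  apply: ae_ge0_le_integral => //.
  + by apply/measurable_EFinP; exact: measurable_normX.
  + exists (~` D); split=> //; first exact: measurableC.
    move=> x /= nf Dx; apply: nf => _.
    rewrite -[H x]fineK ?ge0_fin_numE// lee_fin.
    have -> : fine (H x) = (fine (H x) `^ p^-1) `^ p.
      by rewrite -powRrM mulVf ?gt_eqF// powRr1.
    apply: ge0_ler_powR; rewrite ?nnegrE ?(ltW p0) ?powR_ge0//.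
    by apply: fB => // k; exact: SB.
Unshelve. all: by end_near. Qed.

(** The sum of 3^-i over N <= i < N + k, in closed form. *)
Let geom (N k : nat) : R := 3 / 2 * ((3^-1) ^+ N - (3^-1) ^+ (N + k)).

Lemma Lp_fun_abs f : Lp f -> Lp (fun x => `|f x|) /\ nLp (fun x => `|f x|) <= nLp f.
Proof.
move=> pf; apply: Lp_fun_le => //.
- by apply: measurableT_comp => //; case: pf.
- by apply: aeW => x; rewrite normr_id.
Qed.

Lemma Lp_fun_sum (v : nat -> T -> R) (N : nat) : (forall i, Lp (v i)) ->
  Lp (fun x => \sum_(0 <= i < N) v i x).
Proof.
move=> pv; elim: N => [|N IH].
  have -> : (fun x => \sum_(0 <= i < 0) v i x) = (fun=> 0).
    by apply/funext => x; rewrite big_nil.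
  by have [] := @Lp_fun0 _ _ _ mu p%:E p1e.
have -> : (fun x => \sum_(0 <= i < N.+1) v i x) =
    (fun x => \sum_(0 <= i < N) v i x + v N x).
  by apply/funext => x; rewrite big_nat_recr.
exact: (Lp_funD p1e IH (pv N)).1.
Qed.

Let tail_sum (v : nat -> T -> R) (N k : nat) :
  (forall i, Lp (v i)) -> (forall i, nLp (v i) <= (3^-1) ^+ i) ->
  Lp (fun x => \sum_(0 <= i < k) `|v (N + i)%N x|) /\
  nLp (fun x => \sum_(0 <= i < k) `|v (N + i)%N x|) <= geom N k.
Proof.
move=> pv v3; elim: k => [|k [IH1 IH2]].
  have -> : (fun x => \sum_(0 <= i < 0) `|v (N + i)%N x|) = (fun=> 0).
    by apply/funext => x; rewrite big_nil.
  have [p0' p0E] := @Lp_fun0 _ _ _ mu p%:E p1e.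
  by split=> //; rewrite /nLp p0E /geom addn0 subrr mulr0.
have -> : (fun x => \sum_(0 <= i < k.+1) `|v (N + i)%N x|) =
    (fun x => \sum_(0 <= i < k) `|v (N + i)%N x| + `|v (N + k)%N x|).
  by apply/funext => x; rewrite big_nat_recr.
have [pa na] := Lp_fun_abs (pv (N + k)%N).
have [pD nD] := Lp_funD p1e IH1 pa.
split=> //; apply: (le_trans nD).
have := le_trans na (v3 (N + k)%N).
move: IH2; rewrite /geom -/nLp addnS exprS; lra.
Qed.

Let geom_le N k : geom N k <= 3 / 2 * (3^-1) ^+ N.
Proof. by rewrite /geom ler_pM2l// gerBl exprn_ge0. Qed.

(** Absolute convergence at every point makes the sum a pointwise limit of measurable functions,
    hence measurable. Its N-th tail is dominated by the partial sums of the |v (N + i)|, to which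
    [monotone_Lp] applies. *)
Let series_everywhere (v : nat -> T -> R) :
  (forall i, Lp (v i)) -> (forall i, nLp (v i) <= (3^-1) ^+ i) ->
  (forall x, exists B, forall k, \sum_(0 <= i < k) `|v i x| <= B) ->
  exists y : T -> R, measurable_fun setT y /\ forall N,
    Lp (fun x => y x - \sum_(0 <= i < N) v i x) /\
    nLp (fun x => y x - \sum_(0 <= i < N) v i x) <= 3 / 2 * (3^-1) ^+ N.
Proof.
move=> pv v3 vB.
have mv i : measurable_fun setT (v i) by case: (pv i).
have cv x : cvgn (series (v^~ x)).
  apply: normed_cvg; apply: nondecreasing_is_cvgn.
    apply: homo_leq => // [? ? ? |k]; first exact: le_trans.
    by rewrite /= /series /= big_nat_recr//= lerDl.
  by have [B hB] := vB x; exists B => _ [k _ <-]; exact: hB.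
pose y x := limn (series (v^~ x)).
have msum k : measurable_fun setT (fun x => \sum_(0 <= i < k) v i x).
  by case: (Lp_fun_sum k pv).
have my : measurable_fun setT y.
  apply: (@measurable_fun_cvg _ _ _ setT (fun k x => \sum_(0 <= i < k) v i x)) => //.
  by move=> x _; exact: cv.
exists y; split=> // N.
have C0 : 0 <= 3 / 2 * (3^-1) ^+ N :> R by rewrite mulr_ge0// exprn_ge0.
have [||||D [_ _ _ HD]] := @monotone_Lp
    (fun k x => \sum_(0 <= i < k) `|v (N + i)%N x|) _ C0.
- by move=> k x; exact: sumr_ge0.
- by move=> k x; rewrite big_nat_recr//= lerDl.
- by move=> k; have [] := tail_sum N k pv v3.
- by move=> k; have [_ /le_trans] := tail_sum N k pv v3; apply; exact: geom_le.
apply: HD; first exact: measurable_funB.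
move=> x B _ SB.
have cvy : `|series (v^~ x) k - \sum_(0 <= i < N) v i x| @[k --> \oo]
    --> `|y x - \sum_(0 <= i < N) v i x|.
  by apply: cvg_norm; apply: cvgB; [exact: cv|exact: cvg_cst].
apply: (cvgr_to_le cvy); near=> k.
have Nk : (N <= k)%N by near: k; exact: nbhs_infty_ge.
rewrite /series /= (@big_cat_nat _ _ _ N)//= addrAC subrr add0r.
apply: le_trans (SB (k - N)%N); rewrite -{1}(add0n N) big_addn.
apply: le_trans (ler_norm_sum _ _ _) _.
by apply: ler_sum => i _; rewrite addnC.
Unshelve. all: by end_near. Qed.

Lemma Lp_geometric_series (v : nat -> T -> R) :
  (forall i, Lp (v i)) -> (forall i, nLp (v i) <= (3^-1) ^+ i) ->
  exists2 y, Lp y & forall N,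
    Lp (fun x => y x - \sum_(0 <= i < N) v i x) /\
    nLp (fun x => y x - \sum_(0 <= i < N) v i x) <= 3 / 2 * (3^-1) ^+ N.
Proof.
move=> pv v3.
have [|||||D [mD D0 DB _]] := @monotone_Lp
    (fun k x => \sum_(0 <= i < k) `|v (0 + i)%N x|) (3 / 2 * (3^-1) ^+ 0).
- by rewrite mulr_ge0.
- by move=> k x; exact: sumr_ge0.
- by move=> k x; rewrite big_nat_recr//= lerDl.
- by move=> k; have [] := tail_sum 0%N k pv v3.
- by move=> k; have [_ /le_trans] := tail_sum 0%N k pv v3; apply; exact: geom_le.
(* Cutting the terms off outside [D] changes them on a null set only and makes the series converge
   absolutely everywhere. *)
pose w i x := v i x * \1_D x.
have wE i x : `|w i x| <= `|v i x|.
  by rewrite /w normrM indicE; case: (x \in D); rewrite ?normr1 ?mulr1// normr0 mulr0.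
have pw i : Lp (w i) /\ nLp (w i) <= nLp (v i).
  apply: (Lp_fun_le p1e _ (pv i)); last by apply: aeW => x; exact: wE.
  apply: measurable_funM; last exact: measurable_indic.
  by case: (pv i).
have [||x|y [my yw]] := @series_everywhere w.
- by move=> i; case: (pw i).
- by move=> i; apply: le_trans (v3 i); case: (pw i).
- have [Dx|Dx] := pselect (D x); last first.
    exists 0 => k; rewrite big1// => i _.
    by rewrite /w indicE memNset// mulr0 normr0.
  have [B hB] := DB _ Dx; exists B => k; apply: le_trans (hB k).
  exact: ler_sum.
have aeE N : {ae mu, forall x,
    `|y x - \sum_(0 <= i < N) v i x| <= `|y x - \sum_(0 <= i < N) w i x|}.
  exists (~` D); split=> //; first exact: measurableC.
  move=> x /= nle Dx; apply: nle; rewrite (eq_bigr (w ^~ x))// => i _.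
  by rewrite /w indicE mem_set// mulr1.
have py : Lp y.
  have [+ _] := yw 0%N; congr Lp; apply/funext => x.
  by rewrite big_nil subr0.
exists y => // N.
have [pN nN] := yw N.
have [|pv' nv'] := Lp_fun_le p1e _ pN (aeE N).
  by apply: measurable_funB => //; case: (Lp_fun_sum N pv).
by split=> //; exact: le_trans nv' nN.
Qed.

End Lp_series.

(** * Uniform boundedness on L_p *)

Section uniform_boundedness.
Context d (T : measurableType d) (R : realType).
Variable mu : {measure set T -> \bar R}.
Variables (I : set T).
Hypotheses (mI : measurable I) (Ioo : (mu I < +oo)%E).
Variables (p : R) (q : \bar R).
Hypotheses (p1 : 1 <= p) (pq : (p%:E^-1 + q^-1 = 1)%E).

Let p1e : (1 <= p%:E)%E. Proof. by rewrite lee_fin. Qed.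

(* Of the two steps s +- h, one satisfies |psi (s +- h)| >= |psi h|; taking it at
   each stage makes the [psi n] unbounded at the limit of the walk, with no appeal to the Baire category theorem. *)
Let walk_step (psi u s : nat -> T -> R) n (f : T -> R) : R :=
  if `|pairing mu (psi n) (fun x => 3^-1 ^+ n * u n x)| <=
     `|pairing mu (psi n) (fun x => f x + 3^-1 ^+ n * u n x)| then 1 else -1.

Let walk (psi u : nat -> T -> R) : nat -> T -> R :=
  fix s n := if n is n'.+1
    then fun x => s n' x + walk_step psi u s n' (s n') * (3^-1 ^+ n' * u n' x)
    else fun=> 0.

(** Each step has norm at most 3^-n along a function that realises 3/4 of the norm of [psi n], so
    |psi n| is at least 3/4 3^-n times that norm after the step. All later steps together have norm
    at most 3/2 3^-(n+1) = 1/2 3^-n. The remaining 1/4 3^-n times the norm exceeds n + 1, because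
    [psi n] was chosen with norm above 4 3^n (n + 1). *)
Lemma uniform_boundedness (phi : nat -> T -> R) :
  (forall k, Lp_fun mu q (phi k)) ->
  (forall k x, ~ I x -> phi k x = 0) ->
  (forall f, Lp_fun mu p%:E f ->
    exists B, forall k, `|pairing mu (phi k) f| <= B) ->
  exists C, forall k, Lp_val mu q (phi k) <= C.
Proof.
move=> pphi phiI phiB; apply: contrapT => /forallNP noC.
have big n : exists k, 4 * 3 ^+ n * n.+1%:R < Lp_val mu q (phi k).
  have /existsNP[k /negP] := noC (4 * 3 ^+ n * n.+1%:R).
  by rewrite -ltNge => ?; exists k.
have [idx hidx] := choice big.
pose psi n := phi (idx n).
have val0 n : 0 < Lp_val mu q (psi n).
  by apply: le_lt_trans (hidx n); rewrite !mulr_ge0// exprn_ge0.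
have wit n : exists u, [/\ Lp_fun mu p%:E u, Lp_val mu p%:E u <= 1 &
    3 / 4 * Lp_val mu q (psi n) <= pairing mu (psi n) u].
  apply: (dual_witness mI Ioo p1 pq (pphi _) (phiI _)).
  by rewrite gtr_pMl//; lra.
have [u hu] := choice wit.
pose s := walk psi u.
pose e n := walk_step psi u s n (s n).
pose v n x := e n * (3^-1 ^+ n * u n x).
have e1 n : `|e n| = 1 by rewrite /e /walk_step; case: ifP; rewrite ?normrN normr1.
have sS n x : s n.+1 x = s n x + v n x by [].
have sE n x : s n x = \sum_(0 <= i < n) v i x.
  by elim: n => [|n IH]; rewrite ?big_nil// big_nat_recr//= -IH.
have i3 n : 0 <= 3^-1 ^+ n :> R by rewrite exprn_ge0.
have pu n : Lp_fun mu p%:E (fun x => 3^-1 ^+ n * u n x).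
  by have [pu _ _] := hu n; case: (Lp_funZ (3^-1 ^+ n) p1e pu).
have nu n : Lp_val mu p%:E (fun x => 3^-1 ^+ n * u n x) <= 3^-1 ^+ n.
  have [pun u1 _] := hu n; have [_ ->] := Lp_funZ (3^-1 ^+ n) p1e pun.
  by rewrite ger0_norm// ler_piMr.
have pv n : Lp_fun mu p%:E (v n) by case: (Lp_funZ (e n) p1e (pu n)).
have nv n : Lp_val mu p%:E (v n) <= 3^-1 ^+ n.
  have [_ ->] := Lp_funZ (e n) p1e (pu n).
  by rewrite e1 mul1r.
have ps n : Lp_fun mu p%:E (s n).
  have -> : s n = (fun x => \sum_(0 <= i < n) v i x) by apply/funext => x; exact: sE.
  exact: Lp_fun_sum.
have ppsi n : Lp_fun mu q (psi n) by exact: pphi.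
have low n : 3 / 4 * 3^-1 ^+ n * Lp_val mu q (psi n) <=
    `|pairing mu (psi n) (s n.+1)|.
  have [pun _ hun] := hu n.
  have sSE : pairing mu (psi n) (s n.+1) = pairing mu (psi n) (s n) +
      e n * pairing mu (psi n) (fun x => 3^-1 ^+ n * u n x).
    have -> : s n.+1 = (fun x => s n x + v n x) by [].
    by rewrite (pairingD p1 pq (ps n) (pv n) (ppsi n)) (pairingZ _ p1 pq (pu n)).
  have -> : 3 / 4 * 3^-1 ^+ n * Lp_val mu q (psi n) =
    3^-1 ^+ n * (3 / 4 * Lp_val mu q (psi n)) by ring.
  apply: le_trans (_ : `|pairing mu (psi n) (fun x => 3^-1 ^+ n * u n x)| <= _).
    rewrite (pairingZ _ p1 pq pun)// normrM ger0_norm// ler_wpM2l//.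
    exact: le_trans hun (ler_norm _).
  rewrite sSE /e /walk_step (pairingD p1 pq (ps n) (pu n) (ppsi n)).
  case: ifPn => [|]; first by rewrite mul1r.
  rewrite -ltNge mulN1r.
  set A := pairing _ _ _; set B := pairing _ _ _ => AB.
  (* As 2B = (A + B) - (A - B), the minus step reaches |B| whenever the plus step falls short of
     it. *)
  have : `|B + B| <= `|A + B| + `|A - B|.
    by rewrite -[`|A - B|]normrN; apply: le_trans (ler_normD _ _); rewrite le_eqVlt;
      apply/orP; left; apply/eqP; congr `|_|; ring.
  rewrite -mulr2n normrMn mulr2n; lra.
have [y py hy] := Lp_geometric_series p1 pv nv.
have [B hB] := phiB y py.
have [n Bn] : exists n : nat, B < n.+1%:R.
  exists (Num.truncn `|B|); apply: le_lt_trans (ler_norm B) _.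
  by rewrite truncnS_gt.
have := hB (idx n); rewrite -/(psi n); apply/negP; rewrite -ltNge.
have [pt nt] := hy n.+1.
have yE : pairing mu (psi n) y = pairing mu (psi n) (s n.+1) +
    pairing mu (psi n) (fun x => y x - \sum_(0 <= i < n.+1) v i x).
  rewrite -(pairingD p1 pq (ps n.+1) pt (ppsi n)); congr pairing.
  by apply/funext => x; rewrite sE addrC subrK.
have tl := pairing_le p1 pq pt (ppsi n).
set P1 := pairing _ _ (s _) in yE; set P2 := pairing _ _ (fun x => y x - _) in yE tl.
have tl2 : `|P2| <= 2^-1 * 3^-1 ^+ n * Lp_val mu q (psi n).
  apply: (le_trans tl); rewrite mulrC ler_wpM2r ?(ltW (val0 n))//.
  by apply: (le_trans nt); rewrite exprS; lra.
have tri : `|P1| - `|P2| <= `|P1 + P2|.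
  by rewrite -[X in _ - X]normrN -[P1 in `|P1| - _](addrK P2) lerBlDr ler_normD.
rewrite yE; apply: lt_le_trans tri.
have lown := low n; rewrite -/P1 in lown.
have hn := hidx n; rewrite -/(psi n) in hn.
have : n.+1%:R < 4^-1 * 3^-1 ^+ n * Lp_val mu q (psi n).
  rewrite exprVn -invfM mulrC ltr_pdivlMr ?mulr_gt0 ?exprn_gt0//.
  by rewrite mulrC.
lra.
Qed.

End uniform_boundedness.

(** * Weak convergence from a norm bound and convergence of primitives *)

Section weak_convergence.
Import HBNNSimple.
Context (R : realType) (X : Type) (F : set_system X) {FF : Filter F}.
Notation mu := (@lebesgue_measure R).
Variables (a b p : R) (q : \bar R).
Hypotheses (ab : a < b) (p1 : 1 <= p) (pq : (p%:E^-1 + q^-1 = 1)%E).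
Variable psi : X -> R -> R.
Hypothesis ppsi : forall m, Lp_fun mu q (psi m).
Hypothesis psi0 : forall m x, ~ `[a, b]%classic x -> psi m x = 0.
Variable C : R.
Hypothesis psiC : \forall m \near F, Lp_val mu q (psi m) <= C.
Hypothesis psi_int : forall t, a < t <= b ->
  \int[mu]_(x in `[a, t]) psi m x @[m --> F] --> (0 : R).
Implicit Types f g : R -> R.

Let p0 : 0 < p. Proof. exact: lt_le_trans ltr01 p1. Qed.
Let p1e : (1 <= p%:E)%E. Proof. by rewrite lee_fin. Qed.
Let I : set R := `[a, b]%classic.
Let mI : measurable I. Proof. exact: measurable_itv. Qed.
Let Ioo : (mu I < +oo)%E.
Proof. by rewrite /I lebesgue_measure_itv/= lte_fin ab -EFinD ltry. Qed.

Let Lp := Lp_fun mu p%:E.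
Let P f := pairing mu (psi m) f @[m --> F] --> (0 : R).

Let PD f g : Lp f -> Lp g -> P f -> P g -> P (fun x => f x + g x).
Proof.
move=> pf pg Pf Pg; rewrite /P.
under eq_fun => m do rewrite (pairingD p1 pq pf pg (ppsi m)).
by have := @cvgD _ _ _ _ FF _ _ _ _ Pf Pg; rewrite addr0.
Qed.

Let PZ c f : Lp f -> P f -> P (fun x => c * f x).
Proof.
move=> pf Pf; rewrite /P.
under eq_fun => m do rewrite (pairingZ c p1 pq pf (ppsi m)).
by have := @cvgMl_tmp _ _ _ FF _ c _ Pf; rewrite mulr0.
Qed.

Let Psum (J : Type) (s : seq J) (g : J -> R -> R) :
  (forall j, Lp (g j)) -> (forall j, P (g j)) ->
  Lp (fun x => \sum_(j <- s) g j x) /\ P (fun x => \sum_(j <- s) g j x).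
Proof.
move=> pg Pg; elim: s => [|j s [IH1 IH2]].
  have -> : (fun x => \sum_(j <- [::]) g j x) = (fun=> 0).
    by apply/funext => x; rewrite big_nil.
  split; first by have [] := @Lp_fun0 _ _ _ mu p%:E p1e.
  have E m : pairing mu (psi m) (fun=> 0) = 0.
    rewrite /pairing; under eq_Rintegral do rewrite mulr0.
    by rewrite Rintegral_cst// mul0r.
  by rewrite /P; under eq_fun do rewrite E; exact: cvg_cst.
have -> : (fun x => \sum_(j <- j :: s) g j x) =
    (fun x => g j x + \sum_(j <- s) g j x).
  by apply/funext => x; rewrite big_cons.
by split; [case: (Lp_funD p1e (pg j) IH1)|exact: PD].
Qed.

Let Pclosure f : Lp f ->
  (forall e, 0 < e -> exists g, [/\ Lp g, P g &
     Lp_val mu p%:E (fun x => f x - g x) <= e]) -> P f.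
Proof.
move=> pf fapp; apply/cvgr0Pnorm_le => e e0.
(* [F] is only assumed to be a filter, so [C] may be negative; [C'] is a positive bound to divide
   by. *)
pose C' := `|C| + 1; have C'0 : 0 < C' by rewrite ltr_wpDl.
have [g [pg Pg fg]] := fapp (e / 2 / C') (divr_gt0 (divr_gt0 e0 (ltr0n _ 2)) C'0).
have pgN : Lp (fun x => - g x).
  have [+ _] := Lp_funZ (-1) p1e pg.
  by congr Lp_fun; apply/funext => x; rewrite mulN1r.
have [pfg _] := Lp_funD p1e pf pgN.
move/cvgr0Pnorm_le : Pg => /(_ (e / 2) (divr_gt0 e0 (ltr0n _ 2))) Pg.
near=> m.
have -> : pairing mu (psi m) f =
    pairing mu (psi m) g + pairing mu (psi m) (fun x => f x - g x).
  rewrite -(pairingD p1 pq pg pfg (ppsi m)); congr pairing.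
  by apply/funext => x; rewrite addrC subrK.
rewrite (le_trans (ler_normD _ _))// [leRHS](splitr e) lerD//.
  by near: m.
apply: le_trans (pairing_le p1 pq pfg (ppsi m)) _.
have psim : Lp_val mu q (psi m) <= C' .
  apply: (@le_trans _ _ C); first by near: m.
  by rewrite (le_trans (ler_norm _))// lerDl.
apply: le_trans (ler_pM _ _ psim fg) _; rewrite ?Lp_val_ge0//.
by rewrite mulrC divfK// gt_eqF.
Unshelve. all: by end_near. Qed.

(** Dominated convergence of |f - g n|^p, with |f|^p as the dominating function, turns monotone
    pointwise approximation into approximation in L_p, where [Pclosure] applies. *)
Let Pmonotone f (g : nat -> R -> R) : Lp f ->
  (forall n x, 0 <= g n x <= f x) -> (forall n, measurable_fun setT (g n)) ->
  (forall x, g n x @[n --> \oo] --> f x) -> (forall n, P (g n)) -> P f.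
Proof.
move=> pf gf mg cg Pg; apply: (Pclosure pf) => e e0.
have f0 x : 0 <= f x by case/andP: (gf 0%N x) => /le_trans; apply.
have [mf _] := pf.
pose h n x := (`|f x - g n x| `^ p)%:E.
have mX (k : R -> R) : measurable_fun setT k ->
    measurable_fun setT (fun x => (`|k x| `^ p)%:E).
  move=> mk; apply/measurable_EFinP.
  apply: (@measurableT_comp _ _ _ _ _ _ (@powR R ^~ p)) => //.
  exact: measurableT_comp.
have [|||||_ _ cvh] := @dominated_convergence _ _ _ mu setT measurableT
    h (cst 0%E) (fun x => (`|f x| `^ p)%:E).
- by move=> n; apply: mX; exact: measurable_funB.
- exact: measurable_cst.
- apply: aeW => x _; apply/fine_cvgP; split; first exact: nearW.
  apply/cvgr0Pnorm_le => d d0.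
  have /cvgrPdist_le/(_ (d `^ p^-1) (powR_gt0 _ d0)) := cg x.
  apply: filterS => n le_d; rewrite /= ger0_norm ?powR_ge0//.
  rewrite -[leRHS]powRr1 ?(ltW d0)// -(mulVf (negbT (gt_eqF p0))) powRrM.
  by apply: ge0_ler_powR; rewrite ?nnegrE ?(ltW p0) ?powR_ge0.
- apply/integrableP; split; first exact: mX.
  under eq_integral do rewrite gee0_abs ?lee_fin ?powR_ge0//.
  by rewrite int_normX// ltry.
- apply: aeW => x n _; rewrite gee0_abs ?lee_fin ?powR_ge0//.
  apply: ge0_ler_powR; rewrite ?nnegrE ?(ltW p0)//.
  have /andP[g0 gfx] := gf n x; rewrite !ger0_norm ?subr_ge0//.
  by rewrite gerBl.
have : \forall n \near \oo, (\int[mu]_x h n x < (e `^ p)%R%:E)%E.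
  move: cvh; rewrite integral0 => /fine_cvgP[hfin].
  move/cvgr0Pnorm_lt => /(_ (e `^ p) (powR_gt0 _ e0)) hlt.
  near=> n.
  rewrite -[ltLHS]fineK; last by near: n.
  by rewrite lte_fin; apply: le_lt_trans (ler_norm _) _; near: n.
move=> /filter_ex[n hn].
have [pfg nfg] := Lp_fun_intX p1 (ltW e0) (measurable_funB mf (mg n)) (ltW hn).
exists (g n); split=> //.
have aeg : {ae mu, forall x, `|g n x| <= `|f x|}.
  by apply: aeW => x; have /andP[g0 gfx] := gf n x; rewrite !ger0_norm.
by have [] := @Lp_fun_le _ _ _ mu p%:E (g n) f p1e (mg n) pf aeg.
Unshelve. all: by end_near. Qed.

(** A Borel set may have infinite measure; its trace on [I] has an indicator in L_p, and [psi]
    vanishes off [I]. *)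
Let PS (E : set R) := P (\1_(E `&` I) : R -> R).

Let pS (E : set R) : measurable E -> Lp (\1_(E `&` I) : R -> R).
Proof.
move=> mE; apply: Lp_fun_indic => //; first exact: measurableI.
apply: le_lt_trans Ioo; apply: le_measure; rewrite ?inE//; exact: measurableI.
Qed.

Let pairingS m (E : set R) : measurable E ->
  pairing mu (psi m) (\1_(E `&` I)) = \int[mu]_(x in E `&` I) psi m x.
Proof.
move=> mE; rewrite [RHS]Rintegral_mkcond; apply: eq_Rintegral => x _.
by rewrite patchE indicE; case: (x \in _); rewrite ?mulr1// mulr0.
Qed.

Let ipsi m (A : set R) : measurable A -> mu.-integrable A (EFin \o psi m).
Proof.
move=> mA; apply: (integrableS measurableT) => //.
have := pairing_integrable p1 pq (pS measurableT) (ppsi m).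
congr (integrable _ _ _); apply/funext => x /=; rewrite indicE setTI.
have [xI|xI] := pselect (I x); first by rewrite mem_set// mulr1.
by rewrite psi0// mul0r.
Qed.

Let PST : PS setT.
Proof.
have := @psi_int b; rewrite ab lexx => /(_ isT); rewrite /PS /P.
by under [in X in _ -> X]eq_fun => m do rewrite pairingS// setTI.
Qed.

(** Open rays form the generating pi-system. Their traces on [I] are half-open intervals, whose
    integrals agree with those over the closed intervals in [psi_int]. *)
Let PSray x : PS `]-oo, x[%classic.
Proof.
rewrite /PS /P.
under eq_fun => m do rewrite pairingS//.
have [xa|ax] := leP x a.
  have -> : `]-oo, x[%classic `&` I = set0.
    apply/seteqP; split=> // y [] /=; rewrite /I/= !in_itv/= => yx /andP[ay _].
    by move: (lt_le_trans yx xa); rewrite ltNge ay.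
  by under eq_fun do rewrite Rintegral_set0; exact: cvg_cst.
have [xb|bx] := leP x b; last first.
  have -> : `]-oo, x[%classic `&` I = I.
    apply/seteqP; split=> [y []//|y] /=; rewrite /I/= !in_itv/= => /andP[ay yb].
    by split; [exact: le_lt_trans yb bx|rewrite ay yb].
  by apply: psi_int; rewrite ab lexx.
have -> : `]-oo, x[%classic `&` I = `[a, x[%classic.
  apply/seteqP; split=> y /=; rewrite /I/= !in_itv/=.
    by move=> [-> /andP[->]].
  by move=> /andP[-> yx]; rewrite yx (ltW (lt_le_trans yx xb)).
have := @psi_int x; rewrite ax xb => /(_ isT).
by under eq_fun => m do rewrite -Rintegral_itv_bndo_bndc ?ipsi//.
Qed.

Let PSall (E : set R) : measurable E -> PS E.
Proof.
have mE : @measurable _ R = <<s @RGenInftyO.G R >>.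
  exact: RGenInftyO.measurableE.
rewrite {1}mE; move: E; apply: (dynkin_induction mE) => //.
- move=> _ _ [x ->] [y ->]; exists (Num.min x y).
  by apply/seteqP; split=> z /=; rewrite !in_itv/= lt_min => /andP.
- by move=> _ [x ->]; exact: PSray.
- move=> E mE' PE; have := PD (pS measurableT) _ PST (PZ (-1) (pS mE') PE).
  move=> /(_ (Lp_funZ (-1) p1e (pS mE')).1).
  congr P; apply/funext => x; rewrite !indicE setTI mulN1r.
  rewrite !in_setI in_setC.
  by case: (x \in E); case: (x \in I); rewrite /= ?subr0 ?subrr.
- move=> G mG tG PG.
  pose g n x := \sum_(0 <= k < n) (\1_(G k `&` I) x : R).
  (* By disjointness a point lies in at most one [G k0], so the partial sums jump once from 0 to 1
     and increase to the indicator of the union. *)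
  have gE n x k0 : (G k0 `&` I) x -> g n x = (k0 < n)%:R.
    move=> Gk0; elim: n => [|n IH]; first by rewrite /g big_nil.
    rewrite /g big_nat_recr//= -/(g n x) IH indicE.
    have [<-|k0n] := eqVneq k0 n; first by rewrite mem_set// ltnn ltnSn add0r.
    rewrite memNset ?addr0 ?ltnS ?[(k0 <= n)%N]leq_eqVlt ?(negbTE k0n)//.
    move=> [Gn _]; move/eqP: k0n; apply.
    by apply: tG => //; exists x; split=> //; case: Gk0.
  have g0 n x : (forall k, ~ (G k `&` I) x) -> g n x = 0.
    by move=> nG; rewrite /g big1// => k _; rewrite indicE memNset.
  have mU : measurable (\bigcup_k G k) by exact: bigcupT_measurable.
  have pPg n := Psum (index_iota 0 n) (fun k => pS (mG k)) PG.
  apply: (@Pmonotone _ g); first exact: pS.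
  + move=> n x; have [[k [Gk Ix]]|nG] := pselect (exists k, (G k `&` I) x).
      rewrite (gE _ _ k)// indicE mem_set; last by split=> //; exists k.
      by case: (k < n)%N; rewrite ?lexx ?ler01 ?ler0n.
    rewrite g0; last by move=> k Gk; apply: nG; exists k.
    by rewrite lexx indicE ler0n.
  + by move=> n; case: (pPg n) => -[].
  + move=> x; have [[k [Gk Ix]]|nG] := pselect (exists k, (G k `&` I) x).
      rewrite indicE mem_set; last by split=> //; exists k.
      apply: cvg_near_cst; near=> n.
      rewrite (gE _ _ k)//; suff -> : (k < n)%N by [].
      by near: n; exact: nbhs_infty_gt.
    rewrite indicE memNset; last first.
      by move=> [[k _ Gk] Ix]; apply: nG; exists k.
    apply: cvg_near_cst; apply: nearW => n.
    by rewrite g0// => k Gk; apply: nG; exists k.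
  + by move=> n; case: (pPg n).
Unshelve. all: by end_near. Qed.

(** Simple functions increase to [f]. Cutting everything to [I] leaves the pairings unchanged and
    makes each approximant a finite combination of the indicators in [PSall]. *)
Let Pge0 f : Lp f -> (forall x, 0 <= f x) -> P f.
Proof.
move=> pf f0; have [mf _] := pf.
pose fI x := f x * \1_I x.
have fIE m : pairing mu (psi m) f = pairing mu (psi m) fI.
  apply: eq_Rintegral => x _; rewrite /fI indicE.
  have [xI|xI] := pselect (I x); first by rewrite mem_set// mulr1.
  by rewrite psi0// !mul0r.
have mfI : measurable_fun setT fI.
  by apply: measurable_funM => //; exact: measurable_indic.
have pfI : Lp fI.
  suff aef : {ae mu, forall x, `|fI x| <= `|f x|}.
    by have [] := @Lp_fun_le _ _ _ mu p%:E fI f p1e mfI pf aef.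
  apply: aeW => x; rewrite /fI normrM indicE; case: (x \in I); rewrite ?normr1 ?mulr1//.
  by rewrite normr0 mulr0.
suff PfI : P fI by rewrite /P; under eq_fun do rewrite fIE.
have mEf : measurable_fun setT (EFin \o f) by apply/measurable_EFinP.
have Ef0 (x : R) : setT x -> (0 <= (EFin \o f) x)%E by rewrite lee_fin.
pose s := nnsfun_approx measurableT mEf.
pose g n x := s n x * \1_I x.
have cs x : s n x @[n --> \oo] --> f x.
  by have /fine_cvgP[_] := @cvg_nnsfun_approx _ _ _ _ measurableT _ mEf Ef0 x Logic.I.
have sf n x : s n x <= f x.
  have nd : nondecreasing_seq (s^~ x).
    by move=> i j ij; have /lefP := @nd_nnsfun_approx _ _ _ _ measurableT _ mEf i j ij; apply.
  rewrite -(cvg_lim _ (cs x))//; apply: nondecreasing_cvgn_le => //.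
  by apply/cvg_ex; eexists; exact: cs.
apply: (@Pmonotone _ g pfI).
- move=> n x; have i0 : 0 <= \1_I x :> R by rewrite indicE ler0n.
  by rewrite /g mulr_ge0//= /fI ler_wpM2r.
- by move=> n; apply: measurable_funM => //; exact: measurable_indic.
- by move=> x; apply: cvgMr_tmp; exact: cs.
- move=> n.
  have gE : g n = (fun x => \sum_(y <- finmap.enum_fset (fset_set (range (s n))))
      y * \1_(s n @^-1` [set y] `&` I) x).
    apply/funext => x; rewrite /g fimfunE fsbig_finite//= mulr_suml.
    by apply: eq_bigr => y _; rewrite indicI mulrA.
  rewrite gE; apply: (Psum _ _ _).2 => y.
    by apply: (Lp_funZ y p1e (pS _)).1.
  by apply: PZ; [exact: pS|exact: PSall].
Qed.

Lemma pairing_cvg0 f : Lp_fun mu p%:E f ->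
  pairing mu (psi m) f @[m --> F] --> (0 : R).
Proof.
move=> pf; have [mf _] := pf.
have [pa _] := Lp_fun_abs p1 pf.
have [pN _] := Lp_funZ (-1) p1e pf.
have [pg _] := Lp_funD p1e pa pf.
have [ph _] := Lp_funD p1e pa pN.
(* |f| + f and |f| - f are twice the positive and the negative part of [f]. *)
have Pg : P (fun x => `|f x| + f x).
  by apply: Pge0 => // x; rewrite addrC -lerBlDr sub0r lerNl -normrN ler_norm.
have Ph : P (fun x => `|f x| + -1 * f x).
  by apply: Pge0 => // x; rewrite mulN1r subr_ge0 ler_norm.
have := PZ 2^-1 (Lp_funD p1e pg (Lp_funZ (-1) p1e ph).1).1
  (PD pg (Lp_funZ (-1) p1e ph).1 Pg (PZ (-1) ph Ph)).
by congr P; apply/funext => x; field.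
Qed.

End weak_convergence.

(** * Borel measurability of the derivative *)

Section measurable_derivative.
Context (R : realType).
Implicit Types (a b x : R) (G : R -> R).

Lemma dnbhs_shiftP x (U : set R) :
  x^' U <-> exists2 d, 0 < d & forall h, 0 < `|h| < d -> U (x + h).
Proof.
rewrite /dnbhs; split.
- move=> /nbhs_ballP[d /= d0 dU]; exists d => // h /andP[h0 hd].
  apply: dU; first by rewrite /ball/= opprD addNKr normrN.
  by rewrite -subr_eq0 addrAC subrr add0r -normr_gt0.
- move=> [d d0 dU]; apply/nbhs_ballP; exists d => //= y; rewrite /ball/= distrC => xy yx.
  by rewrite -(subrK x y) addrC; apply: dU; rewrite xy andbT normr_gt0 subr_eq0.
Qed.

Lemma within_itv_dnbhs a b x : a < x < b -> within `[a, b] x^' = x^'.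
Proof.
move=> /andP[ax xb]; apply/seteqP; split=> U; rewrite /within /=; last first.
  by apply: filterS => z + _.
have nI : \forall z \near x^', z \in `[a, b].
  apply/dnbhs_shiftP; exists (Num.min (x - a) (b - x)).
    by rewrite lt_min !subr_gt0 ax xb.
  by move=> h /andP[_]; rewrite lt_min !ltr_norml in_itv/=; lra.
by apply: filterS2 nI => z zI; apply.
Qed.

Let quot G x (h : R) := (G (x + h) - G x) / h.

Let diff_quotE G x h : diff_quot G x (x + h) = quot G x h.
Proof. by rewrite /diff_quot /quot addrAC subrr add0r. Qed.

(** The Cauchy condition for the difference quotients at [x], which can be stated without their
    limit. *)
Let osc G (e d : R) x := forall h k, 0 < `|h| < d -> 0 < `|k| < d ->
  `|quot G x h - quot G x k| <= e.

Let cvg_oscP a b G x : a < x < b ->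
  cvg (diff_quot G x z @[z --> within `[a, b] x^']) <->
  forall e, 0 < e -> exists2 d, 0 < d & osc G e d x.
Proof.
move=> axb; rewrite within_itv_dnbhs//; split=> [/cvg_ex[l]|cau].
  move/cvgrPdist_le => cl e e0; have /dnbhs_shiftP[d d0 hd] := cl _ (divr_gt0 e0 (ltr0n _ 2)).
  exists d => // h k hh kk; have := hd h hh; have := hd k kk; rewrite !diff_quotE.
  by rewrite !ler_norml; lra.
apply/cauchy_cvgP/cauchy_exP => e e0.
have e20 := divr_gt0 e0 (ltr0n _ 2).
have [d d0 hd] := cau _ e20.
exists (diff_quot G x (x + d / 2)).
have d2 : 0 < `|d / 2| < d by rewrite gtr0_norm; lra.
apply/dnbhs_shiftP; exists d => // h hh; rewrite /= /ball/= !diff_quotE.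
by apply: le_lt_trans (hd _ _ d2 hh) _; lra.
Qed.

(** The quotient is continuous in a nonzero increment, so a real increment can be replaced by a
    rational one of the same range at an arbitrarily small cost. *)
Let osc_rat G e d x : continuous G ->
  (forall r s : rat, 0 < `|ratr r : R| < d -> 0 < `|ratr s : R| < d ->
    `|quot G x (ratr r) - quot G x (ratr s)| <= e) -> osc G e d x.
Proof.
move=> cG hr h k hh kk; apply/ler_addgt0Pl => t t0.
have approx l : 0 < `|l| < d -> exists2 r : rat, 0 < `|ratr r : R| < d &
    `|quot G x l - quot G x (ratr r)| <= t / 2.
  move=> /andP[l0 ld].
  have cq : quot G x z @[z --> l] --> quot G x l.
    apply: cvgM; last by apply: cvgV; rewrite -?normr_gt0//; exact: cvg_id.
    apply: cvgB; last exact: cvg_cst.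
    apply: (@cvg_comp _ _ _ (fun z => x + z) G); last exact: cG.
    by apply: cvgD; [exact: cvg_cst|exact: cvg_id].
  move/cvgrPdist_le : cq => /(_ _ (divr_gt0 t0 (ltr0n _ 2))) nq.
  have nl : \forall z \near l, 0 < `|z| < d.
    have cn : `|z| @[z --> l] --> `|l| by apply: cvg_norm; exact: cvg_id.
    near=> z; apply/andP; split; near: z.
      exact: (cvgr_gt _ cn).
    exact: (cvgr_lt _ cn).
  have nn : nbhs l [set z | `|quot G x l - quot G x z| <= t / 2 /\ 0 < `|z| < d].
    exact: filterI nq nl.
  have [z /= z0 hz] := (@nbhs_ballP _ _ _ _).1 nn.
  have lz : l - z < l + z by lra.
  have [r] := rat_in_itvoo lz; rewrite in_itv/= => rlz.
  exists r; have [] := hz (ratr r) => //; rewrite /ball/=; rewrite ltr_norml; lra.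
have [r rd hr1] := approx h hh; have [s sd hs] := approx k kk.
have := hr r s rd sd; move: hr1 hs; rewrite !ler_norml; lra.
Unshelve. all: by end_near. Qed.

(* Measurability here is with respect to Borel sets, so it does not follow from
   almost everywhere equality with a measurable function: the set where the
   difference quotients are Cauchy is described by rational increments. *)
Lemma measurable_real_deriv a b G : continuous G ->
  measurable_fun `[a, b] (real_deriv a b G).
Proof.
(* The two endpoints do not affect measurability, and on the open interval the filter within [a, b]
   is the full punctured neighbourhood filter. *)
move=> cG; apply: (@measurable_fun_itv_cc _ _ _ false true).
have mG : measurable_fun setT G by exact: continuous_measurable_fun.
have mq h : measurable_fun setT (fun x => quot G x h).
  apply: measurable_funM => //; apply: measurable_funB => //.
  apply: measurableT_comp => //; apply: measurable_funD => //.
pose bad (n k : nat) : set R := \bigcup_(r : rat) \bigcup_(s : rat)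
  [set x | [/\ 0 < `|ratr r : R| < n.+1%:R^-1, 0 < `|ratr s : R| < n.+1%:R^-1 &
    k.+1%:R^-1 < `|quot G x (ratr r) - quot G x (ratr s)|]].
have mbad n k : measurable (bad n k).
  apply: bigcupT_measurable_rat => r; apply: bigcupT_measurable_rat => s.
  have [hr|hr] := pselect (0 < `|ratr r : R| < n.+1%:R^-1); last first.
    by rewrite (_ : [set _ | _] = set0)//; apply/seteqP; split=> // x [].
  have [hs|hs] := pselect (0 < `|ratr s : R| < n.+1%:R^-1); last first.
    by rewrite (_ : [set _ | _] = set0)//; apply/seteqP; split=> // x [].
  rewrite (_ : [set _ | _] =
      [set x | k.+1%:R^-1 < `|quot G x (ratr r) - quot G x (ratr s)|]); last first.
    by apply/seteqP; split=> // x [].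
  by apply: measurable_gtr; apply: measurableT_comp => //; exact: measurable_funB.
pose D : set R := \bigcap_k \bigcup_n ~` bad n k.
have mD : measurable D.
  apply: bigcapT_measurable => k; apply: bigcupT_measurable => n.
  exact: measurableC.
have DE x : a < x < b ->
    D x <-> cvg (diff_quot G x z @[z --> within `[a, b] x^']).
  move=> axb; rewrite cvg_oscP//; split=> [Dx e e0|h k _].
    have [k ke] : exists k : nat, k.+1%:R^-1 < e.
      exists (Num.truncn e^-1); rewrite invf_plt ?posrE//; exact: truncnS_gt.
    have [n _ nb] := Dx k Logic.I; exists n.+1%:R^-1; first by rewrite invr_gt0.
    apply: osc_rat => // r s hr hs; apply: le_trans (ltW ke).
    by rewrite leNgt; apply/negP => lt; apply: nb; exists r => //; exists s.
  have k0 : 0 < k.+1%:R^-1 :> R by rewrite invr_gt0.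
  have [d d0 hd] := h _ k0.
  have [n nd] : exists n : nat, n.+1%:R^-1 < d.
    exists (Num.truncn d^-1); rewrite invf_plt ?posrE//; exact: truncnS_gt.
  exists n => // -[r _ [s _ [/andP[r0 r1] /andP[s0 s1]]]]; apply/negP; rewrite -leNgt.
  by apply: hd; apply/andP; split=> //; exact: lt_trans nd.
pose J : set R := `]a, b[%classic.
have mJ : measurable J by exact: measurable_itv.
have JE : J = (J `&` D) `|` (J `&` ~` D) by rewrite -setIUr setUCr setIT.
rewrite -/J JE; apply/measurable_funU; [exact: measurableI| |split].
- by apply: measurableI => //; exact: measurableC.
- apply: (@measurable_fun_cvg _ _ _ _ (fun n x => quot G x n.+1%:R^-1)).
    by move=> n; apply: measurable_funTS.
  move=> x [Jx Dx]; have axb : a < x < b by move: Jx; rewrite /J/= in_itv.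
  have := (DE x axb).1 Dx; rewrite /real_deriv within_itv_dnbhs// => cv.
  apply/cvgrPdist_le => e e0; move/cvgrPdist_le : (cv) => /(_ e e0).
  move=> /dnbhs_shiftP[d d0 hd].
  near=> n; rewrite -diff_quotE; apply: hd.
  rewrite ger0_norm ?invr_gt0 ?invr_ge0// ltr0n/=.
  near: n; exact: (near_infty_natSinv_lt (PosNum d0)).
(* Off [D] the limit does not exist and [lim] returns its default [point], so the derivative is
   constant there. *)
- apply: (@eq_measurable_fun _ _ _ _ _ (fun=> point)); last exact: measurable_cst.
  move=> x; rewrite inE => -[Jx nDx]; rewrite /real_deriv dvgP//.
  have axb : a < x < b by move: Jx; rewrite /J/= in_itv.
  by move=> cv; apply: nDx; exact: (DE x axb).2 cv.
Unshelve. all: by end_near. Qed.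

End measurable_derivative.

(** * Derivatives relative to the closed interval *)

Section interval_derivative.
Local Open Scope complex_scope.
Context (R : realType).
Variables a b : R.
Hypothesis ab : a < b.
Implicit Types (x l : R) (f g : R -> R).

Definition has_deriv f x l : Prop :=
  diff_quot f x z @[z --> within `[a, b] x^'] --> l.

(** Uniqueness of the limit rests on this. Points of the interval near [x] are found to its right,
    or to its left when x = b. *)
Lemma within_itv_proper x : x \in `[a, b] -> ProperFilter (within `[a, b] x^').
Proof.
rewrite in_itv/= => /andP[ax xb].
apply: Build_ProperFilter_ex; rewrite /within /= => U.
move=> /dnbhs_shiftP[d d0 hd].
have [xltb|bx] := ltP x b.
  pose h := Num.min (d / 2) (b - x).
  have h0 : 0 < h by rewrite lt_min subr_gt0 xltb andbT; lra.
  have hdd : h <= d / 2 by rewrite /h ge_min lexx.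
  have hb : h <= b - x by rewrite /h ge_min lexx orbT.
  exists (x + h); apply: hd; first by rewrite gtr0_norm// h0 /=; lra.
  by rewrite /= in_itv/=; apply/andP; split; lra.
pose h := Num.min (d / 2) (x - a).
have h0 : 0 < h by rewrite lt_min subr_gt0 (lt_le_trans ab bx) andbT; lra.
have hdd : h <= d / 2 by rewrite /h ge_min lexx.
have hb : h <= x - a by rewrite /h ge_min lexx orbT.
exists (x - h); apply: hd; first by rewrite normrN gtr0_norm// h0 /=; lra.
by rewrite /= in_itv/=; apply/andP; split; lra.
Qed.

Lemma has_deriv_real_deriv f x l : x \in `[a, b] -> has_deriv f x l ->
  real_derivable_at a b f x /\ real_deriv a b f x = l.
Proof.
move=> xab fl; have pF := within_itv_proper xab.
split; first by apply/cvg_ex; exists l.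
exact: (cvg_lim (@Rhausdorff R) fl).
Qed.

Lemma eq_diff_quot_cvg f g x l : x \in `[a, b] -> {in `[a, b], f =1 g} ->
  has_deriv f x l -> has_deriv g x l.
Proof.
move=> xab fg; apply: cvg_trans; apply: near_eq_cvg.
rewrite near_withinE; apply: nearW => z /= zab.
by rewrite /diff_quot !fg.
Qed.

(** The equality has to hold also where no limit exists, so the two image filters are shown to be
    equal, and not only their limits. *)
Lemma eq_real_deriv f g x : x \in `[a, b] -> {in `[a, b], f =1 g} ->
  real_deriv a b f x = real_deriv a b g x.
Proof.
move=> xab fg; have pF := within_itv_proper xab.
have E h k : {in `[a, b], h =1 k} ->
    diff_quot k x z @[z --> within `[a, b] x^'] `=>`
    diff_quot h x z @[z --> within `[a, b] x^'].
  move=> hk; apply: near_eq_cvg; rewrite near_withinE; apply: nearW => z /= zab.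
  by rewrite /diff_quot !hk.
rewrite /real_deriv; congr (lim _); apply/seteqP.
by split; apply: E => // z zab; rewrite fg.
Qed.

Lemma has_deriv_cst (c : R) x : has_deriv (fun=> c) x 0.
Proof.
rewrite /has_deriv /diff_quot; under eq_fun do rewrite subrr mul0r.
exact: cvg_cst.
Qed.

Lemma derivable_has_deriv f x l : derivable f x 1 -> derive1 f x = l ->
  has_deriv f x l.
Proof.
move=> df fl; rewrite /has_deriv.
apply: (@cvg_trans _ (diff_quot f x z @[z --> x^'])).
  by apply: cvg_within_filter; exact: cvg_id.
have cv : h^-1 *: (f (h + x) - f x) @[h --> 0^'] --> l.
  rewrite -fl derive1E /derive.
  have := df; rewrite /derivable /=.
  by under eq_fun => h do rewrite [h *: 1]mulr1.
apply/cvgrPdist_le => e e0.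
move/cvgrPdist_le : cv => /(_ e e0) /dnbhs_shiftP[d d0 hd].
apply/dnbhs_shiftP; exists d => // h hh; have := hd h hh.
by rewrite /= add0r /diff_quot [x + h]addrC addrK [h^-1 *: _]mulrC.
Qed.

End interval_derivative.

(** * Iterated derivatives along a chain of real functions *)

Section derivative_chain.
Local Open Scope complex_scope.
Context (R : realType).
Variables a b : R.
Hypothesis ab : a < b.
Variables (k : nat) (g : nat -> R -> R).
Hypothesis g_deriv : forall i x, (i < k)%N -> x \in `[a, b] ->
  has_deriv a b (g i) x (g i.+1 x).

Let y t : R[i] := (g 0%N t)%:C.

Lemma nderiv_chain s : (s <= k)%N -> {in `[a, b], forall x,
  nderiv a b s y x = (g s x)%:C}.
Proof.
elim: s => [//|s IH] sk x xab.
rewrite /nderiv /= -/(nderiv a b s y) /deriv.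
rewrite (@eq_real_deriv _ _ _ ab _ (g s))//; last first.
  by move=> z zab; rewrite IH// ltnW.
rewrite (@eq_real_deriv _ _ _ ab (fun t => complex.Im _) (fun=> 0))//; last first.
  by move=> z zab; rewrite IH// ltnW.
rewrite (has_deriv_real_deriv ab xab (g_deriv sk xab)).2.
by rewrite (has_deriv_real_deriv ab xab (has_deriv_cst _ _ _ _)).2.
Qed.

Lemma derivable_at_chain s x (l : R) : (s <= k)%N -> x \in `[a, b] ->
  has_deriv a b (g s) x l -> derivable_at a b (nderiv a b s y) x.
Proof.
move=> sk xab gl; split.
  suff : has_deriv a b (fun t => complex.Re (nderiv a b s y t)) x l.
    by move/(has_deriv_real_deriv ab xab) => [].
  by apply: eq_diff_quot_cvg gl => // z zab; rewrite nderiv_chain.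
suff : has_deriv a b (fun t => complex.Im (nderiv a b s y t)) x 0.
  by move/(has_deriv_real_deriv ab xab) => [].
by apply: eq_diff_quot_cvg (has_deriv_cst a b 0 x) => // z zab; rewrite nderiv_chain.
Qed.

(** Nothing is assumed about differentiability of [g k]: where its derivative does not exist, both
    sides carry the same default value. *)
Lemma nderivS_chain x : x \in `[a, b] ->
  nderiv a b k.+1 y x = (real_deriv a b (g k) x)%:C.
Proof.
move=> xab; rewrite /nderiv /= -/(nderiv a b k y) /deriv.
rewrite (@eq_real_deriv _ _ _ ab _ (g k))//; last first.
  by move=> z zab; rewrite nderiv_chain.
rewrite (@eq_real_deriv _ _ _ ab (fun t => complex.Im _) (fun=> 0))//; last first.
  by move=> z zab; rewrite nderiv_chain.
by rewrite (has_deriv_real_deriv ab xab (has_deriv_cst _ _ _ _)).2.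
Qed.

End derivative_chain.

(** * The complex modulus against real and imaginary parts *)

Section complex_modulus.
Local Open Scope complex_scope.
Context (R : realType).
Implicit Types z : R[i].

Lemma normc_ge_Re z : `|complex.Re z| <= Normc.normc z.
Proof.
case: z => x y /=; rewrite -sqrtr_sqr ler_wsqrtr// lerDl; exact: sqr_ge0.
Qed.

Lemma normc_ge_Im z : `|complex.Im z| <= Normc.normc z.
Proof.
case: z => x y /=; rewrite -sqrtr_sqr ler_wsqrtr// lerDr; exact: sqr_ge0.
Qed.

Lemma normc_le_ReIm z : Normc.normc z <= `|complex.Re z| + `|complex.Im z|.
Proof.
case: z => x y /=; rewrite -[leRHS]ger0_norm ?addr_ge0// -sqrtr_sqr.
apply: ler_wsqrtr; rewrite sqrrD !real_normK ?num_real//.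
by rewrite addrAC lerDl mulrn_wge0// mulr_ge0.
Qed.

Lemma normc_real (x : R) : Normc.normc x%:C = `|x|.
Proof. by rewrite /= expr0n addr0 sqrtr_sqr. Qed.

Lemma normc_ge0 z : 0 <= Normc.normc z.
Proof. exact: le_trans (normc_ge_Re z). Qed.

End complex_modulus.

(** * Extension by zero outside the interval *)

Section cut_functions.
Local Open Scope complex_scope.
Context (R : realType).
Variables a b : R.
Notation mu := (@lebesgue_measure R).
Implicit Types (f : R -> R) (F : R -> R[i]) (q : \bar R).

Definition cut f (t : R) : R := f t * \1_(`[a, b]%classic) t.

Lemma cut_in f t : t \in `[a, b] -> cut f t = f t.
Proof. by move=> tab; rewrite /cut indicE mem_set ?mulr1. Qed.

Lemma cut_out f t : ~ `[a, b]%classic t -> cut f t = 0.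
Proof. by move=> tab; rewrite /cut indicE memNset ?mulr0. Qed.

Lemma measurable_cut f : measurable_fun `[a, b] f <-> measurable_fun setT (cut f).
Proof.
have -> : cut f = f \_ `[a, b] by rewrite patch_indic.
by apply: measurable_restrictT; exact: measurable_itv.
Qed.

Lemma normc_cut F t : Normc.normc (F t) * \1_(`[a, b]%classic) t =
  Normc.normc (cut (fun t => complex.Re (F t)) t +i* cut (fun t => complex.Im (F t)) t).
Proof.
have [tab|tab] := pselect (`[a, b]%classic t).
  by rewrite !cut_in// indicE mem_set// mulr1; case: (F t).
by rewrite !cut_out// indicE memNset// mulr0 (normc_real 0) normr0.
Qed.

Lemma measurable_normc_cut F :
  measurable_fun `[a, b] (fun t => complex.Re (F t)) ->
  measurable_fun `[a, b] (fun t => complex.Im (F t)) ->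
  measurable_fun setT (fun t => Normc.normc (F t) * \1_(`[a, b]%classic) t).
Proof.
move=> /measurable_cut mRe /measurable_cut mIm.
under eq_fun do rewrite normc_cut /=.
apply: (@measurableT_comp _ _ _ _ _ _ (@Num.sqrt R)).
  apply: continuous_measurable_fun; exact: sqrt_continuous.
by apply: measurable_funD; exact: measurable_funX.
Qed.

Lemma in_Lp_Lp_fun q F : in_Lp a b q F ->
  Lp_fun mu q (fun t => Normc.normc (F t) * \1_(`[a, b]%classic) t).
Proof. by case=> mRe mIm fin; split=> //; exact: measurable_normc_cut. Qed.

Lemma in_Lp_Re q F : (1 <= q)%E -> in_Lp a b q F ->
  Lp_fun mu q (cut (fun t => complex.Re (F t))) /\
  Lp_val mu q (cut (fun t => complex.Re (F t))) <= fine (Lp_norm a b q F).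
Proof.
move=> q1 pF; have pN := in_Lp_Lp_fun pF; have [mRe mIm _] := pF.
apply: (@Lp_fun_le _ _ _ mu q _ _ q1 _ pN); first exact/measurable_cut.
apply: aeW => t; rewrite normc_cut [leRHS]ger0_norm ?normc_ge0//.
exact: (normc_ge_Re (_ +i* _)).
Qed.

Lemma in_Lp_Im q F : (1 <= q)%E -> in_Lp a b q F ->
  Lp_fun mu q (cut (fun t => complex.Im (F t))) /\
  Lp_val mu q (cut (fun t => complex.Im (F t))) <= fine (Lp_norm a b q F).
Proof.
move=> q1 pF; have pN := in_Lp_Lp_fun pF; have [mRe mIm _] := pF.
apply: (@Lp_fun_le _ _ _ mu q _ _ q1 _ pN); first exact/measurable_cut.
apply: aeW => t; rewrite normc_cut [leRHS]ger0_norm ?normc_ge0//.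
exact: (normc_ge_Im (_ +i* _)).
Qed.

Lemma Lp_norm_le_ReIm q F : (1 <= q)%E ->
  Lp_fun mu q (cut (fun t => complex.Re (F t))) ->
  Lp_fun mu q (cut (fun t => complex.Im (F t))) ->
  (Lp_norm a b q F <= (Lp_val mu q (cut (fun t => complex.Re (F t))) +
     Lp_val mu q (cut (fun t => complex.Im (F t))))%R%:E)%E.
Proof.
move=> q1 pRe pIm.
have [paRe naRe] : Lp_fun mu q (fun t => `|cut (fun t => complex.Re (F t)) t|) /\
    Lp_val mu q (fun t => `|cut (fun t => complex.Re (F t)) t|) <=
    Lp_val mu q (cut (fun t => complex.Re (F t))).
  apply: (@Lp_fun_le _ _ _ mu q _ _ q1 _ pRe).
    by apply: measurableT_comp => //; case: pRe.
  by apply: aeW => t; rewrite normr_id.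
have [paIm naIm] : Lp_fun mu q (fun t => `|cut (fun t => complex.Im (F t)) t|) /\
    Lp_val mu q (fun t => `|cut (fun t => complex.Im (F t)) t|) <=
    Lp_val mu q (cut (fun t => complex.Im (F t))).
  apply: (@Lp_fun_le _ _ _ mu q _ _ q1 _ pIm).
    by apply: measurableT_comp => //; case: pIm.
  by apply: aeW => t; rewrite normr_id.
have [pS nS] := @Lp_funD _ _ _ mu q _ _ q1 paRe paIm.
have mN : measurable_fun setT (fun t => Normc.normc (F t) * \1_(`[a, b]%classic) t).
  by apply: measurable_normc_cut; apply/measurable_cut; [case: pRe|case: pIm].
have := @Lp_fun_le _ _ _ mu q _ _ q1 mN pS.
case; first apply: aeW => t.
  rewrite normc_cut [leLHS]ger0_norm ?normc_ge0// [leRHS]ger0_norm ?addr_ge0//.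
  exact: (normc_le_ReIm (_ +i* _)).
move=> pN nN; rewrite /Lp_norm.
have -> : (fun t => (Normc.normc (F t) * \1_(`[a, b]%classic) t)%:E) =
  EFin \o (fun t => Normc.normc (F t) * \1_(`[a, b]%classic) t) by [].
rewrite (@Lp_valE _ _ _ mu q _ pN) lee_fin (le_trans nN)// (le_trans nS)//.
exact: lerD.
Qed.

Lemma Lp_norm_real q F f : {in `[a, b], forall t, F t = (f t)%:C} ->
  Lp_norm a b q F = Lnorm mu q (EFin \o cut f).
Proof.
move=> Ff; rewrite /Lp_norm -[RHS]Lnorm_abse; apply: eq_Lnorm => t /=.
have [tab|tab] := pselect (`[a, b]%classic t).
  by rewrite cut_in// indicE mem_set// mulr1 Ff// normc_real.
by rewrite cut_out// indicE memNset// mulr0 normr0.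
Qed.

End cut_functions.

(** * Sobolev functions from chains of derivatives *)

Definition real_abs_cont (R : realType) (a b : R) (f : R -> R) : Prop :=
  forall e : R, 0 < e -> exists2 d : R, 0 < d &
    forall (N : nat) (u v : 'I_N -> R),
      (forall i, [/\ a <= u i, u i <= v i & v i <= b]) ->
      trivIset setT (fun i => `]u i, v i[%classic) ->
      \sum_(i < N) (v i - u i) < d ->
      \sum_(i < N) `|f (v i) - f (u i)| < e.

Section chain_sobolev.
Local Open Scope complex_scope.
Context (R : realType).
Variables a b p : R.
Hypotheses (ab : a < b) (p1 : 1 <= p).
Notation mu := (@lebesgue_measure R).
Variables (k : nat) (g : nat -> R -> R) (h : R -> R).
Hypothesis g_deriv : forall i x, (i < k)%N -> x \in `[a, b] ->
  has_deriv a b (g i) x (g i.+1 x).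
Hypothesis g_cont : forall i, (i <= k)%N -> continuous (g i).
Hypothesis g_ac : real_abs_cont a b (g k).
Hypothesis ph : Lp_fun mu p%:E (cut a b h).
Hypothesis h_ae : {ae mu, forall x, x \in `[a, b] -> has_deriv a b (g k) x (h x)}.

Let y t : R[i] := (g 0%N t)%:C.
Let p1e : (1 <= p%:E)%E. Proof. by rewrite lee_fin. Qed.

Lemma nderivS_chain_ae :
  {ae mu, forall x, x \in `[a, b] -> nderiv a b k.+1 y x = (h x)%:C}.
Proof.
apply: (@filterS _ _ (ae_filter_ringOfSetsType mu) _ _ _ h_ae) => x hx xab.
by rewrite (nderivS_chain ab g_deriv xab) (has_deriv_real_deriv ab xab (hx xab)).2.
Qed.

Let pd : Lp_fun mu p%:E (cut a b (real_deriv a b (g k))) /\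
  Lp_val mu p%:E (cut a b (real_deriv a b (g k))) <= Lp_val mu p%:E (cut a b h).
Proof.
apply: (@Lp_fun_le _ _ _ mu p%:E _ _ p1e _ ph).
  by apply/measurable_cut; apply: measurable_real_deriv; exact: g_cont.
apply: (@filterS _ _ (ae_filter_ringOfSetsType mu) _ _ _ h_ae) => x hx.
have [xab|xab] := pselect (`[a, b]%classic x); last by rewrite !cut_out.
by rewrite !cut_in// (has_deriv_real_deriv ab xab (hx xab)).2.
Qed.

Lemma Lp_norm_nderivS_chain :
  (Lp_norm a b p%:E (nderiv a b k.+1 y) <= (Lp_val mu p%:E (cut a b h))%:E)%E.
Proof.
rewrite (@Lp_norm_real _ a b p%:E _ (real_deriv a b (g k))); last first.
  by move=> x xab; rewrite (nderivS_chain ab g_deriv xab).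
by rewrite (@Lp_valE _ _ _ mu p%:E _ pd.1) lee_fin pd.2.
Qed.

(** A function bounded by [S] has norm at most S (b - a)^(1/p), and the two lower bounds on [L] give
    (b - a)^(1/p) <= L for every p >= 1. *)
Lemma Lp_norm_nderiv_chain s (S L : R) : (s <= k)%N ->
  {in `[a, b], forall x, `|g s x| <= S} -> 1 <= L -> b - a <= L ->
  (Lp_norm a b p%:E (nderiv a b s y) <= (S * L)%:E)%E.
Proof.
move=> sk gS L1 baL.
have S0 : 0 <= S.
  by apply: le_trans (gS a _); rewrite ?normr_ge0// in_itv/= lexx ltW.
rewrite (@Lp_norm_real _ a b p%:E _ (g s)); last by move=> x xab; rewrite (nderiv_chain ab g_deriv sk).
have mI : measurable `[a, b]%classic by exact: measurable_itv.
have mIE : mu `[a, b]%classic = (b - a)%:E.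
  by rewrite lebesgue_measure_itv/= lte_fin ab.
have pI : Lp_fun mu p%:E (\1_(`[a, b]%classic) : R -> R).
  apply: (@Lp_fun_indic _ _ _ mu p _ p1 mI).
  exact: (eq_ind_r (fun z => z < +oo)%E (ltry _) mIE).
have [pS nS] := @Lp_funZ _ _ _ mu p%:E S _ p1e pI.
have [||pc nc] := @Lp_fun_le _ _ _ mu p%:E (cut a b (g s)) _ p1e _ pS.
- apply/measurable_cut; apply: measurable_funTS.
  by apply: continuous_measurable_fun; exact: g_cont.
- apply: aeW => x; rewrite /cut normrM [leRHS]normrM (ger0_norm S0).
  have [xab|xab] := pselect (`[a, b]%classic x).
    by rewrite ler_wpM2r// gS.
  by rewrite indicE memNset// normr0 !mulr0.
rewrite (@Lp_valE _ _ _ mu p%:E _ pc) lee_fin (le_trans nc)// nS ger0_norm//.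
rewrite ler_wpM2l// -lee_fin -Lp_valE//.
have -> : (Lnorm mu p%:E (EFin \o (\1_(`[a, b]%classic) : R -> R)) =
    lebesgue_measure `[a, b]%classic `^ p^-1)%E by exact: Lnorm_indic.
rewrite mIE poweR_EFin lee_fin.
have p0 : 0 < p by exact: lt_le_trans ltr01 p1.
apply: (@le_trans _ _ (L `^ p^-1)).
  apply: ge0_ler_powR; rewrite ?nnegrE ?invr_ge0 ?(ltW p0)// ?subr_ge0 ?(ltW ab)//.
  exact: le_trans ler01 L1.
rewrite -[leRHS]powRr1 ?(le_trans ler01 L1)//; apply: ler_powR => //.
by rewrite invf_le1.
Qed.

Lemma chain_sobolev : sobolev a b p k.+1 y.
Proof.
rewrite /sobolev; split.
- move=> s sk x xab.
  by apply: (derivable_at_chain ab g_deriv (ltnW sk) xab); exact: g_deriv.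
- move=> e e0; have [d d0 hd] := g_ac e0; exists d => // N u v uv tr sd.
  apply: le_lt_trans (hd N u v uv tr sd); apply: ler_sum => i _.
  have [au uvi vb] := uv i.
  have uab : u i \in `[a, b] by rewrite in_itv/= au (le_trans uvi).
  have vab : v i \in `[a, b] by rewrite in_itv/= vb (le_trans au).
  rewrite (nderiv_chain ab g_deriv (leqnn k) uab) (nderiv_chain ab g_deriv (leqnn k) vab).
  by rewrite -raddfB normc_real.
- apply: (@filterS _ _ (ae_filter_ringOfSetsType mu) _ _ _ h_ae) => x hx xab.
  by apply: (derivable_at_chain ab g_deriv (leqnn k) xab); exact: hx.
- have mre : measurable_fun `[a, b] (real_deriv a b (g k)).
    by apply: measurable_real_deriv; exact: g_cont.
  split.
  + apply: eq_measurable_fun mre => x; rewrite inE => xab.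
    by rewrite (nderivS_chain ab g_deriv xab).
  + apply: (@eq_measurable_fun _ _ _ _ _ (fun _ : R => 0 : R)); last exact: measurable_cst.
    by move=> x; rewrite inE => xab; rewrite (nderivS_chain ab g_deriv xab).
  + exact: le_lt_trans Lp_norm_nderivS_chain (ltry _).
Qed.

End chain_sobolev.

(** * Primitives vanishing at t0 *)

Section primitive.
Context (R : realType).
Variables a b t0 : R.
Hypotheses (ab : a < b) (t0ab : t0 \in `[a, b]).
Notation mu := (@lebesgue_measure R).
Implicit Types (h : R -> R) (x u v : R).

(* A neighbourhood of [a, b] is used so that the endpoints are interior and
   two-sided differentiation theorems apply to [prim h] there. *)
Let wide h := cut (a - 1) (b + 1) h.

(** The signed integral from t0 to x; half-lines make one formula serve both orders of t0 and x. *)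
Definition prim h x : R :=
  \int[mu]_(t in `]-oo, x]) wide h t - \int[mu]_(t in `]-oo, t0]) wide h t.

Definition wide_integrable h := mu.-integrable setT (EFin \o wide h).

Definition wide_norm1 h : R := \int[mu]_t `|wide h t|.

Lemma continuous_wide_integrable h : continuous h -> wide_integrable h.
Proof.
move=> ch; have /(integrable_mkcond _ _).1 : mu.-integrable `[a - 1, b + 1] (EFin \o h).
  apply: continuous_compact_integrable; first exact: segment_compact.
  exact: continuous_subspaceT.
by move=> /(_ (measurable_itv _)); rewrite epatch_indic; congr (integrable _ _ _).
Qed.

Lemma prim_t0 h : prim h t0 = 0. Proof. exact: subrr. Qed.

Section integrable.
Variable h : R -> R.
Hypothesis ih : wide_integrable h.

Let ihS A : measurable A -> mu.-integrable A (EFin \o wide h).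
Proof. by move=> mA; apply: integrableS ih. Qed.

Let ihN A : measurable A -> mu.-integrable A (EFin \o (fun t => `|wide h t|)).
Proof. by move=> mA; exact: integrable_norm (ihS mA). Qed.

Lemma prim_diff u v : u <= v ->
  prim h v - prim h u = \int[mu]_(t in `]u, v]) wide h t.
Proof.
move=> uv; rewrite /prim opprB addrA subrK.
by apply: Rintegral_itvB => //; apply: ihS; exact: measurable_itv.
Qed.

Lemma prim_diff_le u v : u <= v ->
  `|prim h v - prim h u| <= \int[mu]_(t in `]u, v]) `|wide h t|.
Proof.
move=> uv; rewrite prim_diff//; apply: le_normr_Rintegral => //.
exact: ihS.
Qed.

Lemma wide_integral_le (A : set R) : measurable A ->
  \int[mu]_(t in A) `|wide h t| <= wide_norm1 h.
Proof.
move=> mA; rewrite -lee_fin /wide_norm1 /Rintegral !fineK; last 2 first.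
- exact: integrable_fin_num (ihN measurableT).
- exact: integrable_fin_num (ihN mA).
apply: ge0_subset_integral => //=.
by have /integrableP[] := ihN measurableT.
Qed.

Lemma prim_le x : `|prim h x| <= wide_norm1 h.
Proof.
have [xt0|t0x] := leP x t0.
  rewrite -[prim h x]subr0 -(prim_t0 h) distrC (le_trans (prim_diff_le xt0))//.
  exact: wide_integral_le.
rewrite -[prim h x]subr0 -(prim_t0 h) (le_trans (prim_diff_le (ltW t0x)))//.
exact: wide_integral_le.
Qed.

Lemma prim_continuous : continuous (prim h).
Proof.
move=> x; apply/cvgrPdist_lt => e e0.
have [d [d0 hd]] := integral_normr_continuous ih e0.
apply/nbhs_ballP; exists d => //= z; rewrite /ball/= => xz.
have small u v : u <= v -> v - u < d -> `|prim h v - prim h u| < e.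
  move=> uv vud; apply: le_lt_trans (prim_diff_le uv) _; apply: hd => //.
  rewrite -[X in (X < _)%E]/(lebesgue_measure `]u, v]%classic).
  rewrite lebesgue_measure_itv/= lte_fin; case: ifPn => _; last by rewrite lte_fin.
  by rewrite -EFinD lte_fin.
have [zx|/ltW xz'] := leP z x.
  by apply: small => //; move: xz; rewrite ger0_norm// subr_ge0.
rewrite distrC; apply: small => //; move: xz; rewrite distrC ger0_norm// subr_ge0.
by [].
Qed.

(** Absolute continuity of the integral, applied to the union [D] of the disjoint intervals, whose
    measure is at most the sum of their lengths. *)
Lemma prim_abs_cont : real_abs_cont a b (prim h).
Proof.
move=> e e0; have [d [d0 hd]] := integral_normr_continuous ih e0.
exists d => // N u v uv tr sd.
pose J i : set R := `]u i, v i[%classic.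
have mJ i : measurable (J i) by exact: measurable_itv.
have trJ : trivIset [set` index_enum 'I_N] J.
  by apply: sub_trivIset tr.
pose D := \big[setU/set0]_(i <- index_enum 'I_N) J i.
have mD : measurable D by exact: bigsetU_measurable.
have muD : (mu D < d%:E)%E.
  have -> : mu D = (\int[mu]_(x in D) 1)%E by rewrite integral_cst// mul1e.
  rewrite (ge0_integral_bigsetU mu mJ)//; last exact: index_enum_uniq.
  rewrite (eq_bigr (fun i => mu (J i))); last by move=> i _; rewrite integral_cst ?mul1e; [|exact: mJ].
  apply: le_lt_trans (_ : (\sum_(i < N) (v i - u i)%:E < _)%E); last first.
    by rewrite sumEFin lte_fin.
  apply: lee_sum => i _; rewrite -[leLHS]/(lebesgue_measure `]u i, v i[%classic) lebesgue_measure_itv/= lte_fin.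
  have [_ uvi _] := uv i.
  by case: ifPn => _; [rewrite EFinD|rewrite lee_fin subr_ge0].
apply: le_lt_trans (hd D mD muD).
rewrite -lee_fin -sumEFin /Rintegral fineK; last first.
  exact: integrable_fin_num (ihN mD).
rewrite (ge0_integral_bigsetU mu mJ)//; last 2 first.
- exact: index_enum_uniq.
- by have /integrableP[] := ihN mD.
apply: lee_sum => i _; have [_ uvi _] := uv i.
have -> : (\int[mu]_(x in J i) `|wide h x|%:E)%E =
    (\int[mu]_(x in `]u i, v i]) `|wide h x|)%:E.
  rewrite -Rintegral_itv_bndo_bndc; last exact: ihN.
  rewrite /Rintegral fineK; first by [].
  exact: (@integrable_fin_num _ _ _ mu _ (mJ i) _ (ihN (mJ i))).
by rewrite lee_fin; exact: prim_diff_le.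
Qed.

Let has_deriv_prim x l :
  has_deriv a b (fun z => \int[mu]_(t in `]-oo, z]) wide h t) x l ->
  has_deriv a b (prim h) x l.
Proof.
have E : diff_quot (prim h) x =
    diff_quot (fun z => \int[mu]_(t in `]-oo, z]) wide h t) x.
  by apply/funext => z; rewrite /diff_quot /prim opprB addrA subrK.
by rewrite /has_deriv E.
Qed.

Lemma prim_deriv_continuous x : continuous h -> x \in `[a, b] ->
  has_deriv a b (prim h) x (h x).
Proof.
move=> ch xab; apply: has_deriv_prim.
have xw : x \in `]a - 1, b + 1[ by move: xab; rewrite !in_itv/=; lra.
have cw : {for x, continuous (wide h)}.
  rewrite /prop_for /continuous_at [wide h x]cut_in; last first.
    by move: xw; rewrite !in_itv/=; lra.
  apply: cvg_trans (ch x); apply: near_eq_cvg.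
  near=> z; rewrite /wide cut_in//; apply: subset_itv_oo_cc.
  by near: z; exact: near_in_itvoo.
have [|||df dE] := @continuous_FTC1 R (wide h) -oo%O x (x + 1) _ _ _ cw.
- by rewrite ltrDl.
- exact: ihS.
- by rewrite ltNyr.
apply: derivable_has_deriv => //.
by rewrite dE [LHS]cut_in//; move: xw; rewrite !in_itv/=; lra.
Unshelve. all: by end_near. Qed.

Lemma prim_deriv_ae : {ae mu, forall x, x \in `[a, b] -> has_deriv a b (prim h) x (h x)}.
Proof.
have loc : locally_integrable setT (wide h).
  have := @integrable_locally R (wide h) setT measurableT ih.
  by rewrite patch_setT.
have := @FTC1Ny R (wide h) (fun y => ihS (measurable_itv _)) loc.
apply: (@filterS _ _ (ae_filter_ringOfSetsType mu)) => x [df dE] xab.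
apply: has_deriv_prim; apply: derivable_has_deriv => //.
by rewrite dE [LHS]cut_in//; move: xab; rewrite !in_itv/=; lra.
Qed.

End integrable.

(** The factor b - a + 2 is the length of [a - 1, b + 1]. *)
Lemma wide_norm1_le h (S : R) : 0 <= S -> wide_integrable h ->
  (forall x, `|h x| <= S) -> wide_norm1 h <= (b - a + 2) * S.
Proof.
move=> S0 ih hS.
have iw : mu.-integrable setT (EFin \o (\1_(`[a - 1, b + 1]%classic) : R -> R)).
  apply: integrable_indic_lty; first exact: measurable_itv.
  rewrite -[X in (X < _)%E]/(lebesgue_measure `[a - 1, b + 1]%classic).
  by rewrite lebesgue_measure_itv/= lte_fin; case: ifP => _; rewrite -?EFinD ltry.
have iI : \int[mu]_t (\1_(`[a - 1, b + 1]%classic) t : R) = b - a + 2.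
  rewrite /Rintegral integral_indic//.
  rewrite setIT -[X in fine X]/(lebesgue_measure `[a - 1, b + 1]%classic).
  rewrite lebesgue_measure_itv/= lte_fin; have -> : (a - 1 < b + 1)%R by move: ab; lra.
  by rewrite -EFinD/=; ring.
rewrite mulrC -iI -RintegralZl//; apply: le_Rintegral => //.
- exact: integrable_norm.
- exact: (integrableZl measurableT S iw).
- move=> x _; rewrite /wide /cut normrM ler_pM//.
  by rewrite indicE; case: (_ \in _); rewrite ?normr1// normr0.
Qed.

End primitive.

(** * Test functions with prescribed derivatives *)

Section test_functions.
Local Open Scope complex_scope.
Context (R : realType).
Variables a b t0 p : R.
Hypotheses (ab : a < b) (t0ab : t0 \in `[a, b]) (p1 : 1 <= p).
Notation mu := (@lebesgue_measure R).
Implicit Types (f h : R -> R).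

(** The length of the widened interval: each further integration multiplies a uniform bound by at
    most [L]. *)
Let L := b - a + 2.
Let L1 : 1 <= L. Proof. by rewrite /L; move: ab; lra. Qed.
Let L0 : 0 <= L. Proof. exact: le_trans ler01 L1. Qed.
Let baL : b - a <= L. Proof. by rewrite /L; lra. Qed.

Definition iprim j h : R -> R := iter j (prim a b t0) h.

Lemma iprim_continuous j h : wide_integrable a b h -> continuous (iprim j.+1 h).
Proof.
move=> ih; elim: j => [|j IH]; first exact: prim_continuous.
by apply: prim_continuous; exact: continuous_wide_integrable.
Qed.

Lemma iprim_t0 j h : iprim j.+1 h t0 = 0.
Proof. exact: prim_t0. Qed.

Lemma iprim_le j h x : wide_integrable a b h ->
  `|iprim j.+1 h x| <= L ^+ j * wide_norm1 a b h.
Proof.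
move=> ih; elim: j x => [|j IH] x; first by rewrite mul1r; exact: prim_le.
have ij : wide_integrable a b (iprim j.+1 h).
  by apply: continuous_wide_integrable; exact: iprim_continuous.
apply: le_trans (prim_le t0 ij x) _.
have W0 : 0 <= wide_norm1 a b h by apply: Rintegral_ge0 => t _.
rewrite exprS -mulrA; apply: (wide_norm1_le ab _ ij) => [|z]; last exact: IH.
by rewrite mulr_ge0// exprn_ge0.
Qed.

Let wide_cut f : cut (a - 1) (b + 1) (cut a b f) = cut a b f.
Proof.
apply/funext => x; have [xab|xab] := pselect (`[a, b]%classic x).
  by rewrite cut_in//; move: xab; rewrite /= !in_itv/=; lra.
by rewrite [RHS]cut_out// {1}/cut cut_out// mul0r.
Qed.

Let le_powR1 (x : R) : `|x| <= 1 + `|x| `^ p.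
Proof.
have [x1|x1] := leP `|x| 1; first by rewrite (le_trans x1)// lerDl powR_ge0.
rewrite -[leLHS](powRr1 (normr_ge0 x)) (le_trans (ler_powR (ltW x1) p1))//.
by rewrite lerDr.
Qed.

Let mI : measurable `[a, b]%classic.
Proof. exact: measurable_itv. Qed.

(** Obtained by integrating the pointwise bound |x| <= 1 + |x|^p over [a, b]: the constant
    contributes b - a <= L, and the p-th power at most 1. *)
Let Lp_cut_L1 f : Lp_fun mu p%:E f -> Lp_val mu p%:E f <= 1 ->
  mu.-integrable setT (EFin \o cut a b f) /\ \int[mu]_x `|cut a b f x| <= L + 1.
Proof.
move=> pf nf; have [mf _] := pf.
have mc : measurable_fun setT (cut a b f).
  by apply/measurable_cut; exact: measurable_funTS.
have iI : mu.-integrable setT (EFin \o (\1_(`[a, b]%classic) : R -> R)).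
  apply: integrable_indic_lty => //.
  rewrite -[X in (X < _)%E]/(lebesgue_measure `[a, b]%classic).
  by rewrite lebesgue_measure_itv/= lte_fin ab -EFinD ltry.
have mp : measurable_fun setT (fun x => `|f x| `^ p).
  apply: (@measurableT_comp _ _ _ _ _ _ (@powR R ^~ p)) => //.
  exact: measurableT_comp.
have intp : (\int[mu]_x (`|f x| `^ p)%:E)%E = (Lp_val mu p%:E f `^ p)%:E.
  exact: int_normX.
have ip : mu.-integrable setT (EFin \o (fun x => `|f x| `^ p)).
  apply/integrableP; split; first exact/measurable_EFinP.
  under eq_integral do rewrite /= ger0_norm ?powR_ge0//.
  by rewrite intp ltry.
have iS : mu.-integrable setT
    (EFin \o (fun x => \1_(`[a, b]%classic) x + `|f x| `^ p : R)).
  exact: (integrableD measurableT iI ip).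
have le_cut x : `|cut a b f x| <= \1_(`[a, b]%classic) x + `|f x| `^ p.
  rewrite /cut normrM indicE; case: (x \in _); rewrite /= ?normr1 ?mulr1//.
  by rewrite normr0 mulr0 add0r powR_ge0.
have ic : mu.-integrable setT (EFin \o cut a b f).
  apply: (le_integrable measurableT _ _ iS); first exact/measurable_EFinP.
  by move=> x _; rewrite !abse_EFin lee_fin [leRHS]ger0_norm//.
split=> //.
apply: le_trans (_ : \int[mu]_x (\1_(`[a, b]%classic) x + `|f x| `^ p : R) <= _).
  by apply: le_Rintegral => //; exact: integrable_norm.
rewrite RintegralD// lerD//.
  rewrite /Rintegral integral_indic// setIT.
  rewrite -[X in fine X]/(lebesgue_measure `[a, b]%classic).
  by rewrite lebesgue_measure_itv/= lte_fin ab/= baL.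
rewrite /Rintegral intp /= (_ : 1 = 1 `^ p); last by rewrite powR1.
apply: ge0_ler_powR; rewrite ?nnegrE ?Lp_val_ge0//.
exact: le_trans ler01 p1.
Qed.

Let sum_Lp_norm_le k (y : R -> R[i]) (S S' : R) :
  (forall s, (s <= k)%N -> Lp_norm a b p%:E (nderiv a b s y) <= S%:E)%E ->
  (Lp_norm a b p%:E (nderiv a b k.+1 y) <= S'%:E)%E ->
  (\sum_(s < k.+2) Lp_norm a b p%:E (nderiv a b s y) <= (k.+1%:R * S + S')%:E)%E.
Proof.
move=> hS hS'; rewrite big_ord_recr/= EFinD; apply: leeD => //.
apply: (@le_trans _ _ (\sum_(s < k.+1) S%:E)%E).
  by apply: lee_sum => s _; apply: hS; rewrite -ltnS.
by rewrite sumEFin sumr_const card_ord mulr_natl.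
Qed.

(** [y] is the (k+1)-fold primitive of [c * f], every primitive being taken to vanish at t0.
    Choosing [c] before [f] keeps the later operator-norm estimates uniform. *)
Lemma test_function_Lp k : exists2 c : R, 0 < c & forall f,
  Lp_fun mu p%:E f -> Lp_val mu p%:E f <= 1 -> exists y : R -> R[i],
  [/\ sobolev a b p k.+1 y,
      (\sum_(s < k.+2) Lp_norm a b p%:E (nderiv a b s y) <= 1)%E,
      forall s, (s <= k)%N -> nderiv a b s y t0 = 0 &
      {ae mu, forall x, x \in `[a, b] -> nderiv a b k.+1 y x = (c * f x)%:C}].
Proof.
(* The k + 1 lower derivatives are bounded by c L^k (L + 1), hence have norm at most L times that;
   the summand 1 accounts for the top derivative. *)
pose K := k.+1%:R * (L ^+ k * (L + 1) * L) + 1.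
have K0 : 0 < K.
  rewrite ltr_wpDl// mulr_ge0// mulr_ge0// mulr_ge0 ?exprn_ge0// addr_ge0//.
pose c := K^-1; have c0 : 0 < c by rewrite invr_gt0.
exists c => // f pf nf.
have [icut ncut] := Lp_cut_L1 pf nf.
pose h := cut a b (fun x => c * f x).
have hE x : h x = c * cut a b f x by rewrite /h /cut mulrA.
have whE : cut (a - 1) (b + 1) h = h by exact: wide_cut.
have ih : wide_integrable a b h.
  rewrite /wide_integrable whE.
  have := integrableZl measurableT c icut; congr (integrable _ _ _).
  by apply/funext => x; rewrite /= hE EFinM.
have nh : wide_norm1 a b h <= c * (L + 1).
  rewrite /wide_norm1 whE.
  under eq_Rintegral do rewrite hE normrM (gtr0_norm c0).
  by rewrite RintegralZl ?ler_pM2l//; exact: integrable_norm.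
(* [g i] is the i-th derivative of [g 0]: each index removes one of the k + 1 primitives. *)
pose g i := iprim (k.+1 - i) h.
have gS i : (i < k)%N -> g i = prim a b t0 (g i.+1).
  by move=> ik; rewrite /g subSS subSn// ltnW.
have gE i : (i <= k)%N -> exists j, [/\ (j <= k)%N & g i = iprim j.+1 h].
  by move=> ik; exists (k - i)%N; rewrite /g subSn// leq_subr.
have g_cont i : (i <= k)%N -> continuous (g i).
  by move=> /gE[j [_ ->]]; exact: iprim_continuous.
have g_deriv i x : (i < k)%N -> x \in `[a, b] -> has_deriv a b (g i) x (g i.+1 x).
  move=> ik xab; rewrite gS//; apply: prim_deriv_continuous => //.
    by apply: continuous_wide_integrable; exact: g_cont.
  exact: g_cont.
have gk : g k = prim a b t0 h by rewrite /g subSnn.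
have g_ac : real_abs_cont a b (g k) by rewrite gk; exact: prim_abs_cont.
have p1e : (1 <= p%:E)%E by rewrite lee_fin.
have [pcf ncf] := @Lp_funZ _ _ _ mu p%:E c _ p1e pf.
have mch : measurable_fun setT (cut a b (fun x => c * f x)).
  by apply/measurable_cut; apply: measurable_funTS; case: pcf.
have ae_le : {ae mu, forall x, `|cut a b (fun x => c * f x) x| <= `|c * f x|}.
  apply: aeW => x; rewrite /cut normrM indicE; case: (x \in _).
    by rewrite normr1 mulr1.
  by rewrite normr0 mulr0.
have [ph nph] := @Lp_fun_le _ _ _ mu p%:E _ _ p1e mch pcf ae_le.
have h_ae : {ae mu, forall x, x \in `[a, b] -> has_deriv a b (g k) x (c * f x)}.
  apply: (@filterS _ _ (ae_filter_ringOfSetsType mu) _ _ _ (prim_deriv_ae t0 ih)) => x hx xab.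
  by have := hx xab; rewrite gk /h cut_in.
exists (fun t => (g 0%N t)%:C); split.
- exact: (chain_sobolev ab p1 g_deriv g_cont g_ac ph h_ae).
- have gb s : (s <= k)%N -> {in `[a, b], forall x, `|g s x| <= L ^+ k * (c * (L + 1))}.
    move=> sk x _; have [j [jk ->]] := gE s sk.
    apply: le_trans (iprim_le j x ih) _; apply: ler_pM => //.
    + by rewrite exprn_ge0.
    + by apply: Rintegral_ge0 => t _.
    + exact: ler_weXn2l.
  apply: le_trans (sum_Lp_norm_le (fun s sk =>
    Lp_norm_nderiv_chain ab p1 g_deriv g_cont sk (gb s sk) L1 baL)
    (Lp_norm_nderivS_chain ab p1 g_deriv g_cont ph h_ae)) _.
  rewrite lee_fin (@le_trans _ _ (c * K))//; last by rewrite mulVf ?gt_eqF.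
  have -> : c * K = k.+1%:R * (L ^+ k * (c * (L + 1)) * L) + c by rewrite /K; ring.
  by rewrite lerD2l (le_trans nph)// ncf (gtr0_norm c0) ler_piMr// ltW.
- move=> s sk; rewrite (nderiv_chain ab g_deriv sk t0ab).
  by have [j [_ ->]] := gE s sk; rewrite iprim_t0.
- exact: (nderivS_chain_ae ab g_deriv h_ae).
Qed.

(** On [a, b] the s-fold primitive of the constant [c] is c (t - t0)^s / s!. Derivatives of order
    below s are primitives and vanish at t0, the s-th is [c], and higher ones are zero. *)
Lemma test_polynomial k s : (s <= k)%N -> exists2 c : R, 0 < c &
  exists y : R -> R[i],
  [/\ sobolev a b p k.+1 y,
      (\sum_(i < k.+2) Lp_norm a b p%:E (nderiv a b i y) <= 1)%E,
      forall i, (i <= k)%N -> nderiv a b i y t0 = if i == s then c%:C else 0 &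
      forall x, x \in `[a, b] -> nderiv a b k.+1 y x = 0].
Proof.
move=> sk; pose K := k.+1%:R * (L ^+ k * L).
have K0 : 0 < K by rewrite mulr_gt0// mulr_gt0 ?exprn_gt0 ?(lt_le_trans ltr01).
pose c := K^-1; have c0 : 0 < c by rewrite invr_gt0.
exists c => //.
have ic : wide_integrable a b (fun=> c).
  by apply: continuous_wide_integrable => x; exact: cvg_cst.
pose g i := if (i <= s)%N then iprim (s - i) (fun=> c) else (fun=> 0).
have g_cont i : (i <= k)%N -> continuous (g i).
  move=> _; rewrite /g; case: ifP => _; last by move=> x; exact: cvg_cst.
  case: (s - i)%N => [|j]; first by move=> x; exact: cvg_cst.
  exact: iprim_continuous.
have g_deriv i x : (i < k)%N -> x \in `[a, b] -> has_deriv a b (g i) x (g i.+1 x).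
  move=> ik xab; have [si|si|si] := ltngtP i s; last 1 first.
  (* The chain changes form here: the constant [c] is followed by the zero function. *)
  - by rewrite /g si leqnn ltnn subnn; exact: has_deriv_cst.
  - have -> : g i = prim a b t0 (g i.+1) by rewrite /g (ltnW si) si -(subnSK si).
    apply: prim_deriv_continuous => //.
      by apply: continuous_wide_integrable; exact: g_cont.
    exact: g_cont.
  - have [n1 n2] : (i <= s)%N = false /\ (i.+1 <= s)%N = false.
      by split; apply/negbTE; rewrite -ltnNge// ltnS ltnW.
    by rewrite /g n1 n2; exact: has_deriv_cst.
have [c' gk] : exists c', g k = fun=> c'.
  rewrite /g; case: ifP => ks; last by exists 0.
  by exists c; rewrite (eqP (_ : s - k == 0)%N)// subn_eq0.
have g_ac : real_abs_cont a b (g k).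
  move=> e e0; exists 1 => // N u v _ _ _; rewrite gk.
  by under eq_bigr do rewrite subrr normr0; rewrite big1.
have p1e : (1 <= p%:E)%E by rewrite lee_fin.
have [p0 n0] := @Lp_fun0 _ _ _ mu p%:E p1e.
have c0E : cut a b (fun=> 0) = (fun=> 0) by apply/funext => x; rewrite /cut mul0r.
have ph : Lp_fun mu p%:E (cut a b (fun=> 0)) by rewrite c0E.
have h_ae : {ae mu, forall x, x \in `[a, b] -> has_deriv a b (g k) x 0}.
  by apply: aeW => x xab; rewrite gk; exact: has_deriv_cst.
exists (fun t => (g 0%N t)%:C); split.
- exact: (chain_sobolev ab p1 g_deriv g_cont g_ac ph h_ae).
- have cb j x : `|iprim j (fun=> c) x| <= L ^+ j * c.
    case: j => [|j]; first by rewrite mul1r gtr0_norm.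
    apply: le_trans (iprim_le j x ic) _; rewrite exprSr -mulrA ler_wpM2l ?exprn_ge0//.
    by apply: (wide_norm1_le ab (ltW c0) ic) => z; rewrite gtr0_norm.
  have gb i : (i <= k)%N -> {in `[a, b], forall x, `|g i x| <= L ^+ k * c}.
    move=> ik x _; rewrite /g; case: ifP => _; last first.
      by rewrite normr0 mulr_ge0 ?exprn_ge0 ?(ltW c0).
    apply: le_trans (cb _ x) _; rewrite ler_pM2r//; apply: ler_weXn2l => //.
    exact: leq_trans (leq_subr _ _) sk.
  apply: le_trans (sum_Lp_norm_le (fun i ik =>
    Lp_norm_nderiv_chain ab p1 g_deriv g_cont ik (gb i ik) L1 baL)
    (Lp_norm_nderivS_chain ab p1 g_deriv g_cont ph h_ae)) _.
  rewrite c0E n0 addr0 lee_fin (@le_trans _ _ (c * K))//; last by rewrite mulVf ?gt_eqF.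
  by rewrite le_eqVlt; apply/orP; left; apply/eqP; rewrite /K; ring.
- move=> i ik; rewrite (nderiv_chain ab g_deriv ik t0ab) /g.
  have [si|si|<-] := ltngtP i s; last by rewrite subnn.
    by rewrite -(subnSK si) iprim_t0.
  by [].
- move=> x xab; rewrite (nderivS_chain ab g_deriv xab) gk.
  by rewrite (has_deriv_real_deriv ab xab (has_deriv_cst _ _ _ _)).2.
Qed.

End test_functions.

(** * Complex arithmetic and bounded combinations of functionals *)

Section complex_norm.
Local Open Scope complex_scope.
Context (R : realType).
Implicit Types x y z : R[i].

Lemma ReD x y : complex.Re (x + y) = complex.Re x + complex.Re y.
Proof. by case: x; case: y. Qed.

Lemma ImD x y : complex.Im (x + y) = complex.Im x + complex.Im y.
Proof. by case: x; case: y. Qed.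

Lemma ReM x y : complex.Re (x * y) =
  complex.Re x * complex.Re y - complex.Im x * complex.Im y.
Proof. by case: x; case: y. Qed.

Lemma ImM x y : complex.Im (x * y) =
  complex.Re x * complex.Im y + complex.Im x * complex.Re y.
Proof. by case: x; case: y. Qed.

Lemma normcD_le x y : Normc.normc (x + y) <= Normc.normc x + Normc.normc y.
Proof. exact: le_normcD. Qed.

Lemma normc_opp x : Normc.normc (- x) = Normc.normc x.
Proof. exact: normcN. Qed.

Lemma normcB_le x y : Normc.normc (x - y) <= Normc.normc x + Normc.normc y.
Proof. by rewrite -(normc_opp y) normcD_le. Qed.

Lemma normc_sum_le (I : Type) (s : seq I) (P : pred I) (F : I -> R[i]) :
  Normc.normc (\sum_(i <- s | P i) F i) <= \sum_(i <- s | P i) Normc.normc (F i).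
Proof.
elim/big_rec2: _ => [|i u v _ IH]; first by rewrite Normc.normc0.
exact: le_trans (normcD_le _ _) (lerD _ IH).
Qed.

End complex_norm.

(* A finite-dimensional space of coefficient vectors [alpha] whose combinations
   of the functionals [l x] are bounded admits a uniform bound: induct on the
   coordinates, using one vector with nonzero leading coordinate to eliminate
   that coordinate from all the others. *)
Section bounded_combinations.
Local Open Scope complex_scope.
Context (R : realType) (X : Type) (Y : Type) (l : X -> Y -> R[i]).
Implicit Types alpha beta : X -> R[i].

Let comb (s : seq X) alpha (y : Y) := \sum_(x <- s) alpha x * l x y.
Let mass (s : seq X) alpha : R := \sum_(x <- s) Normc.normc (alpha x).
Let bounded s alpha := exists C, forall y, Normc.normc (comb s alpha y) <= C.

Let combB s alpha beta (c : R[i]) y :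
  comb s (fun x => alpha x - c * beta x) y = comb s alpha y - c * comb s beta y.
Proof.
rewrite /comb mulr_sumr -sumrB; apply: eq_bigr => x _.
by rewrite mulrBl mulrA.
Qed.

Let mass_ge0 s alpha : 0 <= mass s alpha.
Proof. by apply: sumr_ge0 => x _; exact: normc_ge0. Qed.

Let massB s alpha beta (c : R[i]) :
  mass s (fun x => alpha x - c * beta x) <= mass s alpha + Normc.normc c * mass s beta.
Proof.
rewrite /mass mulr_sumr -big_split; apply: ler_sum => x _ /=.
by rewrite -Normc.normcM normcB_le.
Qed.

Lemma bounded_combinations (s : seq X) : exists2 K, 0 <= K &
  forall alpha, (exists C, forall y,
      Normc.normc (\sum_(x <- s) alpha x * l x y) <= C) ->
    forall y, Normc.normc (\sum_(x <- s) alpha x * l x y) <=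
      K * \sum_(x <- s) Normc.normc (alpha x).
Proof.
rewrite -/(bounded _ _).
elim: s => [|x0 s [K K0 IH]].
  by exists 0 => // alpha _ y; rewrite !big_nil Normc.normc0 mulr0.
have reduce alpha : alpha x0 = 0 -> bounded (x0 :: s) alpha -> forall y,
    Normc.normc (comb (x0 :: s) alpha y) <= K * mass s alpha.
  move=> a0 [C hC] y; rewrite /comb big_cons a0 mul0r add0r; apply: IH.
  by exists C => z; have := hC z; rewrite /comb big_cons a0 mul0r add0r.
have [[beta [[D hD] b0]]|nob] := pselect (exists beta,
    bounded (x0 :: s) beta /\ beta x0 <> 0); last first.
  exists K => // alpha balpha y.
  have a0 : alpha x0 = 0 by apply: contrapT => a0; apply: nob; exists alpha.
  apply: le_trans (reduce alpha a0 balpha y) _; apply: ler_wpM2l => //.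
  by rewrite big_cons lerDr normc_ge0.
pose nb := Normc.normc (beta x0).
have nb0 : 0 < nb.
  rewrite lt_neqAle normc_ge0 andbT eq_sym; apply/eqP => /Normc.eq0_normc.
  exact: b0.
(* The first term bounds the combination with coefficients alpha - c beta, where |c| = |alpha x0| /
   nb; the second pays for adding c beta back. If [Y] is empty, [D] may be negative, hence the
   absolute value. *)
exists (K * (1 + mass s beta / nb) + `|D| / nb).
  have nb1 : 0 <= nb^-1 by rewrite invr_ge0 ltW.
  apply: addr_ge0; last exact: mulr_ge0.
  by apply: mulr_ge0 => //; apply: addr_ge0 => //; apply: mulr_ge0.
move=> alpha [C hC] y.
pose c := alpha x0 / beta x0.
have nc : Normc.normc c = Normc.normc (alpha x0) / nb.
  by rewrite /c Normc.normcM Normc.normcV.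
pose alpha' x := alpha x - c * beta x.
have a0 : alpha' x0 = 0.
  by rewrite /alpha' /c divfK ?subrr//; exact/eqP.
have ba' : bounded (x0 :: s) alpha'.
  exists (C + Normc.normc c * D) => z; rewrite /alpha' combB.
  apply: le_trans (normcB_le _ _) _; rewrite Normc.normcM lerD//; first exact: hC.
  by rewrite ler_wpM2l ?normc_ge0.
have := reduce alpha' a0 ba' y.
rewrite {1}/alpha' combB -/(comb _ alpha y) => le1.
have le2 : Normc.normc (comb (x0 :: s) alpha y) <=
    Normc.normc (comb (x0 :: s) alpha y - c * comb (x0 :: s) beta y) +
    Normc.normc c * D.
  rewrite -[X in Normc.normc X <= _](subrK (c * comb (x0 :: s) beta y)).
  by apply: le_trans (normcD_le _ _) _; rewrite lerD2l Normc.normcM ler_wpM2l ?normc_ge0.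
apply: (le_trans le2); apply: le_trans (lerD le1 (lexx _)) _.
have := massB s alpha beta c; rewrite -/alpha' => lem.
have lem' : K * mass s alpha' <= K * (mass s alpha + Normc.normc c * mass s beta).
  exact: ler_wpM2l.
apply: le_trans (lerD lem' (lexx _)) _.
rewrite big_cons -/(mass s alpha) nc.
set A := Normc.normc _; have A0 : 0 <= A by exact: normc_ge0.
have -> : K * (mass s alpha + A / nb * mass s beta) + A / nb * D =
  K * mass s alpha + (K * (mass s beta / nb) + D / nb) * A by field; rewrite gt_eqF.
have DD : D / nb <= `|D| / nb by rewrite ler_pM2r ?invr_gt0// ler_norm.
have Q0 : 0 <= mass s beta / nb by rewrite divr_ge0// ltW.
have N0 : 0 <= `|D| / nb by rewrite divr_ge0// ltW.
set q := mass s beta / nb in Q0 *; set e := D / nb in DD *; set e' := `|D| / nb in N0 DD *.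
have h1 : e * A <= e' * A by exact: ler_wpM2r.
have h2 : 0 <= K * A by exact: mulr_ge0.
have h3 : 0 <= K * q * mass s alpha by do 2 apply: mulr_ge0 => //.
have h4 : 0 <= e' * mass s alpha by rewrite mulr_ge0.
rewrite -subr_ge0.
have -> : (K * (1 + q) + e') * (A + mass s alpha) -
  (K * mass s alpha + (K * q + e) * A) =
  K * A + (e' * A - e * A) + K * q * mass s alpha + e' * mass s alpha by ring.
by do 3 (apply: addr_ge0 => //); rewrite subr_ge0.
Qed.

End bounded_combinations.

(** * Complex integrals as real pairings *)

Section complex_pairing.
Local Open Scope complex_scope.
Context (R : realType).
Variables (a b p : R) (q : \bar R).
Hypotheses (ab : a < b) (p1 : 1 <= p) (pq : (p%:E^-1 + q^-1 = 1)%E).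
Notation mu := (@lebesgue_measure R).
Implicit Types (u v : R -> R) (F G : R -> R[i]).

Let q1 : (1 <= q)%E. Proof. exact: conj_ge1 pq. Qed.
Let p1e : (1 <= p%:E)%E. Proof. by rewrite lee_fin. Qed.
Let mI : measurable (`[a, b]%classic : set R). Proof. exact: measurable_itv. Qed.

Definition recut F := cut a b (fun t => complex.Re (F t)).
Definition imcut F := cut a b (fun t => complex.Im (F t)).

Definition cintegrable F :=
  mu.-integrable `[a, b] (EFin \o (fun t => complex.Re (F t))) /\
  mu.-integrable `[a, b] (EFin \o (fun t => complex.Im (F t))).

Lemma cintegralD F G : cintegrable F -> cintegrable G ->
  cintegrable (fun t => F t + G t) /\
  cintegral a b (fun t => F t + G t) = cintegral a b F + cintegral a b G.
Proof.
move=> [iF1 iF2] [iG1 iG2]; split.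
  split.
    have := @integrableD _ _ _ mu _ mI _ _ iF1 iG1; congr (integrable _ _ _).
    by apply/funext => t; rewrite /= ReD.
  have := @integrableD _ _ _ mu _ mI _ _ iF2 iG2; congr (integrable _ _ _).
  by apply/funext => t; rewrite /= ImD.
rewrite /cintegral.
under eq_Rintegral do rewrite ReD; under [in X in _ +i* X]eq_Rintegral do rewrite ImD.
by rewrite RintegralD// RintegralD.
Qed.

Lemma cintegral_sum (I : Type) (s : seq I) (F : I -> R -> R[i]) :
  (forall i, cintegrable (F i)) ->
  cintegrable (fun t => \sum_(i <- s) F i t) /\
  cintegral a b (fun t => \sum_(i <- s) F i t) = \sum_(i <- s) cintegral a b (F i).
Proof.
move=> iF; elim: s => [|i s [IH1 IH2]].
  have -> : (fun t => \sum_(i <- [::]) F i t) = (fun=> 0).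
    by apply/funext => t; rewrite big_nil.
  split; first by split; exact: integrable0.
  by rewrite big_nil /cintegral /= /Rintegral integral0.
have -> : (fun t => \sum_(j <- i :: s) F j t) =
    (fun t => F i t + \sum_(j <- s) F j t).
  by apply/funext => t; rewrite big_cons.
have [iD ->] := cintegralD (iF i) IH1.
by split=> //; rewrite big_cons IH2.
Qed.

Lemma integrable_cut u v : Lp_fun mu q (cut a b u) -> Lp_fun mu p%:E (cut a b v) ->
  mu.-integrable `[a, b] (EFin \o (fun t => u t * v t)) /\
  \int[mu]_(t in `[a, b]) (u t * v t) = pairing mu (cut a b u) (cut a b v).
Proof.
move=> pu pv.
have E : (fun t => u t * v t) \_ `[a, b] = cut a b u \* cut a b v.
  rewrite patch_indic; apply/funext => t; rewrite /cut/= indicE.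
  by case: (t \in _); rewrite ?mulr1// !mulr0.
split; last by rewrite Rintegral_mkcond E.
apply/integrable_mkcond => //.
rewrite restrict_EFin E.
exact: (@pairing_integrable _ _ _ mu p q _ _ p1 pq pv pu).
Qed.

Lemma cpairE F G : in_Lp a b q F -> in_Lp a b p%:E G ->
  cintegrable (fun t => F t * G t) /\
  cintegral a b (fun t => F t * G t) =
    (pairing mu (recut F) (recut G) - pairing mu (imcut F) (imcut G)) +i*
    (pairing mu (recut F) (imcut G) + pairing mu (imcut F) (recut G)).
Proof.
move=> pF pG.
have [pF1 _] := in_Lp_Re q1 pF; have [pF2 _] := in_Lp_Im q1 pF.
have [pG1 _] := in_Lp_Re p1e pG; have [pG2 _] := in_Lp_Im p1e pG.
have [i11 e11] := integrable_cut pF1 pG1; have [i22 e22] := integrable_cut pF2 pG2.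
have [i12 e12] := integrable_cut pF1 pG2; have [i21 e21] := integrable_cut pF2 pG1.
split.
  split.
    have := @integrableB _ _ _ mu _ mI _ _ i11 i22; congr (integrable _ _ _).
    by apply/funext => t; rewrite /= ReM.
  have := @integrableD _ _ _ mu _ mI _ _ i12 i21; congr (integrable _ _ _).
  by apply/funext => t; rewrite /= ImM.
rewrite /cintegral.
under eq_Rintegral do rewrite ReM; under [in X in _ +i* X]eq_Rintegral do rewrite ImM.
by rewrite RintegralB// RintegralD// e11 e22 e12 e21.
Qed.

(** The factor 4 counts the real pairings into which the complex product splits. *)
Lemma cpair_le F G : in_Lp a b q F -> in_Lp a b p%:E G ->
  Normc.normc (cintegral a b (fun t => F t * G t)) <=
  4 * (fine (Lp_norm a b q F) * fine (Lp_norm a b p%:E G)).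
Proof.
move=> pF pG; have [_ ->] := cpairE pF pG.
have [pF1 nF1] := in_Lp_Re q1 pF; have [pF2 nF2] := in_Lp_Im q1 pF.
have [pG1 nG1] := in_Lp_Re p1e pG; have [pG2 nG2] := in_Lp_Im p1e pG.
apply: le_trans (normc_le_ReIm _) _ => /=.
apply: le_trans (lerD (ler_normB _ _) (ler_normD _ _)) _.
have bd u v : Lp_fun mu q u -> Lp_fun mu p%:E v -> Lp_val mu q u <= fine (Lp_norm a b q F) ->
    Lp_val mu p%:E v <= fine (Lp_norm a b p%:E G) ->
    `|pairing mu u v| <= fine (Lp_norm a b q F) * fine (Lp_norm a b p%:E G).
  move=> pu pv nu nv; apply: le_trans (pairing_le p1 pq pv pu) _.
  by apply: ler_pM => //; exact: Lp_val_ge0.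
have b11 := bd _ _ pF1 pG1 nF1 nG1; have b22 := bd _ _ pF2 pG2 nF2 nG2.
have b12 := bd _ _ pF1 pG2 nF1 nG2; have b21 := bd _ _ pF2 pG1 nF2 nG1.
move: b11 b22 b12 b21; rewrite /recut /imcut; lra.
Qed.

Lemma pairing_ae (phi u v : R -> R) : Lp_fun mu q phi -> Lp_fun mu p%:E u ->
  Lp_fun mu p%:E v -> {ae mu, forall x, u x = v x} ->
  pairing mu phi u = pairing mu phi v.
Proof.
move=> pphi pu pv uv.
have [pNv _] := @Lp_funZ _ _ _ mu p%:E (-1) _ p1e pv.
have [pd _] := @Lp_funD _ _ _ mu p%:E _ _ p1e pu pNv.
have [p0 n0] := @Lp_fun0 _ _ _ mu p%:E p1e.
have uv0 : {ae mu, forall x, `|u x + -1 * v x| <= `|0 : R|}.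
  apply: (@filterS _ _ (ae_filter_ringOfSetsType mu) _ _ _ uv) => x ->.
  by rewrite mulN1r subrr.
have [_ nd] := @Lp_fun_le _ _ _ mu p%:E _ _ p1e pd.1 p0 uv0.
have := pairing_le p1 pq pd pphi; rewrite (pairingD p1 pq pu pNv pphi) (pairingZ _ p1 pq pv pphi).
move=> le0; have : `|pairing mu phi u + -1 * pairing mu phi v| <= 0.
  apply: (le_trans le0); rewrite -(mulr0 (Lp_val mu q phi)).
  by rewrite ler_wpM2l ?Lp_val_ge0// -n0.
by rewrite normr_le0 mulN1r subr_eq0 => /eqP.
Qed.

End complex_pairing.

(** * The zero function and differences in L_p *)

Section zero_function.
Local Open Scope complex_scope.
Context (R : realType).
Variables a b p : R.
Hypotheses (ab : a < b) (p1 : 1 <= p).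
Notation mu := (@lebesgue_measure R).

Let z : R -> R[i] := fun=> 0.

Let g_deriv k i x : (i < k)%N -> x \in `[a, b] ->
  has_deriv a b ((fun (_ : nat) (_ : R) => 0 : R) i) x 0.
Proof. by move=> _ _; exact: has_deriv_cst. Qed.

(** The other components of a test vector are zero, so their derivatives have to be computed as
    well. Away from [a, b] the filter defining the derivative is trivial and its limit is
    uncontrolled, hence the restriction. *)
Lemma nderiv0 s : {in `[a, b], forall x, nderiv a b s z x = 0}.
Proof. by move=> x xab; rewrite (nderiv_chain ab (@g_deriv s)). Qed.

Lemma Lp_norm_nderiv0 s : Lp_norm a b p%:E (nderiv a b s z) = 0%E.
Proof.
rewrite (@Lp_norm_real _ a b p%:E _ (fun=> 0)); last first.
  by move=> x xab; rewrite nderiv0.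
have -> : cut a b (fun=> 0) = (fun=> 0) by apply/funext => x; rewrite /cut mul0r.
have p1e : (1 <= p%:E)%E by rewrite lee_fin.
by have [p0 n0] := @Lp_fun0 _ _ _ mu p%:E p1e; rewrite (Lp_valE p0) n0.
Qed.

Lemma sobolev0 k : sobolev a b p k.+1 z.
Proof.
have p1e : (1 <= p%:E)%E by rewrite lee_fin.
apply: (@chain_sobolev _ a b p ab p1 k (fun _ _ => 0) (fun=> 0)).
- exact: g_deriv.
- by move=> i _ x; exact: cvg_cst.
- move=> e e0; exists 1 => // N u v _ _ _.
  by under eq_bigr do rewrite subrr normr0; rewrite big1.
- have -> : cut a b (fun=> 0) = (fun=> 0) by apply/funext => x; rewrite /cut mul0r.
  by have [] := @Lp_fun0 _ _ _ mu p%:E p1e.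
- by apply: aeW => x _; exact: has_deriv_cst.
Qed.

End zero_function.

Section in_Lp_sub.
Local Open Scope complex_scope.
Context (R : realType).
Variables (a b : R) (q : \bar R).
Hypothesis q1 : (1 <= q)%E.
Notation mu := (@lebesgue_measure R).

Lemma in_LpB (F G : R -> R[i]) : in_Lp a b q F -> in_Lp a b q G ->
  in_Lp a b q (fun t => F t - G t).
Proof.
move=> pF pG; have [mF1 mF2 _] := pF; have [mG1 mG2 _] := pG.
have ReB t : complex.Re (F t - G t) = complex.Re (F t) - complex.Re (G t).
  by case: (F t); case: (G t).
have ImB t : complex.Im (F t - G t) = complex.Im (F t) - complex.Im (G t).
  by case: (F t); case: (G t).
have [pF1 _] := in_Lp_Re q1 pF; have [pF2 _] := in_Lp_Im q1 pF.
have [pG1 _] := in_Lp_Re q1 pG; have [pG2 _] := in_Lp_Im q1 pG.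
have [pN1 _] := @Lp_funZ _ _ _ mu q (-1) _ q1 pG1.
have [pN2 _] := @Lp_funZ _ _ _ mu q (-1) _ q1 pG2.
have [p1 _] := @Lp_funD _ _ _ mu q _ _ q1 pF1 pN1.
have [p2 _] := @Lp_funD _ _ _ mu q _ _ q1 pF2 pN2.
split.
- have -> : (fun t => complex.Re (F t - G t)) =
      (fun t => complex.Re (F t) - complex.Re (G t)) by apply/funext => t; rewrite ReB.
  exact: measurable_funB.
- have -> : (fun t => complex.Im (F t - G t)) =
      (fun t => complex.Im (F t) - complex.Im (G t)) by apply/funext => t; rewrite ImB.
  exact: measurable_funB.
- have p1' : Lp_fun mu q (cut a b (fun t => complex.Re (F t - G t))).
    move: p1; congr Lp_fun; apply/funext => t.
    by rewrite /cut ReB mulN1r mulrBl.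
  have p2' : Lp_fun mu q (cut a b (fun t => complex.Im (F t - G t))).
    move: p2; congr Lp_fun; apply/funext => t.
    by rewrite /cut ImB mulN1r mulrBl.
  exact: le_lt_trans (Lp_norm_le_ReIm q1 p1' p2') (ltry _).
Qed.

End in_Lp_sub.

(** * Operators in canonical form and their values on test vectors *)

Section canonical_form.
Local Open Scope complex_scope.
Context (R : realType).
Variables (a b t0 p : R) (q : \bar R) (k l m : nat).
Hypotheses (ab : a < b) (p1 : 1 <= p) (pq : (p%:E^-1 + q^-1 = 1)%E).
Hypothesis t0ab : t0 \in `[a, b].
Notation mu := (@lebesgue_measure R).
Implicit Types (A : 'I_k.+1 -> 'M[R[i]]_(l, m)) (Psi : R -> 'M[R[i]]_(l, m)).
Implicit Types (Y : R -> 'cV[R[i]]_m) (y : R -> R[i]).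

Let q1 : (1 <= q)%E. Proof. exact: conj_ge1 pq. Qed.
Let p1e : (1 <= p%:E)%E. Proof. by rewrite lee_fin. Qed.

Definition canonical_op A Psi Y : 'cV[R[i]]_l :=
  \sum_(s < k.+1) A s *m vderiv a b s Y t0 +
  mx_integral a b (fun t => Psi t *m vderiv a b k.+1 Y t).

Lemma vsobolev_in_Lp Y j : vsobolev a b p k.+1 Y ->
  in_Lp a b p%:E (fun t => vderiv a b k.+1 Y t j 0).
Proof.
move=> /(_ j)[_ _ _].
by congr in_Lp; apply/funext => t; rewrite /vderiv mxE.
Qed.

Lemma canonical_opE A Psi Y i : mx_in_Lp a b q Psi -> vsobolev a b p k.+1 Y ->
  canonical_op A Psi Y i 0 =
  \sum_(s < k.+1) \sum_j A s i j * nderiv a b s (fun u => Y u j 0) t0 +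
  \sum_j cintegral a b (fun t => Psi t i j * vderiv a b k.+1 Y t j 0).
Proof.
move=> pPsi WY; rewrite /canonical_op mxE summxE; congr (_ + _).
  by apply: eq_bigr => s _; rewrite mxE; apply: eq_bigr => j _; rewrite /vderiv mxE.
rewrite /mx_integral mxE.
have [_ <-] := @cintegral_sum R a b _ (index_enum 'I_m)
  (fun j t => Psi t i j * vderiv a b k.+1 Y t j 0)
  (fun j => (cpairE p1 pq (pPsi i j) (vsobolev_in_Lp j WY)).1).
by congr cintegral; apply/funext => t; rewrite mxE.
Qed.

Let entryB (U V : 'cV[R[i]]_l) i : (U - V) i 0 = U i 0 - V i 0.
Proof. by rewrite !mxE. Qed.

Lemma canonical_opB A A0 Psi Psi0 Y : mx_in_Lp a b q Psi -> mx_in_Lp a b q Psi0 ->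
  vsobolev a b p k.+1 Y ->
  canonical_op A Psi Y - canonical_op A0 Psi0 Y =
  canonical_op (fun s => A s - A0 s) (fun t => Psi t - Psi0 t) Y.
Proof.
move=> pPsi pPsi0 WY.
have pB : mx_in_Lp a b q (fun t => Psi t - Psi0 t).
  move=> i j; have := in_LpB q1 (pPsi i j) (pPsi0 i j); congr in_Lp.
  by apply/funext => t; rewrite !mxE.
apply/matrixP => i j; rewrite (ord1 j) entryB.
have E := canonical_opE A i pPsi WY; have E0 := canonical_opE A0 i pPsi0 WY.
apply: (etrans (congr2 (fun u v => u - v) E E0)).
apply: (etrans _ (esym (canonical_opE _ i pB WY))).
rewrite opprD addrACA -!sumrB; congr (_ + _); [apply: eq_bigr => s _|apply: eq_bigr => h _].
  by rewrite -sumrB; apply: eq_bigr => h _; rewrite !mxE mulrBl.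
have pV := vsobolev_in_Lp h WY.
have i0 := (cpairE p1 pq (pPsi0 i h) pV).1; have iB := (cpairE p1 pq (pB i h) pV).1.
have [_ S] := cintegralD iB i0.
apply/eqP; rewrite subr_eq -S; apply/eqP; congr cintegral.
apply/funext => t.
have -> : (Psi t - Psi0 t) i h = Psi t i h - Psi0 t i h by rewrite !mxE.
by rewrite -mulrDl subrK.
Qed.

Definition evec (j0 : 'I_m) y (t : R) : 'cV[R[i]]_m :=
  \col_j (if j == j0 then y t else 0).

Lemma evecE j0 y j :
  (fun t => evec j0 y t j 0) = if j == j0 then y else (fun=> 0).
Proof. by apply/funext => t; rewrite mxE; case: ifP. Qed.

Lemma nderiv_evec s j0 y j x : nderiv a b s (fun u => evec j0 y u j 0) x =
  if j == j0 then nderiv a b s y x else nderiv a b s (fun=> 0) x.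
Proof. by have := congr1 (fun f => nderiv a b s f x) (evecE j0 y j); case: ifP. Qed.

Lemma vderiv_evec s j0 y j x : vderiv a b s (evec j0 y) x j 0 =
  if j == j0 then nderiv a b s y x else nderiv a b s (fun=> 0) x.
Proof. by rewrite -nderiv_evec /vderiv mxE. Qed.

Lemma evec_sobolev j0 y : sobolev a b p k.+1 y -> vsobolev a b p k.+1 (evec j0 y).
Proof.
move=> Wy j; apply: (eq_ind_r (sobolev a b p k.+1) _ (evecE j0 y j)).
by case: ifP => _ //; exact: sobolev0.
Qed.

Lemma evec_norm j0 y : sobolev_norm a b p k.+1 (evec j0 y) =
  (\sum_(s < k.+2) Lp_norm a b p%:E (nderiv a b s y))%E.
Proof.
rewrite /sobolev_norm; apply: eq_bigr => s _; rewrite /mx_Lp_norm.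
rewrite (bigD1 j0)//= big_ord1 big1 ?adde0 => [|j jj0].
  by congr Lp_norm; apply/funext => t; rewrite vderiv_evec eqxx.
rewrite big_ord1 -[RHS](Lp_norm_nderiv0 ab p1 s).
by congr Lp_norm; apply/funext => t; rewrite vderiv_evec (negbTE jj0).
Qed.

Let cintegral_eq0 (F : R -> R[i]) : {in `[a, b], forall t, F t = 0} ->
  cintegral a b F = 0.
Proof.
move=> F0; rewrite /cintegral (@eq_Rintegral _ _ _ mu _ (fun=> 0)); last first.
  by move=> t; rewrite inE => tab; rewrite F0.
rewrite [X in _ +i* X](@eq_Rintegral _ _ _ mu _ (fun=> 0)); last first.
  by move=> t; rewrite inE => tab; rewrite F0.
by rewrite /Rintegral integral0.
Qed.

Lemma canonical_op_polynomial A Psi i j0 (s : 'I_k.+1) y (c : R) :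
  mx_in_Lp a b q Psi -> sobolev a b p k.+1 y ->
  (forall r, (r <= k)%N -> nderiv a b r y t0 = if r == s then c%:C else 0) ->
  (forall x, x \in `[a, b] -> nderiv a b k.+1 y x = 0) ->
  canonical_op A Psi (evec j0 y) i 0 = A s i j0 * c%:C.
Proof.
move=> pPsi Wy yt0 yk; rewrite canonical_opE//; last exact: evec_sobolev.
rewrite [X in _ + X]big1 ?addr0 => [|j _]; last first.
  apply: cintegral_eq0 => t tab; rewrite vderiv_evec.
  by case: ifP => _; rewrite ?yk// ?(nderiv0 ab)// mulr0.
have yr (r : 'I_k.+1) : nderiv a b r y t0 = if r == s then c%:C else 0.
  by apply: yt0; rewrite -ltnS.
have z0 (r : 'I_k.+1) : nderiv a b r (fun=> 0) t0 = 0 by exact: nderiv0.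
rewrite (bigD1 s)//= [X in _ + X]big1 ?addr0 => [|r rs]; last first.
  rewrite big1// => j _; rewrite nderiv_evec yr z0 (negbTE rs).
  by case: ifP => _; rewrite mulr0.
rewrite (bigD1 j0)//= big1 ?addr0 => [|j jj0].
  by rewrite nderiv_evec eqxx yr eqxx.
by rewrite nderiv_evec (negbTE jj0) z0 mulr0.
Qed.

(** As [f] is real, the two pairings with the imaginary part of the top derivative vanish, which
    separates the real and imaginary parts of the kernel entry. *)
Lemma canonical_op_test A Psi i j0 y f (c : R) :
  mx_in_Lp a b q Psi -> sobolev a b p k.+1 y -> Lp_fun mu p%:E f ->
  (forall r, (r <= k)%N -> nderiv a b r y t0 = 0) ->
  {ae mu, forall x, x \in `[a, b] -> nderiv a b k.+1 y x = (c * f x)%:C} ->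
  canonical_op A Psi (evec j0 y) i 0 =
  (c * pairing mu (recut a b (fun t => Psi t i j0)) f) +i*
  (c * pairing mu (imcut a b (fun t => Psi t i j0)) f).
Proof.
move=> pPsi Wy pf yt0 yk; have WY := evec_sobolev j0 Wy.
rewrite canonical_opE// big1 ?add0r => [|s _]; last first.
  have yr : nderiv a b s y t0 = 0 by apply: yt0; rewrite -ltnS.
  have z0 : nderiv a b s (fun=> 0) t0 = 0 by exact: nderiv0.
  rewrite big1// => j _; rewrite nderiv_evec yr z0.
  by case: ifP => _; rewrite mulr0.
rewrite (bigD1 j0)//= [X in _ + X]big1 ?addr0 => [|j jj0]; last first.
  apply: cintegral_eq0 => t tab; rewrite vderiv_evec (negbTE jj0).
  by rewrite (nderiv0 ab)// mulr0.
have pV := vsobolev_in_Lp j0 WY.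
have VE : (fun t => vderiv a b k.+1 (evec j0 y) t j0 0) = nderiv a b k.+1 y.
  by apply/funext => t; rewrite vderiv_evec eqxx.
have [_ ->] := cpairE p1 pq (pPsi i j0) pV; rewrite VE in pV *.
have [pF1 _] := in_Lp_Re q1 (pPsi i j0); have [pF2 _] := in_Lp_Im q1 (pPsi i j0).
have [pG1 _] := in_Lp_Re p1e pV; have [pG2 _] := in_Lp_Im p1e pV.
have [pcf _] := @Lp_funZ _ _ _ mu p%:E c _ p1e pf.
have [pccf _] : Lp_fun mu p%:E (cut a b (fun x => c * f x)) /\
    Lp_val mu p%:E (cut a b (fun x => c * f x)) <= Lp_val mu p%:E (fun x => c * f x).
  apply: (@Lp_fun_le _ _ _ mu p%:E _ _ p1e _ pcf).
    by apply/measurable_cut; apply: measurable_funTS; case: pcf.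
  apply: aeW => x; rewrite /cut normrM indicE; case: (x \in _).
    by rewrite normr1 mulr1.
  by rewrite normr0 mulr0.
have [pz _] := @Lp_fun0 _ _ _ mu p%:E p1e.
(* The top derivative equals c f only almost everywhere, so it is exchanged inside the pairing by
   [pairing_ae]. *)
have re_ae : {ae mu, forall x, recut a b (nderiv a b k.+1 y) x = cut a b (fun x => c * f x) x}.
  apply: (@filterS _ _ (ae_filter_ringOfSetsType mu) _ _ _ yk) => x yx.
  have [xab|xab] := pselect (`[a, b]%classic x); last by rewrite /recut !cut_out.
  by rewrite /recut !cut_in// yx.
have im_ae : {ae mu, forall x, imcut a b (nderiv a b k.+1 y) x = (fun=> 0) x}.
  apply: (@filterS _ _ (ae_filter_ringOfSetsType mu) _ _ _ yk) => x yx.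
  have [xab|xab] := pselect (`[a, b]%classic x); last by rewrite /imcut !cut_out.
  by rewrite /imcut !cut_in// yx.
have redE phi : Lp_fun mu q (cut a b phi) ->
    pairing mu (cut a b phi) (recut a b (nderiv a b k.+1 y)) = c * pairing mu (cut a b phi) f.
  move=> pphi; rewrite (pairing_ae p1 pq pphi pG1 pccf re_ae).
  rewrite -(pairingZ c p1 pq pf pphi); apply: eq_Rintegral => x _.
  by rewrite /cut !indicE; case: (x \in _); rewrite ?mulr1// !mulr0 !mul0r.
have imE phi : Lp_fun mu q (cut a b phi) ->
    pairing mu (cut a b phi) (imcut a b (nderiv a b k.+1 y)) = 0.
  move=> pphi; rewrite (pairing_ae p1 pq pphi pG2 pz im_ae).
  by rewrite /pairing; under eq_Rintegral do rewrite mulr0; rewrite Rintegral_cst// mul0r.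
by rewrite /recut /imcut in redE imE *; rewrite !redE// !imE// subr0 add0r.
Qed.

End canonical_form.

(** * Convergence to zero and boundedness near a point *)

Section cvg0.
Local Open Scope complex_scope.
Context (R : realType) (X : Type) (F : set_system X) {FF : Filter F}.

Lemma cvg0_le (f g : X -> R) : (forall x, `|f x| <= g x) ->
  g x @[x --> F] --> (0 : R) -> f x @[x --> F] --> (0 : R).
Proof.
move=> fg /cvgr0Pnorm_le cg; apply/cvgr0Pnorm_le => e e0.
apply: filterS (cg e e0) => x; apply: le_trans.
exact: le_trans (fg x) (ler_norm _).
Qed.

Lemma cvg0_eq (f g : X -> R) : f =1 g ->
  f x @[x --> F] --> (0 : R) -> g x @[x --> F] --> (0 : R).
Proof. by move=> /funext ->. Qed.

Lemma cvg0D (f g : X -> R) : f x @[x --> F] --> (0 : R) ->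
  g x @[x --> F] --> (0 : R) -> f x + g x @[x --> F] --> (0 : R).
Proof. by move=> cf cg; have := @cvgD _ _ _ _ FF _ _ _ _ cf cg; rewrite addr0. Qed.

Lemma cvg0Z (c : R) (f : X -> R) : f x @[x --> F] --> (0 : R) ->
  c * f x @[x --> F] --> (0 : R).
Proof. by move=> cf; have := @cvgMl_tmp _ _ _ FF _ c _ cf; rewrite mulr0. Qed.

Lemma cvg0Z_inv (c : R) (f : X -> R) : c != 0 -> c * f x @[x --> F] --> (0 : R) ->
  f x @[x --> F] --> (0 : R).
Proof.
move=> c0 cf; have -> : f = (fun x => c^-1 * (c * f x)).
  by apply/funext => x; rewrite mulKf.
exact: cvg0Z.
Qed.

Lemma cvg0_sum (I : Type) (s : seq I) (f : I -> X -> R) :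
  (forall i, f i x @[x --> F] --> (0 : R)) ->
  \sum_(i <- s) f i x @[x --> F] --> (0 : R).
Proof.
move=> cf; elim: s => [|i s IH].
  by under eq_fun do rewrite big_nil; exact: cvg_cst.
by under eq_fun do rewrite big_cons; exact: cvg0D.
Qed.

Lemma normc_cvg0 (z : X -> R[i]) : Normc.normc (z x) @[x --> F] --> (0 : R) <->
  (complex.Re (z x) @[x --> F] --> (0 : R)) /\
  (complex.Im (z x) @[x --> F] --> (0 : R)).
Proof.
split=> [cz|[cr ci]].
  split; apply: cvg0_le cz => x; first exact: normc_ge_Re.
  exact: normc_ge_Im.
apply: (@cvg0_le _ (fun x => `|complex.Re (z x)| + `|complex.Im (z x)|)).
  by move=> x; rewrite ger0_norm ?normc_ge0// normc_le_ReIm.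
by apply: cvg0D; [have := @cvg_norm _ _ _ _ FF _ _ cr|have := @cvg_norm _ _ _ _ FF _ _ ci]; rewrite normr0.
Qed.

Lemma mx_norm1_cvg0 (k l : nat) (A : X -> 'M[R[i]]_(k, l)) :
  mx_norm1 (A x) @[x --> F] --> (0 : R) <->
  forall i j, Normc.normc (A x i j) @[x --> F] --> (0 : R).
Proof.
split=> [cA i j|cA]; last first.
  by apply: cvg0_sum => i; apply: cvg0_sum => j; exact: cA.
apply: cvg0_le cA => x; rewrite ger0_norm ?normc_ge0// /mx_norm1.
rewrite (bigD1 i)//= (bigD1 j)//= -addrA lerDl addr_ge0//.
  by apply: sumr_ge0 => h _; exact: normc_ge0.
by apply: sumr_ge0 => h _; apply: sumr_ge0 => h' _; exact: normc_ge0.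
Qed.

Lemma EFin_cvg0 (f : X -> R) : (f x)%:E @[x --> F] --> 0%E <->
  f x @[x --> F] --> (0 : R).
Proof.
split=> [/fine_cvgP[]//|cf]; apply/fine_cvgP; split=> //.
exact: nearW.
Qed.

Lemma ereal_cvg0_fine (e : X -> \bar R) (f : X -> R) (K : R) :
  (forall x, (`|f x|%:E <= K%:E * e x)%E) -> e x @[x --> F] --> 0%E ->
  f x @[x --> F] --> (0 : R).
Proof.
move=> fe /fine_cvgP[fin ce].
have cK := cvg0Z K ce.
move/cvgr0Pnorm_le : cK => cK; apply/cvgr0Pnorm_le => d d0.
apply: filterS2 fin (cK d d0) => x finx; apply: le_trans.
apply: le_trans (ler_norm _) => /=.
by have := fe x; rewrite -[e x]fineK// -EFinM lee_fin.
Qed.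

End cvg0.

(** If no bound held near [mu0], the ball of radius 1/(n+1) would contain, for every n, a parameter
    whose norm exceeds n. These parameters tend to [mu0], so every pairing converges along them and
    is bounded, against [uniform_boundedness]. *)
Lemma near_bounded (R : realType) (M : metricType R) (mu0 : M) (a b p : R)
    (q : \bar R) (psi : M -> R -> R) :
  a < b -> 1 <= p -> (p%:E^-1 + q^-1 = 1)%E ->
  (forall m, Lp_fun (@lebesgue_measure R) q (psi m)) ->
  (forall m x, ~ `[a, b]%classic x -> psi m x = 0) ->
  (forall f, Lp_fun (@lebesgue_measure R) p%:E f ->
    pairing (@lebesgue_measure R) (psi m) f @[m --> mu0] --> (0 : R)) ->
  exists C, \forall m \near mu0, Lp_val (@lebesgue_measure R) q (psi m) <= C.
Proof.
move=> ab p1 pq ppsi psi0 cpsi; apply: contrapT => nC.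
have pick (n : nat) : exists m, ball mu0 n.+1%:R^-1 m /\
    n%:R < Lp_val (@lebesgue_measure R) q (psi m).
  apply: contrapT => nm; apply: nC; exists n%:R.
  near=> m; have bm : ball mu0 n.+1%:R^-1 m by near: m; exact: near_ball.
  by rewrite leNgt; apply/negP => lt; apply: nm; exists m.
have [s hs] := choice pick.
have cs : s n @[n --> \oo] --> mu0.
  apply/cvg_ballP => e e0; near=> n.
  have [bs _] := hs n; apply: le_ball bs; apply: ltW.
  near: n; exact: (near_infty_natSinv_lt (PosNum e0)).
have mI : measurable (`[a, b]%classic : set R) by exact: measurable_itv.
have Ioo : (@lebesgue_measure R `[a, b]%classic < +oo)%E.
  by rewrite lebesgue_measure_itv/= lte_fin ab -EFinD ltry.
have [|C hC] := @uniform_boundedness _ _ _ (@lebesgue_measure R) _ mI Ioo p q p1 pq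
    (fun n => psi (s n)) (fun n => ppsi _) (fun n => psi0 _).
  move=> f pf.
  have cf : pairing (@lebesgue_measure R) (psi (s n)) f @[n --> \oo] --> (0 : R).
    exact: (cvg_comp _ _ cs (cpsi f pf)).
  have /cvg_seq_bounded/pinfty_ex_gt0[B _ hB] : cvgn (fun n => pairing (@lebesgue_measure R) (psi (s n)) f).
    by apply/cvg_ex; exists 0.
  by exists B => n; exact: hB.
have [n Cn] : exists n : nat, C < n%:R.
  exists (Num.truncn `|C|).+1; apply: le_lt_trans (ler_norm C) _.
  exact: truncnS_gt.
have [_ ltn] := hs n.
by have := lt_le_trans (lt_trans Cn ltn) (hC n); rewrite ltxx.
Unshelve. all: by end_near. Qed.

(** * Matrix norms and the real components of the entries *)

Section mx_Lp_norm_components.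
Local Open Scope complex_scope.
Context (R : realType).
Variables (a b : R) (q : \bar R) (k l : nat).
Hypothesis q1 : (1 <= q)%E.
Notation mu := (@lebesgue_measure R).
Implicit Types Psi : R -> 'M[R[i]]_(k, l).

Definition reval Psi i j := Lp_val mu q (recut a b (fun t => Psi t i j)).
Definition imval Psi i j := Lp_val mu q (imcut a b (fun t => Psi t i j)).

Lemma mx_Lp_norm_ge Psi i j :
  (Lp_norm a b q (fun t => Psi t i j) <= mx_Lp_norm a b q Psi)%E.
Proof.
rewrite /mx_Lp_norm (bigD1 i)//= (bigD1 j)//= -addeA leeDl//.
rewrite adde_ge0//; first by apply: sume_ge0 => h _; exact: Lnorm_ge0.
by apply: sume_ge0 => h _; apply: sume_ge0 => h' _; exact: Lnorm_ge0.
Qed.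

Lemma mx_Lp_norm_le Psi : mx_in_Lp a b q Psi ->
  (mx_Lp_norm a b q Psi <= (\sum_i \sum_j (reval Psi i j + imval Psi i j))%R%:E)%E.
Proof.
move=> pPsi; rewrite /mx_Lp_norm -sumEFin; apply: lee_sum => i _.
rewrite -sumEFin; apply: lee_sum => j _.
by apply: Lp_norm_le_ReIm => //;
  [case: (in_Lp_Re q1 (pPsi i j))|case: (in_Lp_Im q1 (pPsi i j))].
Qed.

Lemma mx_Lp_normE Psi : mx_in_Lp a b q Psi ->
  mx_Lp_norm a b q Psi = (fine (mx_Lp_norm a b q Psi))%:E.
Proof.
move=> pPsi; rewrite fineK// ge0_fin_numE.
  exact: le_lt_trans (mx_Lp_norm_le pPsi) (ltry _).
by apply: sume_ge0 => h _; apply: sume_ge0 => h' _; exact: Lnorm_ge0.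
Qed.

Lemma fine_Lp_norm_le Psi i j : mx_in_Lp a b q Psi ->
  fine (Lp_norm a b q (fun t => Psi t i j)) <= fine (mx_Lp_norm a b q Psi).
Proof.
move=> pPsi; have ge := mx_Lp_norm_ge Psi i j; have E := mx_Lp_normE pPsi.
apply: fine_le => //; last by rewrite E.
rewrite ge0_fin_numE; last exact: Lnorm_ge0.
by apply: le_lt_trans ge _; rewrite E ltry.
Qed.

Lemma reval_le Psi i j : mx_in_Lp a b q Psi ->
  reval Psi i j <= fine (mx_Lp_norm a b q Psi).
Proof.
by move=> pPsi; apply: le_trans (in_Lp_Re q1 (pPsi i j)).2 (fine_Lp_norm_le i j pPsi).
Qed.

Lemma imval_le Psi i j : mx_in_Lp a b q Psi ->
  imval Psi i j <= fine (mx_Lp_norm a b q Psi).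
Proof.
by move=> pPsi; apply: le_trans (in_Lp_Im q1 (pPsi i j)).2 (fine_Lp_norm_le i j pPsi).
Qed.

End mx_Lp_norm_components.

(** * Strong convergence to zero *)

Section operator_families.
Local Open Scope complex_scope.
Context (R : realType) (M : metricType R) (mu0 : M).
Variables (a b t0 p : R) (q : \bar R) (k l m : nat).
Hypotheses (ab : a < b) (p1 : 1 <= p) (pq : (p%:E^-1 + q^-1 = 1)%E).
Hypothesis t0ab : t0 \in `[a, b].
Notation leb := (@lebesgue_measure R).
Variables (A : M -> 'I_k.+1 -> 'M[R[i]]_(l, m)) (Psi : M -> R -> 'M[R[i]]_(l, m)).
Hypothesis pPsi : forall mu, mx_in_Lp a b q (Psi mu).

Let q1 : (1 <= q)%E. Proof. exact: conj_ge1 pq. Qed.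
Let p1e : (1 <= p%:E)%E. Proof. by rewrite lee_fin. Qed.
Let FF : Filter (nbhs mu0) := nbhs_filter mu0.
Let op mu := canonical_op a b t0 (A mu) (Psi mu).
Let W := @vsobolev R a b p m k.+1.
Let psi i j mu := recut a b (fun t => Psi mu t i j).
Let chi i j mu := imcut a b (fun t => Psi mu t i j).

Let ppsi i j mu : Lp_fun leb q (psi i j mu).
Proof. by have [] := in_Lp_Re q1 (pPsi mu i j). Qed.

Let pchi i j mu : Lp_fun leb q (chi i j mu).
Proof. by have [] := in_Lp_Im q1 (pPsi mu i j). Qed.

Let psi_out i j mu x : ~ `[a, b]%classic x -> psi i j mu x = 0.
Proof. exact: cut_out. Qed.

Let chi_out i j mu x : ~ `[a, b]%classic x -> chi i j mu x = 0.
Proof. exact: cut_out. Qed.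

Let strong := forall Y, W Y -> mx_norm1 (op mu Y) @[mu --> mu0] --> (0 : R).
Let cond_a := forall s, mx_norm1 (A mu s) @[mu --> mu0] --> (0 : R).
Let cond_b := exists C : R, \forall mu \near mu0,
  (mx_Lp_norm a b q (Psi mu) <= C%:E)%E.
Let cond_c := forall t, t \in `]a, b] ->
  mx_norm1 (mx_integral a t (Psi mu)) @[mu --> mu0] --> (0 : R).
(** Real [f] on the whole line suffice: the kernels vanish off [a, b], and complex integrals split
    into real pairings. *)
Let weak := forall i j f, Lp_fun leb p%:E f ->
  pairing leb (psi i j mu) f @[mu --> mu0] --> (0 : R) /\
  pairing leb (chi i j mu) f @[mu --> mu0] --> (0 : R).

Let strong_a : strong -> cond_a.
Proof.
move=> st s; apply/mx_norm1_cvg0 => i j0.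
have sk : (s <= k)%N by rewrite -ltnS.
have [c c0 [y [Wy _ yt0 yk]]] := test_polynomial ab t0ab p1 sk.
have := (@mx_norm1_cvg0 _ _ _ FF _ _ _).1 (st _ (evec_sobolev ab p1 j0 Wy)) i 0.
have c0' : c != 0 by rewrite gt_eqF.
move=> cvop; apply: (cvg0Z_inv c0'); apply: (cvg0_eq _ cvop) => mu.
have := canonical_op_polynomial ab p1 pq t0ab (A mu) i j0 (pPsi mu) Wy yt0 yk.
by rewrite /op => ->; rewrite Normc.normcM normc_real gtr0_norm// mulrC.
Qed.

Let strong_weak : strong -> weak.
Proof.
move=> st i j0 f pf.
have [c c0 test] := test_function_Lp ab t0ab p1 k.
(* Scaling by [r] brings [f] into the unit ball, where test functions are available; the summand 1
   covers f = 0. *)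
pose r := (1 + Lp_val leb p%:E f)^-1.
have r0 : 0 < r by rewrite invr_gt0 ltr_wpDr ?Lp_val_ge0.
have [prf nrf] := @Lp_funZ _ _ _ leb p%:E r _ p1e pf.
have [|y [Wy _ yt0 yk]] := test _ prf.
  rewrite nrf gtr0_norm// mulrC ler_pdivrMr ?mul1r ?lerDr//.
  by rewrite ltr_wpDr ?Lp_val_ge0.
have := (@mx_norm1_cvg0 _ _ _ FF _ _ _).1 (st _ (evec_sobolev ab p1 j0 Wy)) i 0.
move=> /normc_cvg0[cre cim].
have cr0 : c * r != 0 by rewrite mulf_neq0// gt_eqF.
have opE mu := canonical_op_test ab p1 pq t0ab (A mu) i j0 (pPsi mu) Wy prf yt0 yk.
split; apply: (cvg0Z_inv cr0).
  apply: (cvg0_eq _ cre) => mu; rewrite /op opE /=.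
  by rewrite (pairingZ r p1 pq pf (ppsi i j0 mu)) mulrA.
apply: (cvg0_eq _ cim) => mu; rewrite /op opE /=.
by rewrite (pairingZ r p1 pq pf (pchi i j0 mu)) mulrA.
Qed.

Let weak_b : weak -> cond_b.
Proof.
move=> wk.
have bd (ij : 'I_l * 'I_m) : exists C, \forall mu \near mu0,
    Lp_val leb q (psi ij.1 ij.2 mu) + Lp_val leb q (chi ij.1 ij.2 mu) <= C.
  have [C1 h1] := near_bounded ab p1 pq (ppsi ij.1 ij.2) (psi_out ij.1 ij.2)
    (fun f pf => (wk ij.1 ij.2 f pf).1).
  have [C2 h2] := near_bounded ab p1 pq (pchi ij.1 ij.2) (chi_out ij.1 ij.2)
    (fun f pf => (wk ij.1 ij.2 f pf).2).
  by exists (C1 + C2); apply: filterS2 h1 h2 => mu; exact: lerD.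
have [C hC] := choice bd.
exists (\sum_i \sum_j C (i, j)).
(* There are finitely many entries, so their neighbourhoods have a common one. *)
have nC : \forall mu \near mu0, forall ij : 'I_l * 'I_m,
    Lp_val leb q (psi ij.1 ij.2 mu) + Lp_val leb q (chi ij.1 ij.2 mu) <= C ij.
  exact: filter_forall.
apply: filterS nC => mu hmu.
apply: le_trans (mx_Lp_norm_le q1 (pPsi mu)) _; rewrite lee_fin.
by apply: ler_sum => i _; apply: ler_sum => j _; exact: hmu (i, j).
Qed.

Let int_recut mu t i j : t <= b ->
  \int[leb]_(x in `[a, t]) complex.Re (Psi mu x i j) =
  \int[leb]_(x in `[a, t]) psi i j mu x.
Proof.
move=> tb; apply: eq_Rintegral => x; rewrite inE /= => xat.
rewrite /psi /recut cut_in//; move: xat; rewrite !in_itv/= => /andP[-> xt].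
exact: le_trans xt tb.
Qed.

Let int_imcut mu t i j : t <= b ->
  \int[leb]_(x in `[a, t]) complex.Im (Psi mu x i j) =
  \int[leb]_(x in `[a, t]) chi i j mu x.
Proof.
move=> tb; apply: eq_Rintegral => x; rewrite inE /= => xat.
rewrite /chi /imcut cut_in//; move: xat; rewrite !in_itv/= => /andP[-> xt].
exact: le_trans xt tb.
Qed.

Let pairing_indic (phi : R -> R) t :
  pairing leb phi (\1_(`[a, t]%classic)) = \int[leb]_(x in `[a, t]) phi x.
Proof.
rewrite [RHS]Rintegral_mkcond; apply: eq_Rintegral => x _.
by rewrite patchE indicE; case: (x \in _); rewrite ?mulr1// mulr0.
Qed.

Let weak_c : weak -> cond_c.
Proof.
move=> wk t; rewrite in_itv/= => /andP[at_ tb].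
apply/mx_norm1_cvg0 => i j; apply: (@normc_cvg0 _ _ _ FF _).2.
have pI : Lp_fun leb p%:E (\1_(`[a, t]%classic) : R -> R).
  apply: Lp_fun_indic => //.
  rewrite -[X in (X < _)%E]/(lebesgue_measure `[a, t]%classic).
  by rewrite lebesgue_measure_itv/= lte_fin at_ -EFinD ltry.
have [cre cim] := wk i j _ pI.
split.
  apply: (cvg0_eq _ cre) => mu.
  by rewrite pairing_indic -int_recut// /mx_integral mxE.
apply: (cvg0_eq _ cim) => mu.
by rewrite pairing_indic -int_imcut// /mx_integral mxE.
Qed.

Let bc_weak : cond_b -> cond_c -> weak.
Proof.
move=> [C hC] cc i j f pf.
have bd : \forall mu \near mu0, fine (mx_Lp_norm a b q (Psi mu)) <= C.
  by apply: filterS hC => mu; rewrite {1}(mx_Lp_normE q1 (pPsi mu)) lee_fin.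
have cij t : a < t <= b ->
    (\int[leb]_(x in `[a, t]) psi i j mu x @[mu --> mu0] --> (0 : R)) /\
    (\int[leb]_(x in `[a, t]) chi i j mu x @[mu --> mu0] --> (0 : R)).
  move=> /andP[at_ tb].
  have tab : t \in `]a, b] by rewrite in_itv/= at_.
  have /normc_cvg0[cre cim] := (@mx_norm1_cvg0 _ _ _ FF _ _ _).1 (cc t tab) i j.
  split.
    by apply: (cvg0_eq _ cre) => mu; rewrite -int_recut// /mx_integral mxE.
  by apply: (cvg0_eq _ cim) => mu; rewrite -int_imcut// /mx_integral mxE.
split.
  apply: (pairing_cvg0 ab p1 pq (ppsi i j) (psi_out i j) (C := C)) => //.
    by apply: filterS bd => mu; apply: le_trans; exact: reval_le.
  by move=> t /cij[].
apply: (pairing_cvg0 ab p1 pq (pchi i j) (chi_out i j) (C := C)) => //.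
  by apply: filterS bd => mu; apply: le_trans; exact: imval_le.
by move=> t /cij[].
Qed.

(** For fixed [Y] the coefficients are multiplied by fixed point values, and the top derivative is a
    fixed element of L_p to which weak convergence applies. *)
Let weak_strong : cond_a -> weak -> strong.
Proof.
move=> ca wk Y WY; apply/mx_norm1_cvg0 => i j; rewrite (ord1 j).
pose bound mu := \sum_(s < k.+1) \sum_h
    Normc.normc (nderiv a b s (fun u => Y u h 0) t0) * Normc.normc (A mu s i h) +
  \sum_h Normc.normc (cintegral a b (fun t => Psi mu t i h * vderiv a b k.+1 Y t h 0)).
apply: (@cvg0_le _ _ _ FF _ bound) => [mu|].
  rewrite ger0_norm ?normc_ge0// /op (canonical_opE t0 p1 pq (A mu) i (pPsi mu) WY).
  apply: le_trans (normcD_le _ _) _; apply: lerD; last exact: normc_sum_le.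
  apply: le_trans (normc_sum_le _ _ _) _; apply: ler_sum => s _.
  apply: le_trans (normc_sum_le _ _ _) _; apply: ler_sum => h _.
  by rewrite Normc.normcM mulrC.
apply: cvg0D.
  apply: cvg0_sum => s; apply: cvg0_sum => h; apply: cvg0Z.
  exact: (@mx_norm1_cvg0 _ _ _ FF _ _ _).1 (ca s) i h.
apply: cvg0_sum => h; apply: (@normc_cvg0 _ _ _ FF _).2.
have pV := vsobolev_in_Lp h WY.
have [pG1 _] := in_Lp_Re p1e pV; have [pG2 _] := in_Lp_Im p1e pV.
have [c11 c21] := wk i h _ pG1; have [c12 c22] := wk i h _ pG2.
split.
  apply: (cvg0_eq _ (cvg0D c11 (cvg0Z (-1) c22))) => mu.
  by have [_ ->] := cpairE p1 pq (pPsi mu i h) pV; rewrite mulN1r.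
apply: (cvg0_eq _ (cvg0D c12 c21)) => mu.
by have [_ ->] := cpairE p1 pq (pPsi mu i h) pV.
Qed.

Lemma strong_convergence :
  (forall Y, vsobolev a b p k.+1 Y ->
     mx_norm1 (canonical_op a b t0 (A mu) (Psi mu) Y) @[mu --> mu0] --> (0 : R))
  <-> [/\ forall s, mx_norm1 (A mu s) @[mu --> mu0] --> (0 : R),
      exists C : R, \forall mu \near mu0, (mx_Lp_norm a b q (Psi mu) <= C%:E)%E &
      forall t, t \in `]a, b] ->
        mx_norm1 (mx_integral a t (Psi mu)) @[mu --> mu0] --> (0 : R)].
Proof.
split=> [st|[ca cb cc]]; last exact: weak_strong (bc_weak cb cc).
have wk := strong_weak st.
by split; [exact: strong_a|exact: weak_b|exact: weak_c].
Qed.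

End operator_families.

(** * Uniform convergence to zero *)

Section uniform_families.
Local Open Scope complex_scope.
Context (R : realType) (M : metricType R) (mu0 : M).
Variables (a b t0 p : R) (q : \bar R) (k l m : nat).
Hypotheses (ab : a < b) (p1 : 1 <= p) (pq : (p%:E^-1 + q^-1 = 1)%E).
Hypothesis t0ab : t0 \in `[a, b].
Notation leb := (@lebesgue_measure R).
Variables (A : M -> 'I_k.+1 -> 'M[R[i]]_(l, m)) (Psi : M -> R -> 'M[R[i]]_(l, m)).
Hypothesis pPsi : forall mu, mx_in_Lp a b q (Psi mu).

Let q1 : (1 <= q)%E. Proof. exact: conj_ge1 pq. Qed.
Let p1e : (1 <= p%:E)%E. Proof. by rewrite lee_fin. Qed.
Let FF : Filter (nbhs mu0) := nbhs_filter mu0.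
Let op mu := canonical_op a b t0 (A mu) (Psi mu).
Let unit_ball : set (R -> 'cV[R[i]]_m) :=
  [set Y | vsobolev a b p k.+1 Y /\ (sobolev_norm a b p k.+1 Y <= 1)%E].

Hypothesis op_bounded : forall mu, exists C : R, forall Y, unit_ball Y ->
  mx_norm1 (op mu Y) <= C.

Let opn mu := op_norm a b p k.+1 (op mu).
Let N mu := fine (mx_Lp_norm a b q (Psi mu)).

Let N0 mu : 0 <= N mu.
Proof.
rewrite /N fine_ge0//; apply: sume_ge0 => h _; apply: sume_ge0 => h' _.
exact: Lnorm_ge0.
Qed.

Let op_norm_ge mu Y i : unit_ball Y -> ((Normc.normc (op mu Y i 0))%:E <= opn mu)%E.
Proof.
move=> UY; apply: (@le_trans _ _ (mx_norm1 (op mu Y))%:E).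
  rewrite lee_fin /mx_norm1 (bigD1 i)//= big_ord1 lerDl.
  by apply: sumr_ge0 => h _; apply: sumr_ge0 => h' _; exact: normc_ge0.
by apply: ereal_sup_ubound; exists Y.
Qed.

Let uniform_a : opn mu @[mu --> mu0] --> 0%E ->
  forall s, mx_norm1 (A mu s) @[mu --> mu0] --> (0 : R).
Proof.
move=> cop s; apply/mx_norm1_cvg0 => i j0.
have sk : (s <= k)%N by rewrite -ltnS.
have [c c0 [y [Wy ny yt0 yk]]] := test_polynomial ab t0ab p1 sk.
have UY : unit_ball (evec j0 y).
  by split; [exact: evec_sobolev|rewrite evec_norm].
apply: (@ereal_cvg0_fine _ _ _ FF opn _ c^-1) cop => mu.
have := op_norm_ge mu i UY.
rewrite /op (canonical_op_polynomial ab p1 pq t0ab (A mu) i j0 (pPsi mu) Wy yt0 yk).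
rewrite Normc.normcM normc_real (gtr0_norm c0) ger0_norm ?normc_ge0// => le.
rewrite -lee_pdivrMl ?invr_gt0// invrK -EFinM mulrC.
exact: le.
Qed.

(** The zero function lies in the unit ball, so the supremum is not taken over the empty set, where
    it would be -oo. *)
Let opn_ge0 mu : (0 <= opn mu)%E.
Proof.
have zE (j : 'I_m) : (fun t : R => (0 : 'cV[R[i]]_m) j 0) = (fun=> 0).
  by apply/funext => t; rewrite mxE.
have U0 : unit_ball (fun=> 0).
  split.
    by move=> j; apply: (eq_ind_r (sobolev a b p k.+1) _ (zE j)); exact: sobolev0.
  rewrite /sobolev_norm big1// => s _; rewrite /mx_Lp_norm big1// => j _.
  rewrite big_ord1 -[RHS](Lp_norm_nderiv0 ab p1 s).
  by congr Lp_norm; apply/funext => t; rewrite /vderiv mxE zE.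
apply: (@le_trans _ _ (mx_norm1 (op mu (fun=> 0)))%:E).
  rewrite lee_fin; apply: sumr_ge0 => i _; apply: sumr_ge0 => j _.
  exact: normc_ge0.
by apply: ereal_sup_ubound; exists (fun=> 0).
Qed.

Let opnE mu : opn mu = (fine (opn mu))%:E.
Proof.
have [C hC] := op_bounded mu; rewrite fineK// ge0_fin_numE//.
apply: le_lt_trans (ltry C); apply/ereal_supP => _ [Y UY <-].
by rewrite lee_fin; exact: hC.
Qed.

Let op_norm_ge_val : exists2 c, 0 < c & forall mu i j,
  c * reval a b q (Psi mu) i j <= fine (opn mu) /\
  c * imval a b q (Psi mu) i j <= fine (opn mu).
Proof.
have mI : measurable (`[a, b]%classic : set R) by exact: measurable_itv.
have Ioo : (leb `[a, b]%classic < +oo)%E.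
  by rewrite lebesgue_measure_itv/= lte_fin ab -EFinD ltry.
have [c c0 test] := test_function_Lp ab t0ab p1 k.
exists c => // mu i j.
have tested f : Lp_fun leb p%:E f -> Lp_val leb p%:E f <= 1 ->
    c * pairing leb (recut a b (fun t => Psi mu t i j)) f <= fine (opn mu) /\
    c * pairing leb (imcut a b (fun t => Psi mu t i j)) f <= fine (opn mu).
  move=> pf nf; have [y [Wy ny yt0 yk]] := test f pf nf.
  have UY : unit_ball (evec j y).
    by split; [exact: evec_sobolev|rewrite evec_norm].
  have := op_norm_ge mu i UY; rewrite opnE lee_fin.
  rewrite /op (canonical_op_test ab p1 pq t0ab (A mu) i j (pPsi mu) Wy pf yt0 yk) => le.
  split; apply: le_trans le; apply: le_trans (ler_norm _) _.
    exact: (normc_ge_Re (_ +i* _)).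
  exact: (normc_ge_Im (_ +i* _)).
have dual phi : Lp_fun leb q phi -> (forall x, ~ `[a, b]%classic x -> phi x = 0) ->
    (forall f, Lp_fun leb p%:E f -> Lp_val leb p%:E f <= 1 ->
      c * pairing leb phi f <= fine (opn mu)) ->
    c * Lp_val leb q phi <= fine (opn mu).
  move=> pphi phi0 bd; rewrite leNgt; apply/negP => lt.
  have lt' : fine (opn mu) / c < Lp_val leb q phi by rewrite ltr_pdivrMr// mulrC.
  (* The midpoint leaves strict room on both sides: [dual_witness] needs a level below the norm, and
     the contradiction needs it above the operator bound. *)
  have [d1 d2] := midf_lt lt'.
  have [u [pu nu du]] := @dual_witness _ _ _ leb _ mI Ioo p q phi _ p1 pq pphi phi0 d2.
  have := bd u pu nu; apply/negP; rewrite -ltNge.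
  rewrite mulrC -ltr_pdivrMr//; exact: lt_le_trans d1 du.
split; apply: dual.
- by have [] := in_Lp_Re q1 (pPsi mu i j).
- by move=> x; exact: cut_out.
- by move=> f pf nf; case: (tested f pf nf).
- by have [] := in_Lp_Im q1 (pPsi mu i j).
- by move=> x; exact: cut_out.
- by move=> f pf nf; case: (tested f pf nf).
Qed.

Let NE mu : mx_Lp_norm a b q (Psi mu) = (N mu)%:E.
Proof. exact: mx_Lp_normE. Qed.

Let uniform_d : opn mu @[mu --> mu0] --> 0%E ->
  mx_Lp_norm a b q (Psi mu) @[mu --> mu0] --> 0%E.
Proof.
move=> cop; have [c c0 hc] := op_norm_ge_val.
have {}cop : fine (opn mu) @[mu --> mu0] --> (0 : R) by case/fine_cvgP : cop.
under eq_fun do rewrite NE.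
apply/EFin_cvg0.
(* Each entry contributes 1 / c for its real and 1 / c for its imaginary part. *)
pose K := \sum_(i < l) \sum_(j < m) (2 / c : R).
apply: (@cvg0_le _ _ _ FF _ (fun mu => K * fine (opn mu))); last exact: cvg0Z.
move=> mu; rewrite ger0_norm ?N0// -lee_fin -NE.
apply: le_trans (mx_Lp_norm_le q1 (pPsi mu)) _; rewrite lee_fin /K mulr_suml.
apply: ler_sum => i _; rewrite mulr_suml; apply: ler_sum => j _.
have [h1 h2] := hc mu i j.
rewrite mulrAC ler_pdivlMr// mulrC mulrDr.
by apply: le_trans (lerD h1 h2) _; rewrite mulrDl mul1r.
Qed.

(** For a fixed parameter the evaluation part is the operator minus its integral part, both bounded
    on the unit ball. The functionals [ell] do not involve the parameter, so [bounded_combinations]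
    supplies a single [K] for all of them. *)
Let op_le : exists2 K, 0 <= K & forall mu Y, unit_ball Y ->
  mx_norm1 (op mu Y) <= K * (\sum_(i < l) \sum_(x : 'I_k.+1 * 'I_m) Normc.normc (A mu x.1 i x.2))
    + (\sum_(i < l) \sum_(j < m) 4) * N mu.
Proof.
pose ell (x : 'I_k.+1 * 'I_m) (Y : {Y | unit_ball Y}) :=
  nderiv a b x.1 (fun u => sval Y u x.2 0) t0.
have [K K0 hK] := bounded_combinations ell (index_enum _).
exists K => // mu Y UY; have [WY nY] := UY.
have intle Y' i : unit_ball Y' ->
    Normc.normc (\sum_j cintegral a b (fun t => Psi mu t i j * vderiv a b k.+1 Y' t j 0)) <=
    (\sum_(j < m) 4) * N mu.
  move=> [WY' nY']; apply: le_trans (normc_sum_le _ _ _) _; rewrite mulr_suml.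
  apply: ler_sum => j _.
  have pV := vsobolev_in_Lp j WY'.
  apply: le_trans (cpair_le p1 pq (pPsi mu i j) pV) _; rewrite ler_pM2l//.
  rewrite -[leRHS]mulr1; apply: ler_pM.
  - by rewrite fine_ge0// Lnorm_ge0.
  - by rewrite fine_ge0// Lnorm_ge0.
  - exact: fine_Lp_norm_le.
  - rewrite -lee_fin fineK; last first.
      by rewrite ge0_fin_numE ?Lnorm_ge0//; case: pV.
    apply: le_trans nY'; rewrite /sobolev_norm big_ord_recr/=.
    apply: (@le_trans _ _ (mx_Lp_norm a b p%:E (vderiv a b k.+1 Y'))).
      exact: (mx_Lp_norm_ge a b p%:E (vderiv a b k.+1 Y') j 0).
    rewrite leeDr//; apply: sume_ge0 => s _.
    by apply: sume_ge0 => h _; apply: sume_ge0 => h' _; exact: Lnorm_ge0.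
have opE i (Y' : R -> 'cV[R[i]]_m) (UY' : unit_ball Y') : op mu Y' i 0 =
    \sum_(x : 'I_k.+1 * 'I_m) A mu x.1 i x.2 * ell x (exist _ Y' UY') +
    \sum_j cintegral a b (fun t => Psi mu t i j * vderiv a b k.+1 Y' t j 0).
  rewrite /op (canonical_opE t0 p1 pq (A mu) i (pPsi mu) UY'.1); congr (_ + _).
  by rewrite pair_bigA.
rewrite /mx_norm1 mulr_sumr mulr_suml -big_split; apply: ler_sum => i _ /=.
rewrite big_ord1 (opE i Y UY).
apply: le_trans (normcD_le _ _) _; apply: lerD; last exact: intle.
apply: hK.
have [C hC] := op_bounded mu.
exists (C + (\sum_(j < m) 4) * N mu) => -[Y' UY'].
have -> : \sum_(x : 'I_k.+1 * 'I_m) A mu x.1 i x.2 * ell x (exist _ Y' UY') =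
    op mu Y' i 0 -
    \sum_j cintegral a b (fun t => Psi mu t i j * vderiv a b k.+1 Y' t j 0).
  by rewrite (opE i Y' UY') addrK.
apply: le_trans (normcB_le _ _) _; apply: lerD; last exact: intle.
rewrite -lee_fin; apply: le_trans (op_norm_ge mu i UY') _.
by apply/ereal_supP => _ [Y2 UY2 <-]; rewrite lee_fin; exact: hC.
Qed.

Let ad_uniform : (forall s, mx_norm1 (A mu s) @[mu --> mu0] --> (0 : R)) ->
  mx_Lp_norm a b q (Psi mu) @[mu --> mu0] --> 0%E -> opn mu @[mu --> mu0] --> 0%E.
Proof.
move=> ca cd; have [K K0 hK] := op_le.
have cN : N mu @[mu --> mu0] --> (0 : R) by case/fine_cvgP : cd.
under eq_fun do rewrite opnE.
apply/EFin_cvg0.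
pose bound mu := K * (\sum_(i < l) \sum_(x : 'I_k.+1 * 'I_m) Normc.normc (A mu x.1 i x.2))
    + (\sum_(i < l) \sum_(j < m) 4) * N mu.
apply: (@cvg0_le _ _ _ FF _ bound) => [mu|].
  rewrite ger0_norm ?fine_ge0// -lee_fin -opnE; apply/ereal_supP => _ [Y UY <-].
  by rewrite lee_fin; exact: hK.
apply: cvg0D; apply: cvg0Z => //.
apply: cvg0_sum => i; apply: cvg0_sum => x.
exact: (@mx_norm1_cvg0 _ _ _ FF _ _ _).1 (ca x.1) i x.2.
Qed.

Lemma uniform_convergence :
  op_norm a b p k.+1 (canonical_op a b t0 (A mu) (Psi mu)) @[mu --> mu0] --> 0%E <->
  (forall s, mx_norm1 (A mu s) @[mu --> mu0] --> (0 : R)) /\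
  mx_Lp_norm a b q (Psi mu) @[mu --> mu0] --> 0%E.
Proof.
split=> [cop|[ca cd]]; last exact: ad_uniform.
by split; [exact: uniform_a|exact: uniform_d].
Qed.

End uniform_families.

(** * Differences of kernels *)

Section differences.
Context (R : realType).
Variables (a b : R) (q : \bar R) (k l : nat).
Hypothesis q1 : (1 <= q)%E.
Notation leb := (@lebesgue_measure R).
Implicit Types (F G H : R -> 'M[R[i]]_(k, l)).

Lemma mx_in_LpB F G : mx_in_Lp a b q F -> mx_in_Lp a b q G ->
  mx_in_Lp a b q (fun t => F t - G t).
Proof.
move=> pF pG i j; have := in_LpB q1 (pF i j) (pG i j); congr in_Lp.
by apply/funext => t; rewrite !mxE.
Qed.

(** With a pointwise hypothesis, one lemma serves both the passage from a kernel to its difference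
    with a fixed kernel and the way back. *)
Lemma mx_Lp_norm_triangle F G H : mx_in_Lp a b q F -> mx_in_Lp a b q G ->
  mx_in_Lp a b q H ->
  (forall t i j, Normc.normc (H t i j) <= Normc.normc (F t i j) + Normc.normc (G t i j)) ->
  (mx_Lp_norm a b q H <= mx_Lp_norm a b q F + mx_Lp_norm a b q G)%E.
Proof.
move=> pF pG pH HFG; rewrite /mx_Lp_norm -big_split; apply: lee_sum => i _ /=.
rewrite -big_split; apply: lee_sum => j _ /=.
have nF := in_Lp_Lp_fun (pF i j); have nG := in_Lp_Lp_fun (pG i j).
have [mH _] := in_Lp_Lp_fun (pH i j).
have [pD nD] := @Lp_funD _ _ _ leb q _ _ q1 nF nG.
have HD : {ae leb, forall t,
    `|Normc.normc (H t i j) * \1_(`[a, b]%classic) t| <=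
    `|Normc.normc (F t i j) * \1_(`[a, b]%classic) t +
      Normc.normc (G t i j) * \1_(`[a, b]%classic) t|}.
  apply: aeW => t; rewrite -mulrDl !normrM ler_wpM2r//.
  by rewrite !ger0_norm ?addr_ge0 ?normc_ge0.
have [pHn nH] := @Lp_fun_le _ _ _ leb q _ _ q1 mH pD HD.
have E K : Lp_fun leb q (fun t => Normc.normc (K t i j) * \1_(`[a, b]%classic) t) ->
    Lp_norm a b q (fun t => K t i j) =
    (Lp_val leb q (fun t => Normc.normc (K t i j) * \1_(`[a, b]%classic) t))%:E.
  by move=> pK; rewrite -(@Lp_valE _ _ _ leb q _ pK).
rewrite (E H pHn) (E F nF) (E G nG) -EFinD lee_fin.
exact: le_trans nH nD.
Qed.

(** Integrability over [a, t] comes from Hölder's inequality with the indicator of [a, t], an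
    element of L_p. *)
Lemma mx_integralB (p t : R) F G : 1 <= p -> (p%:E^-1 + q^-1 = 1)%E ->
  a < t <= b -> mx_in_Lp a b q F -> mx_in_Lp a b q G ->
  mx_integral a t F - mx_integral a t G = mx_integral a t (fun x => F x - G x).
Proof.
move=> p1 pq /andP[at_ tb] pF pG.
have pI : Lp_fun leb p%:E (\1_(`[a, t]%classic) : R -> R).
  apply: Lp_fun_indic => //.
  rewrite -[X in (X < _)%E]/(lebesgue_measure `[a, t]%classic).
  by rewrite lebesgue_measure_itv/= lte_fin at_ -EFinD ltry.
have int (u : R -> R) : Lp_fun leb q (cut a b u) ->
    leb.-integrable `[a, t] (EFin \o u).
  move=> pu; have := @pairing_integrable _ _ _ leb p q _ _ p1 pq pI pu.
  move=> iu; apply/integrable_mkcond => //; move: iu; rewrite restrict_EFin.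
  congr (integrable _ _ _); congr (_ \o _); rewrite patch_indic.
  apply/funext => x; rewrite /= indicE; have [xt|xt] := pselect (`[a, t]%classic x).
    rewrite cut_in//; move: xt; rewrite /= !in_itv/= => /andP[-> xt].
    exact: le_trans xt tb.
  by rewrite memNset// !mulr0.
apply/matrixP => i j; rewrite !mxE /cintegral.
have [pF1 _] := in_Lp_Re q1 (pF i j); have [pF2 _] := in_Lp_Im q1 (pF i j).
have [pG1 _] := in_Lp_Re q1 (pG i j); have [pG2 _] := in_Lp_Im q1 (pG i j).
have reE : \int[leb]_(x in `[a, t]) complex.Re ((F x - G x) i j) =
    \int[leb]_(x in `[a, t]) complex.Re (F x i j) -
    \int[leb]_(x in `[a, t]) complex.Re (G x i j).
  rewrite -RintegralB//; [|exact: int|exact: int].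
  by apply: eq_Rintegral => x _; rewrite !mxE; case: (F x i j); case: (G x i j).
have imE : \int[leb]_(x in `[a, t]) complex.Im ((F x - G x) i j) =
    \int[leb]_(x in `[a, t]) complex.Im (F x i j) -
    \int[leb]_(x in `[a, t]) complex.Im (G x i j).
  rewrite -RintegralB//; [|exact: int|exact: int].
  by apply: eq_Rintegral => x _; rewrite !mxE; case: (F x i j); case: (G x i j).
by rewrite reE imE.
Qed.

End differences.

(** * From differences back to the given operators *)

Section canonical_representations.
Context (R : realType) (M : metricType R) (mu0 : M).
Variables (a b t0 p : R) (q : \bar R) (k l m : nat).
Hypotheses (ab : a < b) (p1 : 1 <= p) (pq : (p%:E^-1 + q^-1 = 1)%E).
Hypothesis t0ab : t0 \in `[a, b].
Variable B : M -> (R -> 'cV[R[i]]_m) -> 'cV[R[i]]_l.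
Hypothesis hB : forall mu, bounded_linear a b p k.+1 (B mu).
Variables (alpha : M -> 'I_k.+1 -> 'M[R[i]]_(l, m)) (Phi : M -> R -> 'M[R[i]]_(l, m)).
Hypothesis hPhi : forall mu, mx_in_Lp a b q (Phi mu).
Hypothesis hrepr : forall mu, canonical_repr a b p t0 (B mu) (alpha mu) (Phi mu).

Let q1 : (1 <= q)%E. Proof. exact: conj_ge1 pq. Qed.
Let A mu s := alpha mu s - alpha mu0 s.
Let Psi mu t := Phi mu t - Phi mu0 t.

Let pPsi mu : mx_in_Lp a b q (Psi mu).
Proof. exact: mx_in_LpB. Qed.

Let BE mu y : vsobolev a b p k.+1 y ->
  B mu y - B mu0 y = canonical_op a b t0 (A mu) (Psi mu) y.
Proof.
move=> Wy; apply: (etrans _ (canonical_opB t0 p1 pq (alpha mu) (alpha mu0)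
  (hPhi mu) (hPhi mu0) Wy)).
exact: (congr2 (fun u v => u - v) (@hrepr mu y Wy) (@hrepr mu0 y Wy)).
Qed.

Let op_normE mu : op_norm a b p k.+1 (fun y => B mu y - B mu0 y) =
  op_norm a b p k.+1 (canonical_op a b t0 (A mu) (Psi mu)).
Proof.
rewrite /op_norm; congr ereal_sup; apply/seteqP.
by split=> _ [y [Wy ny] <-]; exists y => //; rewrite (BE mu Wy).
Qed.

Let mx_norm1B_le (u v : 'cV[R[i]]_l) : mx_norm1 (u - v) <= mx_norm1 u + mx_norm1 v.
Proof.
rewrite /mx_norm1 -big_split; apply: ler_sum => i _ /=.
rewrite -big_split; apply: ler_sum => j _ /=.
by rewrite !mxE normcB_le.
Qed.

Let op_bounded mu : exists C : R, forall Y,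
  [set Y | vsobolev a b p k.+1 Y /\ (sobolev_norm a b p k.+1 Y <= 1)%E] Y ->
  mx_norm1 (canonical_op a b t0 (A mu) (Psi mu) Y) <= C.
Proof.
have bd nu : exists C : R, forall Y,
    vsobolev a b p k.+1 Y -> (sobolev_norm a b p k.+1 Y <= 1)%E -> mx_norm1 (B nu Y) <= C.
  have [_ [C hC]] := hB nu; exists `|C| => Y WY nY.
  rewrite -lee_fin; apply: le_trans (hC Y WY) _.
  have n0 : (0 <= sobolev_norm a b p k.+1 Y)%E.
    apply: sume_ge0 => s _; apply: sume_ge0 => i _; apply: sume_ge0 => j _.
    exact: Lnorm_ge0.
  apply: (@le_trans _ _ (`|C|%:E * sobolev_norm a b p k.+1 Y)%E).
    by apply: lee_wpmul2r => //; rewrite lee_fin ler_norm.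
  by rewrite -[leRHS]mule1; apply: lee_wpmul2l => //; rewrite lee_fin.
have [C1 h1] := bd mu; have [C2 h2] := bd mu0.
exists (C1 + C2) => Y [WY nY]; rewrite -(BE mu WY).
by apply: le_trans (mx_norm1B_le _ _) _; apply: lerD; [exact: h1|exact: h2].
Qed.

(** [Phi mu] and [Psi mu] differ by [Phi mu0], whose finite norm is added to the bound in either
    direction. *)
Let cond_bE :
  (exists C : R, \forall mu \near mu0, (mx_Lp_norm a b q (Phi mu) <= C%:E)%E) <->
  (exists C : R, \forall mu \near mu0, (mx_Lp_norm a b q (Psi mu) <= C%:E)%E).
Proof.
have E0 := mx_Lp_normE q1 (hPhi mu0).
split=> -[C hC]; exists (C + fine (mx_Lp_norm a b q (Phi mu0)));
    apply: filterS hC => mu hmu; rewrite EFinD -E0.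
  apply: le_trans (leeD hmu (lexx _)).
  apply: (mx_Lp_norm_triangle q1 (hPhi mu) (hPhi mu0) (pPsi mu)) => t i j.
  by rewrite /Psi !mxE normcB_le.
apply: le_trans (leeD hmu (lexx _)).
apply: (mx_Lp_norm_triangle q1 (pPsi mu) (hPhi mu0) (hPhi mu)) => t i j.
by rewrite /Psi !mxE -{1}(subrK (Phi mu0 t i j) (Phi mu t i j)) normcD_le.
Qed.

Lemma canonical_repr_convergence :
  let cond_a := forall s, mx_cvg (fun mu => alpha mu s) mu0 in
  let cond_b := exists C : R, \forall mu \near mu0,
    (mx_Lp_norm a b q (Phi mu) <= C%:E)%E in
  let cond_c := forall t, t \in `]a, b] ->
    mx_cvg (fun mu => mx_integral a t (Phi mu)) mu0 in
  let cond_d :=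
    mx_Lp_norm a b q (fun t => Phi mu t - Phi mu0 t) @[mu --> mu0] --> 0%E in
  ((forall y, vsobolev a b p k.+1 y -> mx_cvg (fun mu => B mu y) mu0)
     <-> [/\ cond_a, cond_b & cond_c]) /\
  (op_norm a b p k.+1 (fun y => B mu y - B mu0 y) @[mu --> mu0] --> 0%E
     <-> cond_a /\ cond_d).
Proof.
move=> cond_a cond_b cond_c cond_d.
have [st1 st2] := strong_convergence mu0 ab p1 pq t0ab A pPsi.
have cE t : t \in `]a, b] -> forall mu,
    mx_norm1 (mx_integral a t (Phi mu) - mx_integral a t (Phi mu0)) =
    mx_norm1 (mx_integral a t (Psi mu)).
  by rewrite in_itv/= => tab mu; rewrite (mx_integralB q1 p1 pq tab (hPhi mu) (hPhi mu0)).
split; last first.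
  under eq_fun do rewrite op_normE.
  exact: (uniform_convergence mu0 ab p1 pq t0ab pPsi op_bounded).
split=> [st|[ca cb cc]].
- have [|ca cb cc] := st1.
    by move=> Y WY; apply: (cvg0_eq _ (st Y WY)) => mu; rewrite (BE mu WY).
  split=> //; first exact/cond_bE.
  by move=> t tab; apply: (cvg0_eq _ (cc t tab)) => mu; rewrite cE.
- have cc' t : t \in `]a, b] -> mx_norm1 (mx_integral a t (Psi mu)) @[mu --> mu0] --> (0 : R).
    by move=> tab; apply: (cvg0_eq _ (cc t tab)) => mu; rewrite cE.
  move=> y Wy; apply: (cvg0_eq _ (st2 (And3 ca (cond_bE.1 cb) cc') y Wy)) => mu.
  by rewrite (BE mu Wy).
Qed.

End canonical_representations.

Theorem theorem3p3 (R : realType) (a b : R) (hab : a < b)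
    (n m r : nat) (hm : (0 < m)%N) (hr : (0 < r)%N)
    (M : metricType R) (mu0 : M)
    (p : R) (p' : \bar R) (hp : 1 <= p)
    (hpp' : (p%:E^-1 + p'^-1 = 1)%E)
    (t0 : R) (ht0 : t0 \in `[a, b])
    (B : M -> (R -> 'cV[R[i]]_m) -> 'cV[R[i]]_(r * m))
    (hB : forall mu, bounded_linear a b p (n + r) (B mu))
    (alpha : M -> 'I_(n + r) -> 'M[R[i]]_(r * m, m))
    (Phi : M -> R -> 'M[R[i]]_(r * m, m))
    (hPhi : forall mu, mx_in_Lp a b p' (Phi mu))
    (hrepr : forall mu, canonical_repr a b p t0 (B mu) (alpha mu) (Phi mu)) :
  let cond_a := forall s, mx_cvg (fun mu => alpha mu s) mu0 in
  let cond_b := exists C : R, \forall mu \near mu0,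
    (mx_Lp_norm a b p' (Phi mu) <= C%:E)%E in
  let cond_c := forall t, t \in `]a, b] ->
    mx_cvg (fun mu => mx_integral a t (Phi mu)) mu0 in
  let cond_d :=
    mx_Lp_norm a b p' (fun t => Phi mu t - Phi mu0 t) @[mu --> mu0] --> 0%E in
  ((forall y, vsobolev a b p (n + r) y -> mx_cvg (fun mu => B mu y) mu0)
     <-> [/\ cond_a, cond_b & cond_c]) /\
  (op_norm a b p (n + r) (fun y => B mu y - B mu0 y) @[mu --> mu0] --> 0%E
     <-> cond_a /\ cond_d).
Proof.
(* Positivity of r makes the order a successor; in order 0 the space would be L_p, whose members
   have no point values. *)
have nr : (0 < n + r)%N by rewrite addn_gt0 hr orbT.
move: nr hB alpha hrepr; case: (n + r)%N => // k _ hB' alpha hrepr.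
exact: (canonical_repr_convergence mu0 hab hp hpp' ht0 hB' hPhi hrepr).
Qed.
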